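(* Let $\mathcal G$ be a finite weighted multigraph satisfying: (A.1) the random walk on $\mathcal G$ is irreducible; (A.2) $\mathcal G$ has at least two distinct oriented cycles which are not each other's inverse. Let $h$ be the entropy of the universal cover of $\mathcal G$. Let $(\mathcal G_n)_{n\ge1}$ be any deterministic sequence such that $\mathcal G_n$ is an $n$-lift of $\mathcal G$, and for $\varepsilon\in(0,1)$ let $t^{(n)}_{min}(\varepsilon)=\min_{x\in V_n}t_x^{(n)}(\varepsilon)$ be the best-case $\varepsilon$-mixing time of the random walk on $\mathcal G_n$. Then for every $\varepsilon\in(0,1)$ there exist $K\ge0$ and $n_0$ such that for all $n\ge n_0$, $$t^{(n)}_{min}(\varepsilon)\ \ge\ h^{-1}\log n-K\sqrt{\log n}.$$
   Context: **Weighted multigraph and random walk.** $\mathcal G$ is a finite multigraph (multiple edges and multiple loops allowed) with vertex set $V$ and edge set $E$. Every edge (loops included) gives rise to two opposite oriented edges; $\vec E$ is the set of oriented edges and $\vec e^{\,-1}$ is the opposite of $\vec e$. Each $\vec e\in\vec E$ has a weight $w(\vec e)\ge 0$ such that every edge has at least one orientation with positive weight, and for each $u\in V$ the weights of the oriented edges going out of $u$ sum to $1$. The random walk (RW) on such a weighted graph (finite or infinite) is the Markov chain on its vertices with transition matrix $P(u,v)=\frac12\mathbf 1_{\{u=v\}}+\frac12\sum_{\vec e:u\to v}w(\vec e)$, the sum being over oriented edges from $u$ to $v$. **Oriented cycles.** An oriented cycle of length $m\ge1$ is a cyclic order $C=(\vec e_1,\dots,\vec e_m)$ of $m$ (distinct)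 oriented edges with positive weight such that, for all $i$ mod $m$, the end vertex of $\vec e_i$ is the initial vertex of $\vec e_{i+1}$ and $\vec e_i\ne\vec e_{i+1}^{\,-1}$. Its inverse is $C^{-1}=(\vec e_m^{\,-1},\dots,\vec e_1^{\,-1})$. **Lifts.** An $n$-lift $\mathcal G_n$ of $\mathcal G$ has vertex set $V_n=V\times[n]$ (write $u_i=(u,i)$); for each $e\in E$ fix an ordering $(u,v)$ of its endpoints and a permutation $\sigma_e$ of $[n]$, and draw the edges $\{u_i,v_{\sigma_e(i)}\}$, $1\le i\le n$. Each oriented edge of $\mathcal G_n$ gets the weight of the corresponding oriented edge of $\mathcal G$ (its type). If $\pi$ is the invariant probability of the RW on $\mathcal G$, then $\pi_n(u_i)=\pi(u)/n$ is invariant for the RW on $\mathcal G_n$, whose transition matrix is denoted $P_n$. **Mixing times.** $t^{(n)}_x(\varepsilon)=\inf\{t\ge0:\|P_n^t(x,\cdot)-\pi_n\|_{TV}\le\varepsilon\}$ (total variation distance; $\inf\emptyset=+\infty$). **Universal cover and entropy.** Fix $v_*\in V$. The universal cover $(\mathcal T_{\mathcal G},\circ)$ is the rooted tree whose vertices are the finite non-backtracking paths in $\mathcal G$ starting at $v_*$ (paths $(\vec e_1,\dots,\vec e_m)$ with $\vec e_{i+1}\neq \vec e_i^{\,-1}$), the root $\circ$ being the empty path, with an edge between each path $p$ and each one-edge non-backtracking extension $p\vec e$; the oriented edge $(p,p\vec e)$ has label $\vec e$, its opposite has label $\vec e^{\,-1}$, and oriented edges carry the weights of their labels. $he(x)$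 is the graph distance from $\circ$ to $x$ in the tree, and $V_x$ is the set of vertices $y$ such that $x$ lies on the tree path from $\circ$ to $y$. Let $(\mathcal X_t)_{t\ge0}$ be the RW on $(\mathcal T_{\mathcal G},\circ)$ with $\mathcal X_0=\circ$. Under (A.1) and (A.2) it is transient; its ray to infinity is $\xi=\{x:\exists s\ge0,\ \mathcal X_s=x \text{ and } \mathcal X_t\in V_x\ \forall t\ge s\}$, and $\xi_k$ is the unique vertex of $\xi$ at height $k$. Put $W(x)=\mathbb P(x\in\xi)$. There are constants $s>0$, $h_W>0$, not depending on $v_*$, with $he(\mathcal X_t)/t\to s$ and $-\frac1k\log W(\xi_k)\to h_W$ in probability. The entropy of the universal cover is $h:=s\,h_W>0$ (when moreover all oriented edges of $\mathcal G$ have positive weight and each lies on an oriented cycle, $h$ is also the limit in probability of $-\frac1t\log W(\mathcal X_t)$). *)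

(* Defs.v *)
From HB Require Import structures.
From mathcomp Require Import all_boot all_order all_algebra fingroup perm.
From mathcomp Require Import all_classical all_reals all_analysis.

Set Implicit Arguments.
Unset Strict Implicit.
Unset Printing Implicit Defensive.

Import Order.TTheory GRing.Theory Num.Theory.
Import numFieldNormedType.Exports.

Local Open Scope classical_set_scope.
Local Open Scope ring_scope.

(* [ends e] is the ordering of the endpoints of [e] fixed once and for all.   *)
(* The oriented edges are the pairs [(e, b)]: [(e, true)] follows that        *)
(* ordering and [(e, false)] is its opposite, so that a loop also has two     *)
(* orientations.                                                              *)
Definition osrc (V E : Type) (ends : E -> V * V) (a : E * bool) : V :=
  if a.2 then (ends a.1).1 else (ends a.1).2.
Definition otgt (V E : Type) (ends : E -> V * V) (a : E * bool) : V :=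
  if a.2 then (ends a.1).2 else (ends a.1).1.
Definition oinv (E : Type) (a : E * bool) : E * bool := (a.1, ~~ a.2).

Record wmgraph (R : realType) := WMGraph {
  vertex : finType;
  edge : finType;
  ends : edge -> vertex * vertex;
  weight : edge * bool -> R;
  weight_ge0 : forall a, 0 <= weight a;
  weight_gt0 : forall e, (0 < weight (e, true)) || (0 < weight (e, false));
  weight_sum1 : forall u, \sum_(a | osrc ends a == u) weight a = 1
}.

Notation oedge G := (edge G * bool)%type.
Definition src (R : realType) (G : wmgraph R) (a : oedge G) : vertex G :=
  osrc (@ends R G) a.
Definition tgt (R : realType) (G : wmgraph R) (a : oedge G) : vertex G :=
  otgt (@ends R G) a.

(* Transition matrix of the random walk on a graph, finite or infinite:       *)
(* [arc x a y] says that there is an oriented edge labelled [a] from [x] to   *)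
(* [y], and [w] gives the weights of the labels.                              *)
Definition lazy_kernel (R : realType) (T : eqType) (A : finType)
    (arc : T -> A -> T -> bool) (w : A -> R) (x y : T) : R :=
  2^-1 * (x == y)%:R + 2^-1 * \sum_(a | arc x a y) w a.

Definition rw (R : realType) (G : wmgraph R) : vertex G -> vertex G -> R :=
  lazy_kernel (fun u (a : oedge G) v => (src a == u) && (tgt a == v))
    (@weight R G).

Fixpoint kernel_pow (R : realType) (T : finType) (p : T -> T -> R) (t : nat)
    (x y : T) : R :=
  if t is t'.+1 then \sum_z p x z * kernel_pow p t' z y else (x == y)%:R.

Definition irreducible (R : realType) (T : finType) (p : T -> T -> R) : Prop :=
  forall x y, exists t, 0 < kernel_pow p t x y.

Definition invariant_prob (R : realType) (T : finType) (p : T -> T -> R)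
    (pi : T -> R) : Prop :=
  [/\ forall x, 0 <= pi x, \sum_x pi x = 1
    & forall y, \sum_x pi x * p x y = pi y].

(* [nb_next a b]: the oriented edge [b] may follow [a] in a non-backtracking  *)
(* path. *)
Definition nb_next (R : realType) (G : wmgraph R) (a b : oedge G) : bool :=
  (tgt a == src b) && (b != oinv a).

(* An oriented cycle is represented by any of the sequences obtained by       *)
(* cutting the cyclic order open, hence is a sequence up to [same_cycle].     *)
Definition oriented_cycle (R : realType) (G : wmgraph R) (C : seq (oedge G)) :
    bool :=
  [&& (0 < size C)%N, uniq C, all (fun a => 0 < weight a) C
    & path.cycle (@nb_next R G) C].

Definition same_cycle (T : Type) (C C' : seq T) : Prop :=
  exists k, C' = rot k C.

Definition cycle_inv (E : Type) (C : seq (E * bool)) : seq (E * bool) :=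
  rev (map (@oinv E) C).

Definition two_cycles (R : realType) (G : wmgraph R) : Prop :=
  exists C C' : seq (oedge G),
    [/\ oriented_cycle C, oriented_cycle C', ~ same_cycle C C'
      & ~ same_cycle (cycle_inv C) C'].

Section Lift.
Variables (R : realType) (G : wmgraph R) (n : nat).
Variable sigma : edge G -> {perm 'I_n}.

Definition lift_ends (e : edge G * 'I_n) :
    (vertex G * 'I_n) * (vertex G * 'I_n) :=
  (((ends e.1).1, e.2), ((ends e.1).2, sigma e.1 e.2)).

Definition lift_weight (a : (edge G * 'I_n) * bool) : R :=
  weight (a.1.1, a.2).

Let lift_weight_ge0 a : 0 <= lift_weight a.
Proof. exact: weight_ge0. Qed.

Let lift_weight_gt0 e :
  (0 < lift_weight (e, true)) || (0 < lift_weight (e, false)).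
Proof. exact: weight_gt0. Qed.

Let lift_weight_sum1 u :
  \sum_(a | osrc lift_ends a == u) lift_weight a = 1.
Proof.
case: u => u i; rewrite -(weight_sum1 u).
pose f (a : oedge G) : (edge G * 'I_n) * bool :=
  ((a.1, if a.2 then i else (sigma a.1)^-1%g i), a.2).
pose g (a : (edge G * 'I_n) * bool) : oedge G := (a.1.1, a.2).
rewrite (reindex_onto f g) /=; last first.
  move=> [[e j] []]; rewrite /osrc /f /g /=.
    by move=> /eqP[_ ->].
  by move=> /eqP[_ <-]; rewrite permK.
apply: eq_big => [[e []]|[e b] _] //; rewrite /osrc /f /g /=.
  by rewrite xpair_eqE !eqxx !andbT.
by rewrite xpair_eqE permKV !eqxx !andbT.
Qed.

Definition lift_graph : wmgraph R := @WMGraph R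
  (vertex G * 'I_n)%type (edge G * 'I_n)%type lift_ends lift_weight
  lift_weight_ge0 lift_weight_gt0 lift_weight_sum1.

Definition lift_prob (pi : vertex G -> R) (x : vertex lift_graph) : R :=
  pi x.1 / n%:R.

End Lift.

Definition dTV (R : realType) (T : finType) (mu nu : T -> R) : R :=
  \big[Num.max/0]_(A : {set T}) `|\sum_(x in A) mu x - \sum_(x in A) nu x|.

Definition tmix (R : realType) (T : finType) (p : T -> T -> R) (pi : T -> R)
    (eps : R) (x : T) : \bar R :=
  ereal_inf [set (t%:R)%:E | t in
    [set t : nat | dTV (kernel_pow p t x) pi <= eps]].

Definition tmix_min (R : realType) (T : finType) (p : T -> T -> R)
    (pi : T -> R) (eps : R) : \bar R :=
  \big[Order.min/+oo%E]_(x : T) tmix p pi eps x.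

Section Cover.
Variables (R : realType) (G : wmgraph R) (v : vertex G).

Definition nb_path (p : seq (oedge G)) : bool :=
  (if p is a :: _ then src a == v else true) && sorted (@nb_next R G) p.

Definition ucover : Type := {p : seq (oedge G) | nb_path p}.

Definition cover_root : ucover := exist _ [::] isT.

Definition cover_arc (x : ucover) (a : oedge G) (y : ucover) : bool :=
  (val y == rcons (val x) a) || (val x == rcons (val y) (oinv a)).

Definition cover_rw : ucover -> ucover -> R :=
  lazy_kernel cover_arc (@weight R G).

(* [height x] is the graph distance from the root to [x] in the tree, and     *)
(* [subtree x] is the set of the [y] such that [x] lies on the tree path from *)
(* the root to [y]: see [height_dist] and [subtreeP] below.                   *)
Definition height (x : ucover) : nat := size (val x).
Definition subtree (x : ucover) : set ucover :=
  [set y | prefix (val x) (val y)].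

Definition cover_adj (x y : ucover) : bool := [exists a, cover_arc x a y].

Lemma cover_adj_prefix (x y : ucover) : cover_adj x y ->
  (exists a, val y = rcons (val x) a) \/ (exists a, val x = rcons (val y) a).
Proof.
by move=> /existsP[a /orP[]/eqP->]; [left; exists a|right; exists (oinv a)].
Qed.

Lemma nb_path_rcons p a : nb_path (rcons p a) -> nb_path p.
Proof.
case: p => [//|b p]; rewrite /nb_path /= rcons_path.
by move=> /and3P[-> -> _].
Qed.

Lemma cover_geodesic (x : ucover) : exists p : seq ucover,
  [/\ path cover_adj cover_root p, last cover_root p = x, size p = height x
    & forall y, y \in cover_root :: p -> prefix (val y) (val x)].
Proof.
case: x => q; elim/last_ind: q => [|q a IH] hq.
  exists [::]; split=> //=; first exact: val_inj.
  by move=> y; rewrite inE => /eqP->.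
have [p [p1 p2 p3 p4]] := IH (nb_path_rcons hq).
exists (rcons p (exist _ (rcons q a) hq)); split.
- rewrite rcons_path p1 p2 /=; apply/existsP; exists a.
  by rewrite /cover_arc /= eqxx.
- by rewrite last_rcons.
- by rewrite size_rcons p3 /height /= size_rcons.
- move=> y; rewrite -rcons_cons mem_rcons inE => /orP[/eqP->|/p4 h].
    exact: prefix_refl.
  exact: prefix_trans h (prefix_rcons q a).
Qed.

Lemma height_dist (x : ucover) :
  (exists p, [/\ path cover_adj cover_root p, last cover_root p = x
               & size p = height x]) /\
  (forall p, path cover_adj cover_root p -> last cover_root p = x ->
     (height x <= size p)%N).
Proof.
split; first by have [p [? ? ? _]] := cover_geodesic x; exists p.
move=> p; elim/last_ind: p x => [|p y IH] x; first by move=> _ <-.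
rewrite rcons_path last_rcons size_rcons => /andP[hp hy] <-.
apply: leq_trans (_ : (height (last cover_root p)).+1 <= _)%N; last first.
  by rewrite ltnS; exact: IH.
by case: (cover_adj_prefix hy) => -[a]; rewrite /height => ->;
  rewrite size_rcons // ltnW // ltnW.
Qed.

Lemma subtreeP (x y : ucover) :
  subtree x y <-> forall p, path cover_adj cover_root p ->
    last cover_root p = y -> x \in cover_root :: p.
Proof.
split; last first.
  move=> h; have [p [p1 p2 _ p4]] := cover_geodesic y.
  exact/p4/h.
move=> + p; elim/last_ind: p y => [|p z IH] y.
  rewrite /subtree /= => xy _ ry; subst y.
  move: xy; rewrite prefixs0 => /eqP x0.
  by rewrite inE; apply/eqP/val_inj.
rewrite rcons_path last_rcons => + /andP[hp hz] zy; subst z => xy.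
rewrite -rcons_cons mem_rcons inE; have [//|/= xNy] := eqVneq x y.
apply: (IH (last cover_root p)) => //; rewrite /subtree /=.
case: (cover_adj_prefix hz) => -[a ea]; last first.
  by rewrite ea; exact: prefix_trans xy (prefix_rcons _ a).
move: xy; rewrite /subtree /= ea => /prefixP[s].
case: (lastP s) => [|s' b].
  by rewrite cats0 -ea => /val_inj yx; rewrite yx eqxx in xNy.
by rewrite -rcons_cat => /rcons_inj[-> _]; exact: prefix_prefix.
Qed.

End Cover.

(* [X] is a Markov chain on a countable state space, started at [o], with     *)
(* transition matrix [p]; the conditional probabilities are multiplied out.   *)
Definition markov_chain (R : realType) (T : choiceType) (p : T -> T -> R)
    (o : T) (d : measure_display) (Omega : measurableType d)
    (P : probability Omega R) (X : nat -> Omega -> T) : Prop :=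
  [/\ forall t x, measurable [set w | X t w = x],
      P [set w | X 0%N w = o] = 1%E
    & forall t (x : nat -> T),
        P [set w | forall i, (i <= t.+1)%N -> X i w = x i] =
        (P [set w | forall i, (i <= t)%N -> X i w = x i] *
         (p (x t) (x t.+1))%:E)%E].

Definition cvg_in_probability (R : realType) (d : measure_display)
    (Omega : measurableType d) (P : probability Omega R)
    (Y : nat -> Omega -> R) (l : R) : Prop :=
  forall delta : R, 0 < delta ->
    P [set w | delta < `|Y n w - l|] @[n --> \oo] --> 0%E.

Section Entropy.
Variables (R : realType) (G : wmgraph R) (v : vertex G).
Variables (d : measure_display) (Omega : measurableType d).
Variables (P : probability Omega R) (X : nat -> Omega -> ucover v).

Definition ray (w : Omega) : set (ucover v) :=
  [set x | exists s : nat, X s w = x /\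
     forall t : nat, (s <= t)%N -> subtree x (X t w)].

(* The vertex of the ray at height [k]; it is unique when it exists, and the  *)
(* root is a dummy value on the null event where it does not.                 *)
Definition ray_vertex (k : nat) (w : Omega) : ucover v :=
  xget (cover_root v) [set x | ray w x /\ height x = k].

Definition ray_prob (x : ucover v) : R := fine (P [set w | ray w x]).

Definition is_entropy (h : R) : Prop :=
  exists s hW : R,
    [/\ 0 < s, 0 < hW,
        cvg_in_probability P (fun t w => (height (X t w))%:R / t%:R) s,
        cvg_in_probability P
          (fun k w => - (k%:R^-1 * ln (ray_prob (ray_vertex k w)))) hW
      & h = s * hW].

End Entropy.

(* Main.v *)
(* Started from (v, j), the walk on a lift is the image of the walk on the     *)
(* universal cover rooted at v. It therefore suffices to find sets B_t of at   *)
(* most exp (h t + A sqrt t) vertices of the tree containing the walk at time  *)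
(* t with probability at least 1 - delta: for t < h^-1 log n - K sqrt (log n)  *)
(* the image of B_t has a small mass under pi_n. By irreducibility the starts  *)
(* above the other vertices of G are reached in bounded time with a            *)
(* probability bounded away from 0.                                            *)
(*                                                                             *)
(* The labels of the ray form a Markov chain with finitely many states, with   *)
(* transition probabilities explicit in terms of the return probabilities r of *)
(* the edges, and - log W is additive along it. Given the ray, the last        *)
(* entrance times in its vertices are sums of independent variables, whose     *)
(* exponential moments are finite because Num.sqrt r is, up to a perturbation, *)
(* a strict supersolution of the walk. For an additive functional of a finite  *)
(* chain, convergence in probability of the averages makes the Poisson         *)
(* equation solvable, and then gives an error of order sqrt k at height k, by  *)
(* Azuma's argument. Hence at height about s t the ray is at a vertex with     *)
(* W >= exp (- h t - A sqrt t), entered during the last O(sqrt t) steps; as W  *)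
(* sums to 1 over a level, there are few such vertices.                        *)

Require Import Defs.
From mathcomp Require Import all_boot all_order all_algebra perm.
From mathcomp Require Import all_classical all_reals all_analysis.
From mathcomp Require Import ring lra zify.
Set Implicit Arguments.
Unset Strict Implicit.
Unset Printing Implicit Defensive.
Import Order.TTheory GRing.Theory Num.Theory.
Import numFieldNormedType.Exports.
Local Open Scope classical_set_scope.
Local Open Scope ring_scope.

(* [mathcomp.classical.functions] has an [oinv] of its own. *)
Local Notation oinv := (@Defs.oinv _).

(** * Return probabilities *)

Section RealSequences.
Variable R : realType.

(** The invariant law of a lift gives each vertex mass at most [1 / n], so a walk carried by at most
    [rho * n] vertices with large probability is not mixed. Whatever the permutations, the walk on
    the lift is the image of the walk on the tree under the covering map ([pr_proj]). Hence it is
    enough that the tree walk at time [t] is confined, up to small probability, to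
    [exp (h t + O (sqrt t))] vertices, which is [spread]. The transfer to all starting points and to
    the logarithmic time scale is done by [lift_backward], [mixed_not_confined] and [expR_deadline].

    The entropy controls only the leading order, through convergences in probability. The error of
    order [sqrt t] comes from the structure of the tree, which has finitely many types of cones.
    Decomposing trajectories at the last entrance in a cone ([J_last_entrance]) gives the joint law
    of the ray and of its last entrance times: the harmonic measure is a product of transition
    probabilities [ptr] ([ray_prob_W]), and each entrance time has an explicit generating function
    ([entry_exp]). So [- ln W] and the mean entrance time are additive functionals of one finite
    Markov chain. For these, convergence of the averages makes the Poisson equation solvable
    ([poisson]), and the resulting martingale has exponential bounds ([dev_exp]). This yields
    [W_tail] and [time_tail].

    The generating functions are finite because loops inside a cone have exponentially small
    probabilities ([g_decay]). This is delicate when some cones are recurrent, for instance finite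
    ones. Cycles of recurrent types would force the ray along a path where [W] is constant, which
    [hW > 0] excludes ([recurrent_cycle], [not_flat]). *)

Lemma cvg_rsum (I : Type) (s : seq I) (Q : pred I) (f : nat -> I -> R)
    (a : I -> R) :
  (forall i, Q i -> f n i @[n --> \oo] --> a i) ->
  \sum_(i <- s | Q i) f n i @[n --> \oo] --> \sum_(i <- s | Q i) a i.
Proof.
move=> fa; apply: (@cvg_big _ _ _ _ _ _ _ _ _ (fun i n => f n i)) => //.
exact: add_continuous.
Qed.

Lemma ndecr_homo (u : nat -> R) : (forall n, u n <= u n.+1) ->
  {homo u : m n / (m <= n)%N >-> m <= n}.
Proof. by move=> uS; apply: homo_leq => //; exact: le_trans. Qed.

Lemma ndecr_cvg_lim (u : nat -> R) (M : R) :
  (forall n, u n <= u n.+1) -> (forall n, u n <= M) ->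
  u n @[n --> \oo] --> limn u.
Proof.
move=> uS uM; apply: nondecreasing_is_cvgn.
  exact: ndecr_homo.
by exists M => _ [n _ <-].
Qed.

End RealSequences.

Section Stacks.
Variables (R : realType) (G : wmgraph R) (v : vertex G).
Local Notation O := (oedge G).
Local Notation w := (@weight R G).

(* A vertex of the tree is coded by the stack of its labels, last label first; *)
(* a type is the last label, [None] standing for the root.                     *)
Definition child (tau : option O) (b : O) : bool :=
  if tau is Some a then nb_next a b else src b == v.

Definition top (tau : option O) (l : seq O) : option O :=
  if l is c :: _ then Some c else tau.

Definition back (tau : option O) : R := if tau is Some c then w (oinv c) else 0.

(* One step of the walk in the cone below a vertex of type [tau], killed when  *)
(* it leaves the cone; stacks are relative to that vertex.                     *)
Definition cone_step (tau : option O) (u : seq O -> R) (l : seq O) : R :=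
  2^-1 * u l + 2^-1 * ((if l is c :: l' then w (oinv c) * u l' else 0) +
    \sum_(b | child (top tau l) b) w b * u (b :: l)).
Local Notation Lop := cone_step.

Lemma oinvK : involutive (oinv : edge G * bool -> edge G * bool).
Proof. by case=> e b; rewrite /Defs.oinv /= negbK. Qed.

Lemma src_oinv (a : O) : src (oinv a) = tgt a.
Proof. by case: a => e []. Qed.

Lemma tgt_oinv (a : O) : tgt (oinv a) = src a.
Proof. by case: a => e []. Qed.

Lemma wge0 (a : O) : 0 <= w a.
Proof. exact: weight_ge0. Qed.

Lemma sum_out u : \sum_(b | src b == u) w b = 1.
Proof. exact: weight_sum1. Qed.

Lemma sum_out_child (f : O -> R) a :
  \sum_(b | src b == tgt a) f b = f (oinv a) + \sum_(b | child (Some a) b) f b.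
Proof.
rewrite (bigD1 (oinv a)) /= ?src_oinv ?eqxx //; congr (_ + _).
by apply: eq_bigl => b; rewrite /nb_next eq_sym.
Qed.

Lemma sum_child tau : \sum_(b | child tau b) w b = 1 - back tau.
Proof.
case: tau => [a|] /=; last by rewrite subr0 sum_out.
by rewrite -(sum_out (tgt a)) sum_out_child addrC addKr.
Qed.

Lemma back_ge0 tau : 0 <= back tau.
Proof. by case: tau => [a|] //=; exact: wge0. Qed.

Lemma Lop_le tau (u u' : seq O -> R) l : (forall s, u s <= u' s) ->
  Lop tau u l <= Lop tau u' l.
Proof.
move=> uu'; rewrite /Lop lerD ?ler_wpM2l ?invr_ge0 // lerD //.
  by case: l => // c l; rewrite ler_wpM2l ?wge0.
by apply: ler_sum => b _; rewrite ler_wpM2l ?wge0.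
Qed.

Lemma eq_Lop tau (u u' : seq O -> R) l : (forall s, u s = u' s) ->
  Lop tau u l = Lop tau u' l.
Proof. by move=> /funext ->. Qed.

Lemma Lop_ge0 tau (u : seq O -> R) l : (forall s, 0 <= u s) ->
  0 <= Lop tau u l.
Proof.
move=> u0; apply: le_trans (Lop_le tau l u0); rewrite /Lop mulr0 add0r.
rewrite mulr_ge0 ?invr_ge0 // addr_ge0 //; first by case: l => [|c l]; rewrite ?mulr0 ?lexx.
by apply: sumr_ge0 => b _; rewrite mulr0.
Qed.

Lemma LopMr tau (u : seq O -> R) k l : Lop tau (fun s => u s * k) l =
  Lop tau u l * k.
Proof.
rewrite /Lop mulrDl !mulrA; congr (_ + _).
rewrite -mulrA; congr (_ * _); rewrite mulrDl; congr (_ + _).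
  by case: l => [|c l]; rewrite ?mul0r ?mulrA.
by rewrite mulr_suml; apply: eq_bigr => b _; rewrite mulrA.
Qed.

Lemma LopD tau (u u' : seq O -> R) l : Lop tau (fun s => u s + u' s) l =
  Lop tau u l + Lop tau u' l.
Proof.
have E : \sum_(b | child (top tau l) b) w b * (u (b :: l) + u' (b :: l)) =
    \sum_(b | child (top tau l) b) w b * u (b :: l) +
    \sum_(b | child (top tau l) b) w b * u' (b :: l).
  by rewrite -big_split; apply: eq_bigr => b _; rewrite mulrDr.
by rewrite /Lop E; case: l {E} => [|c l]; ring.
Qed.

Lemma Lop_sum tau (I : Type) (r : seq I) (Q : pred I) (u : I -> seq O -> R) l :
  Lop tau (fun s => \sum_(i <- r | Q i) u i s) l =
  \sum_(i <- r | Q i) Lop tau (u i) l.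
Proof.
elim: r => [|i r IH].
  rewrite big_nil -[RHS](mulr0 (Lop tau (fun=> 0) l)) -LopMr.
  by apply: eq_Lop => s; rewrite big_nil mulr0.
rewrite big_cons -IH; case: ifP => Qi.
  by rewrite -LopD; apply: eq_Lop => s; rewrite big_cons Qi.
by apply: eq_Lop => s; rewrite big_cons Qi.
Qed.

Lemma Lop1 tau l : Lop tau (fun=> 1) l = 1 - if l is [::] then 2^-1 * back tau
  else 0.
Proof.
rewrite /Lop; under eq_bigr do rewrite mulr1.
by rewrite sum_child; case: l => [|c l] /=; lra.
Qed.

Lemma Lop_cvg tau (u : nat -> seq O -> R) (u' : seq O -> R) l :
  (forall s, u n s @[n --> \oo] --> u' s) ->
  Lop tau (u n) l @[n --> \oo] --> Lop tau u' l.
Proof.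
move=> uu'; rewrite /Lop.
apply: (@cvgD _ _ _ _ _ (fun n => 2^-1 * u n l)).
  exact: cvgMl_tmp.
apply: cvgMl_tmp.
apply: (@cvgD _ _ _ _ _ (fun n => (if l is c :: l' then w (oinv c) * u n l' else 0))).
  case: l => [|c l]; first exact: cvg_cst.
  exact: cvgMl_tmp.
by apply: cvg_rsum => b _; exact: cvgMl_tmp.
Qed.

(* The probability that the walk pops the whole stack [l] within [t] steps.    *)
Fixpoint Hit (t : nat) (l : seq O) : R :=
  if l is [::] then 1 else if t is t'.+1 then Lop None (Hit t') l else 0.

Lemma Hit_nil t : Hit t [::] = 1. Proof. by case: t. Qed.

Lemma Hit_ge0 t l : 0 <= Hit t l.
Proof.
elim: t l => [|t IH] [|c l] //=; exact: Lop_ge0.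
Qed.

Lemma Hit_le1 t l : Hit t l <= 1.
Proof.
elim: t l => [|t IH] [|c l] //=.
by rewrite (le_trans (Lop_le None (c :: l) IH)) // Lop1 subr0.
Qed.

Lemma Hit_leS t l : Hit t l <= Hit t.+1 l.
Proof.
elim: t l => [|t IH] [|c l] //; first exact: Hit_ge0.
exact: Lop_le.
Qed.

(** Popping [l1 ++ l2] within [t] steps requires popping [l1] and then, from a fresh start, [l2],
    each within [t] steps. Together with [Hit_cat_ge], where the durations add up, this makes [hit]
    multiplicative in the limit. *)
Lemma Hit_cat_le t l1 l2 : Hit t (l1 ++ l2) <= Hit t l1 * Hit t l2.
Proof.
elim: t l1 => [|t IH] [|c l]; rewrite ?Hit_nil ?mul1r //=.
  by rewrite mul0r.
apply: (@le_trans _ _ (Lop None (fun s => Hit t s * Hit t l2) (c :: l))).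
  exact: (@Lop_le None (fun s => Hit t (s ++ l2)) _ (c :: l)).
by rewrite LopMr ler_wpM2l ?Lop_ge0// => [s|]; [exact: Hit_ge0|exact: Hit_leS].
Qed.

Lemma Hit_cat_ge t s0 l1 l2 :
  Hit t l1 * Hit s0 l2 <= Hit (t + s0) (l1 ++ l2).
Proof.
elim: t l1 => [|t IH] [|c l]; rewrite ?Hit_nil ?mul1r //.
- by rewrite mul0r Hit_ge0.
- exact: (@ndecr_homo _ (fun n => Hit n l2) (fun n => Hit_leS n l2) _ _
    (leq_addl _ _)).
- apply: (@le_trans _ _ (Lop None (fun s => Hit t s * Hit s0 l2) (c :: l))).
    by rewrite LopMr.
  exact: (@Lop_le None _ (fun s => Hit (t + s0) (s ++ l2)) (c :: l)).
Qed.

Definition hit (l : seq O) : R := limn (fun t => Hit t l).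

Lemma Hit_cvg l : Hit t l @[t --> \oo] --> hit l.
Proof.
by apply: (@ndecr_cvg_lim _ _ 1) => t; [exact: Hit_leS|exact: Hit_le1].
Qed.

Lemma Hit_le_hit t l : Hit t l <= hit l.
Proof.
apply: (@nondecreasing_cvgn_le _ (fun t => Hit t l)).
  exact: ndecr_homo (fun n => Hit_leS n l).
exact: cvgP (@Hit_cvg l).
Qed.

Lemma hit_le1 l : hit l <= 1.
Proof.
apply: (cvgr_to_le (@Hit_cvg l)); apply: nearW => t; exact: Hit_le1.
Qed.

Lemma hit_ge0 l : 0 <= hit l.
Proof. exact: le_trans (Hit_ge0 0 l) (Hit_le_hit 0 l). Qed.

Lemma hit_nil : hit [::] = 1.
Proof.
by apply/le_anti; rewrite hit_le1 -[1 in X in _ && X](Hit_nil 0) Hit_le_hit.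
Qed.

Lemma hit_cat l1 l2 : hit (l1 ++ l2) = hit l1 * hit l2.
Proof.
have M : Hit t l1 * Hit t l2 @[t --> \oo] --> hit l1 * hit l2.
  by apply: cvgM; exact: Hit_cvg.
apply/le_anti/andP; split.
  apply: ler_cvg_to (@Hit_cvg _) M _; apply: nearW => t.
  exact: Hit_cat_le.
apply: (cvgr_to_le M); apply: nearW => t.
exact: le_trans (Hit_cat_ge t t l1 l2) (Hit_le_hit _ _).
Qed.

Definition return_prob (a : O) : R := hit [:: a].
Local Notation r := return_prob.
Definition no_return (a : O) : R := 1 - r a.
Local Notation q := no_return.
(** Half of this is the inverse of the Green function at the apex of a cone of type [tau]
    ([cvg_sum_g]); the half is due to laziness. *)
Definition green_inv (tau : option O) : R := 1 - \sum_(b | child tau b) w b * r b.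
Local Notation D := green_inv.

Lemma r_ge0 a : 0 <= r a. Proof. exact: hit_ge0. Qed.
Lemma r_le1 a : r a <= 1. Proof. exact: hit_le1. Qed.
Lemma q_ge0 a : 0 <= q a. Proof. by rewrite subr_ge0 r_le1. Qed.
Lemma hit_prod l : hit l = \prod_(c <- l) r c.
Proof.
elim: l => [|c l IH]; first by rewrite big_nil hit_nil.
by rewrite big_cons -IH -hit_cat.
Qed.

Lemma hit_cons c l : hit (c :: l) = r c * hit l.
Proof. by rewrite !hit_prod big_cons. Qed.

Lemma hit_Lop c l tau : hit (c :: l) = Lop tau hit (c :: l).
Proof.
have /cvg_lim <- // := @Hit_cvg (c :: l).
apply: cvg_lim => //.
rewrite -(cvg_shiftS (fun t => Hit t (c :: l))) /=.
by apply: Lop_cvg => s; exact: Hit_cvg.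
Qed.

Lemma sum_wr_le1 tau : \sum_(b | child tau b) w b * r b <= 1 - back tau.
Proof.
rewrite -sum_child; apply: ler_sum => b _.
by rewrite ler_piMr ?wge0 ?r_le1.
Qed.

Lemma D_ge0 tau : 0 <= D tau.
Proof. have := sum_wr_le1 tau; have := back_ge0 tau; rewrite /D; lra. Qed.

Lemma D_le1 tau : D tau <= 1.
Proof.
by rewrite gerBl sumr_ge0 // => b _; rewrite mulr_ge0 ?wge0 ?r_ge0.
Qed.

(** The first-step equation for [r a], solved: the walk goes back at once, or it visits a child,
    returns with probability [r b], and starts afresh. *)
Lemma Dr a : D (Some a) * r a = w (oinv a).
Proof.
have := hit_Lop a [::] None; rewrite /Lop hit_nil mulr1 -/(r a) [top _ _]/=.
under eq_bigr do rewrite hit_cons mulrA.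
by rewrite -mulr_suml -/(r a) /D; lra.
Qed.

Lemma sum_wq tau : \sum_(b | child tau b) w b * q b = D tau - back tau.
Proof.
rewrite /D; under eq_bigr do rewrite mulrBr mulr1.
by rewrite sumrB sum_child; lra.
Qed.

Lemma sum_wq_Some a : \sum_(b | child (Some a) b) w b * q b = D (Some a) * q a.
Proof. by rewrite sum_wq /= -Dr /q; lra. Qed.

(** Since [r] depends on the label and not on the root, it also makes sense for the edge pointing
    back to the root. Up to laziness this is the probability that the walk on the cover rooted at
    [u] never returns to its root. *)
Definition vertex_escape (u : vertex G) : R := 1 - \sum_(b | src b == u) w b * r b.
Local Notation escape := vertex_escape.

Lemma escape_ge0 u : 0 <= escape u.
Proof.
rewrite subr_ge0 -(sum_out u); apply: ler_sum => b _.
by rewrite ler_piMr ?wge0 ?r_le1.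
Qed.

Lemma D_escape a : D (Some a) = escape (tgt a) + w (oinv a) * r (oinv a).
Proof. by rewrite /escape sum_out_child /D; lra. Qed.

Lemma escape0 u b : escape u = 0 -> src b = u -> 0 < w b -> r b = 1.
Proof.
move=> e0 bu wb0.
have : \sum_(b | src b == u) w b * q b = 0.
  under eq_bigr do rewrite mulrBr mulr1.
  by rewrite sumrB sum_out; exact: e0.
move/psumr_eq0P => /(_ (fun b _ => mulr_ge0 (wge0 b) (q_ge0 b))) /(_ b).
rewrite bu eqxx => /(_ isT) /eqP; rewrite mulf_eq0 gt_eqF //= subr_eq0.
by move/eqP.
Qed.

Lemma escape_eq0 u : (forall b, src b = u -> 0 < w b -> r b = 1) -> escape u = 0.
Proof.
move=> h; rewrite /escape -{1}(sum_out u) -sumrB big1 // => b /eqP bu.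
have := wge0 b; rewrite le_eqVlt => /orP[/eqP<-|/(h _ bu) ->].
  by rewrite mul0r subr0.
by rewrite mulr1 subrr.
Qed.

Lemma r1_child a b : r a = 1 -> child (Some a) b -> 0 < w b -> r b = 1.
Proof.
move=> ra1 ab wb0.
have : \sum_(b | child (Some a) b) w b * q b = 0.
  by rewrite sum_wq_Some /q ra1 subrr mulr0.
move/psumr_eq0P => /(_ (fun b _ => mulr_ge0 (wge0 b) (q_ge0 b))) /(_ b ab) /eqP.
by rewrite mulf_eq0 gt_eqF //= subr_eq0 => /eqP.
Qed.

(** Recurrence propagates along an edge of positive weight. The cone below [a] is recurrent, hence
    so are those of its children, and [Dr] at the opposite edge forces [r (oinv a) = 1]. By
    irreducibility [vertex_escape] is then zero everywhere or positive everywhere. *)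
Lemma escape0_step a : escape (src a) = 0 -> 0 < w a -> escape (tgt a) = 0.
Proof.
move=> e0 wa0; have ra1 := escape0 e0 erefl wa0.
have D0 : D (Some (oinv a)) = w a.
  rewrite D_escape tgt_oinv e0 add0r oinvK ra1 mulr1 //.
apply: escape_eq0 => b ba wb0.
have [bia|bia] := eqVneq b (oinv a); last first.
  by apply: (r1_child ra1 _ wb0); rewrite /= /nb_next ba eqxx.
have := Dr (oinv a); rewrite D0 oinvK bia => /(canRL (mulKf _)) ->.
  by rewrite mulVf ?gt_eqF.
by rewrite gt_eqF.
Qed.

Lemma rw_step x y : rw x y != 0 -> x = y \/
  exists a : O, [/\ src a = x, tgt a = y & 0 < w a].
Proof.
rewrite /rw /lazy_kernel; have [->|xy] := eqVneq x y; first by left.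
rewrite mulr0 add0r => h; right; apply: contrapT => nex.
move/eqP: h; apply; rewrite big1 ?mulr0 // => a /andP[/eqP ax /eqP ay].
apply/eqP; rewrite eq_le wge0 andbT leNgt; apply/negP => wa.
by apply: nex; exists a.
Qed.

Lemma rw_ge0 x y : 0 <= @rw R G x y.
Proof.
rewrite /rw /lazy_kernel addr_ge0 // mulr_ge0 ?invr_ge0 //.
by apply: sumr_ge0 => a _; exact: wge0.
Qed.

Lemma kernel_pow_rw_ge0 t x y : 0 <= kernel_pow (@rw R G) t x y.
Proof.
elim: t x => [|t IH] x //=; apply: sumr_ge0 => z _.
by rewrite mulr_ge0 // rw_ge0.
Qed.

Lemma kernel_pow_gt0 t x y : 0 < kernel_pow (@rw R G) t.+1 x y ->
  exists z, 0 < rw x z /\ 0 < kernel_pow (@rw R G) t z y.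
Proof.
move=> /= h; apply: contrapT => nex; move: h; rewrite big1 ?ltxx // => z _.
apply/eqP; rewrite mulf_eq0 !eq_le rw_ge0 kernel_pow_rw_ge0 !andbT !leNgt.
apply/negPn; rewrite negb_or !negbK; apply/negP => /andP[h1 h2].
by apply: nex; exists z.
Qed.

Lemma irr_ind (Q : vertex G -> Prop) x : irreducible (@rw R G) ->
  Q x -> (forall a : O, Q (src a) -> 0 < w a -> Q (tgt a)) -> forall y, Q y.
Proof.
move=> irr Qx Qstep y; have [t] := irr x y.
elim: t x Qx => [|t IH] x Qx.
  by rewrite /=; case: eqVneq => [<-//|_]; rewrite ltxx.
case/kernel_pow_gt0 => z [xz zy]; apply: (IH z) => //.
have := lt0r_neq0 xz => /rw_step[<-//|[a [ax az wa]]].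
by rewrite -az; apply: Qstep; rewrite ?ax.
Qed.

Lemma escape_gt0 : irreducible (@rw R G) ->
  (exists b, 0 < w b /\ r b < 1) -> forall u, 0 < escape u.
Proof.
move=> irr [b [wb rb]] u; rewrite lt_def escape_ge0 andbT; apply/eqP => e0.
have := irr_ind (Q := fun u => escape u = 0) irr e0 escape0_step (src b).
by move=> /escape0 /(_ erefl wb) r1; rewrite r1 ltxx in rb.
Qed.

End Stacks.

(** * Green functions of the walk killed outside a cone *)

Section Convolution.
Variable R : realType.
Implicit Types u v : nat -> R.

(** The durations add up to [t.-1]: one unit of time is spent crossing the edge that separates the
    two pieces of the trajectory. *)
Definition conv u v (t : nat) : R := \sum_(s < t) u s * v (t.-1 - s)%N.

Lemma sum_conv u v n : \sum_(t < n) conv u v t =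
  \sum_(s < n) u s * \sum_(j < n.-1 - s) v j.
Proof.
elim: n => [|n IH]; first by rewrite !big_ord0.
rewrite big_ord_recr /= IH big_ord_recr /= subnn big_ord0 mulr0 addr0.
rewrite -big_split; apply: eq_bigr => s _ /=; rewrite -mulrDr; congr (_ * _).
have sn := ltn_ord s.
have sn1 : (s <= n.-1)%N by rewrite -ltnS (ltn_predK sn).
have -> : (n - s = (n.-1 - s).+1)%N by rewrite -subSn // (ltn_predK sn).
by rewrite big_ord_recr.
Qed.

Lemma sumn_le u m n : (forall i, 0 <= u i) -> (m <= n)%N ->
  \sum_(i < m) u i <= \sum_(i < n) u i.
Proof.
move=> u0; apply: (@ndecr_homo _ (fun n => \sum_(i < n) u i)) => k.
by rewrite big_ord_recr /= lerDl.
Qed.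

Lemma sum_conv_le u v n : (forall i, 0 <= u i) -> (forall i, 0 <= v i) ->
  \sum_(t < n) conv u v t <= (\sum_(t < n) u t) * \sum_(t < n) v t.
Proof.
move=> u0 v0; rewrite sum_conv mulr_suml; apply: ler_sum => s _.
by rewrite ler_wpM2l // sumn_le // (leq_trans (leq_subr _ _)) // leq_pred.
Qed.

Lemma sum_conv_ge u v n : (forall i, 0 <= u i) -> (forall i, 0 <= v i) ->
  (\sum_(t < n) u t) * (\sum_(t < n) v t) <= \sum_(t < (n + n).+1) conv u v t.
Proof.
move=> u0 v0; rewrite sum_conv mulr_suml /=.
apply: (@le_trans _ _
    (\sum_(s < n) u s * \sum_(j < n + n - s) v j)).
  apply: ler_sum => s _; rewrite ler_wpM2l // sumn_le //.
  by rewrite -addnBA ?leq_addr // ltnW.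
apply: (@sumn_le (fun s => u s * \sum_(j < n + n - s) v j)).
  by move=> i; rewrite mulr_ge0 // sumr_ge0.
by rewrite ltnW // ltnS leq_addr.
Qed.

Lemma cvg_sum_conv u v (U V : R) :
  (forall i, 0 <= u i) -> (forall i, 0 <= v i) ->
  \sum_(t < n) u t @[n --> \oo] --> U -> \sum_(t < n) v t @[n --> \oo] --> V ->
  \sum_(t < n) conv u v t @[n --> \oo] --> U * V.
Proof.
move=> u0 v0 uU vV.
have c0 t : 0 <= conv u v t by apply: sumr_ge0 => s _; exact: mulr_ge0.
have UV : (\sum_(t < n) u t) * (\sum_(t < n) v t) @[n --> \oo] --> U * V.
  exact: cvgM.
have le_lim (x : nat -> R) X n : (forall i, 0 <= x i) ->
    \sum_(t < n) x t @[n --> \oo] --> X -> \sum_(t < n) x t <= X.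
  move=> x0 xX; apply: (cvgr_to_ge xX); near=> m.
  by apply: sumn_le => //; near: m; exact: nbhs_infty_ge.
have U0 : 0 <= U by have := le_lim u U 0%N u0 uU; rewrite big_ord0.
have V0 : 0 <= V by have := le_lim v V 0%N v0 vV; rewrite big_ord0.
have bd n : \sum_(t < n) conv u v t <= U * V.
  apply: le_trans (sum_conv_le n u0 v0) _.
  by apply: ler_pM; rewrite ?sumr_ge0// le_lim.
have cv : \sum_(t < n) conv u v t @[n --> \oo] -->
    limn (fun n => \sum_(t < n) conv u v t).
  by apply: (ndecr_cvg_lim (M := U * V)) => // n; rewrite big_ord_recr /= lerDl.
suff -> : U * V = limn (fun n => \sum_(t < n) conv u v t) by [].
apply/le_anti/andP; split.
  apply: (cvgr_to_le UV); apply: nearW => n.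
  exact: le_trans (sum_conv_ge n u0 v0) (le_lim _ _ _ c0 cv).
by apply: (cvgr_to_le cv); apply: nearW.
Unshelve. all: by end_near. Qed.

Lemma conv_exp u v (z : R) t : 0 < z -> conv u v t * z ^+ t =
  z * conv (fun s => u s * z ^+ s) (fun s => v s * z ^+ s) t.
Proof.
move=> z0; rewrite /conv mulr_suml mulr_sumr; apply: eq_bigr => s _.
have -> : z ^+ t = z * (z ^+ s * z ^+ (t.-1 - s)).
  have st := ltn_ord s.
  by rewrite -exprD -exprS subnKC ?(ltn_predK st) // -ltnS (ltn_predK st).
ring.
Qed.

End Convolution.

Section Cones.
Variables (R : realType) (O : eqType).
Implicit Types (x y s : seq O) (u : seq O -> R).

Definition incone x y : bool := drop (size y - size x) y == x.

Definition coneF u x y : R :=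
  if incone x y then u (take (size y - size x) y) else 0.

Lemma incone_cat x s : incone x (s ++ x).
Proof. by rewrite /incone size_cat addnK drop_size_cat. Qed.

Lemma inconeP x y : reflect (exists s, y = s ++ x) (incone x y).
Proof.
apply: (iffP idP) => [/eqP cy|[s ->]]; last exact: incone_cat.
exists (take (size y - size x) y).
by rewrite -[LHS](cat_take_drop (size y - size x)) cy.
Qed.

Lemma incone_size x y : incone x y -> (size x <= size y)%N.
Proof. by case/inconeP => s ->; rewrite size_cat leq_addl. Qed.

Lemma coneF_cat u x s : coneF u x (s ++ x) = u s.
Proof. by rewrite /coneF incone_cat size_cat addnK take_size_cat. Qed.

Lemma coneF_out u x y : ~~ incone x y -> coneF u x y = 0.
Proof. by rewrite /coneF => /negbTE ->. Qed.

End Cones.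

Section Green.
Variables (R : realType) (G : wmgraph R) (v : vertex G).
Local Notation O := (oedge G).
Local Notation w := (@weight R G).
Local Notation child := (child v).
Local Notation Lop := (cone_step v).
Local Notation Hit := (Hit v).
Local Notation hit := (hit v).
Local Notation D := (green_inv v).

(* The probability to go from the stack [l] to the stack [x] in [t] steps      *)
(* inside the cone below a vertex of type [tau].                               *)
Definition cone_prob (tau : option O) (x : seq O) (t : nat) (l : seq O) : R :=
  iter t (Lop tau) (fun s => (s == x)%:R) l.
Local Notation J := cone_prob.

Definition cone_loop (tau : option O) (t : nat) : R := J tau [::] t [::].
Local Notation g := cone_loop.

Lemma J0 tau x l : J tau x 0 l = (l == x)%:R. Proof. by []. Qed.

Lemma JS tau x t l : J tau x t.+1 l = Lop tau (J tau x t) l.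
Proof. by []. Qed.

Lemma J_ge0 tau x t l : 0 <= J tau x t l.
Proof. by elim: t l => [|t IH] l; [rewrite /J /= ler0n|exact: Lop_ge0]. Qed.

Lemma g_ge0 tau t : 0 <= g tau t. Proof. exact: J_ge0. Qed.

(** Popping the stack by time [m] entails a visit to the apex, and the expected number of visits
    dominates the probability of one. Through this bound the remainder in [iter_Lop_hit] becomes a
    tail of the Green series. *)
Lemma Hit_le_J tau m l : Hit m l <= \sum_(t < m.+1) J tau [::] t l.
Proof.
elim: m l => [|m IH] [|c l].
- by rewrite big_ord1 J0 eqxx.
- by rewrite big_ord1 J_ge0.
- rewrite Hit_nil big_ord_recl J0 eqxx lerDl.
  by apply: sumr_ge0 => i _; exact: J_ge0.
- rewrite big_ord_recl J0 add0r.
  apply: (@le_trans _ _ (Lop tau (fun s => \sum_(t < m.+1) J tau [::] t s) (c :: l))).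
    exact: (@Lop_le _ _ v tau (Hit m) _ (c :: l)).
  by rewrite Lop_sum.
Qed.

Lemma Lop_hit tau l :
  hit l = Lop tau hit l + 2^-1 * D tau * (l == [::])%:R.
Proof.
case: l => [|c l]; last by rewrite mulr0 addr0 -hit_Lop.
rewrite eqxx mulr1 /Lop /D hit_nil /=.
under eq_bigr do rewrite hit_cons hit_nil mulr1.
by lra.
Qed.

(** [hit] is harmonic for the killed walk except at the apex, where the defect is [D tau / 2]
    ([Lop_hit]); the sum counts the visits to the apex. *)
Lemma iter_Lop_hit tau n l : hit l =
  iter n (Lop tau) hit l + 2^-1 * D tau * \sum_(t < n) J tau [::] t l.
Proof.
elim: n l => [|n IH] l; first by rewrite big_ord0 mulr0 addr0.
have e : Lop tau hit l = Lop tau (iter n (Lop tau) hit) l +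
    2^-1 * D tau * \sum_(t < n) J tau [::] t.+1 l.
  rewrite (eq_Lop v tau l IH) LopD; congr (_ + _).
  under eq_Lop do rewrite mulrC.
  by rewrite LopMr mulrC Lop_sum.
rewrite (Lop_hit tau) e iterS big_ord_recl J0 (mulrDr (_ * D tau)) -addrA.
by congr (_ + _); exact: addrC.
Qed.

Lemma iter_Lop_cvg tau n (u : nat -> seq O -> R) (u' : seq O -> R) l :
  (forall s, u m s @[m --> \oo] --> u' s) ->
  iter n (Lop tau) (u m) l @[m --> \oo] --> iter n (Lop tau) u' l.
Proof.
by move=> uu'; elim: n l => [|n IH] l //=; apply: Lop_cvg.
Qed.

Lemma iter_Lop_ge0 tau n u l : (forall s, 0 <= u s) ->
  0 <= iter n (Lop tau) u l.
Proof. by move=> u0; elim: n l => [|n IH] l //=; exact: Lop_ge0. Qed.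

Lemma iter_Lop_le tau n u u' l : (forall s, u s <= u' s) ->
  iter n (Lop tau) u l <= iter n (Lop tau) u' l.
Proof. by move=> uu'; elim: n l => [|n IH] l //=; exact: Lop_le. Qed.

Lemma iter_Lop_sum tau n (I : Type) (s : seq I) (Q : pred I)
    (u : I -> seq O -> R) l :
  iter n (Lop tau) (fun x => \sum_(i <- s | Q i) u i x) l =
  \sum_(i <- s | Q i) iter n (Lop tau) (u i) l.
Proof.
elim: n l => [|n IH] l //=.
by rewrite (eq_Lop v tau l IH) Lop_sum.
Qed.

Lemma sum_g_le tau n : D tau * \sum_(t < n) g tau t <= 2.
Proof.
have := iter_Lop_hit tau n [::]; rewrite hit_nil.
have := iter_Lop_ge0 tau n [::] (hit_ge0 v).
rewrite /g; lra.
Qed.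

Lemma cvg_sum_g tau : 0 < D tau ->
  \sum_(t < n) g tau t @[n --> \oo] --> 2 / D tau.
Proof.
move=> D0.
have bd n : \sum_(t < n) g tau t <= 2 / D tau.
  by rewrite ler_pdivlMr // mulrC sum_g_le.
have gS n : \sum_(t < n) g tau t <= \sum_(t < n.+1) g tau t.
  by rewrite big_ord_recr lerDl g_ge0.
have cv := ndecr_cvg_lim gS bd.
suff -> : 2 / D tau = limn (fun n => \sum_(t < n) g tau t) by [].
set L := limn _ in cv *.
apply/le_anti/andP; split; last by apply: (cvgr_to_le cv); apply: nearW.
(* The remainder is at most the tail of the very series to be summed, so the identity at the apex
   becomes [1 = D tau * L / 2] in the limit. *)
have tail n : iter n (Lop tau) hit [::] <= L - \sum_(t < n) g tau t.
  have cvh := @iter_Lop_cvg tau n _ _ [::] (@Hit_cvg _ _ v).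
  apply: (cvgr_to_le cvh); apply: nearW => m.
  apply: le_trans (iter_Lop_le tau n [::] (fun s => Hit_le_J tau m s)) _.
  rewrite iter_Lop_sum lerBrDr addrC.
  apply: (@le_trans _ _ (\sum_(t < n + m.+1) g tau t)).
    rewrite big_split_ord /= lerD2l le_eqVlt; apply/orP; left; apply/eqP.
    by apply: eq_bigr => t _; rewrite /g /J iterD.
  apply: (@nondecreasing_cvgn_le _ (fun n => \sum_(t < n) g tau t)).
    exact: ndecr_homo.
  exact: cvgP cv.
have ge n : 1 <= L - \sum_(t < n) g tau t + 2^-1 * D tau * \sum_(t < n) g tau t.
  have := iter_Lop_hit tau n [::]; rewrite hit_nil.
  have := tail n; rewrite /g; lra.
have cv2 : L - \sum_(t < n) g tau t + 2^-1 * D tau * \sum_(t < n) g tau t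
    @[n --> \oo] --> L - L + 2^-1 * D tau * L.
  apply: cvgD; first by apply: cvgB => //; exact: cvg_cst.
  exact: cvgMl_tmp.
have : 1 <= L - L + 2^-1 * D tau * L by apply: (cvgr_to_ge cv2); exact: nearW.
rewrite ler_pdivrMr //; lra.
Qed.

Section LastEntrance.
Variables (b : O) (l : seq O).
Hypothesis lb : child (top None l) b.
Let x := b :: l.

Let C t := coneF (J (Some b) [::] t) x.

Let C_cat t s : C t (s ++ x) = J (Some b) [::] t s.
Proof. exact: coneF_cat. Qed.

Let C_out t y : ~~ incone x y -> C t y = 0.
Proof. exact: coneF_out. Qed.

Let C_small t y : (size y < size x)%N -> C t y = 0.
Proof.
by move=> h; apply: C_out; apply/negP => /incone_size; rewrite leqNgt h.
Qed.

Let C_step t y : Lop None (C t) y =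
  C t.+1 y + 2^-1 * w b * g (Some b) t * (y == l)%:R.
Proof.
have Cpush b' : C t (b' :: l) = (b' == b)%:R * g (Some b) t.
  have [->|bb'] := eqVneq b' b; first by rewrite mul1r (C_cat t [::]).
  rewrite mul0r C_out //; apply/negP => /inconeP[[|c s] []].
    by move=> e; rewrite e eqxx in bb'.
  by move=> _ /(congr1 size); rewrite size_cat /= => h; lia.
have [/inconeP[s ->]|ncone] := boolP (incone x y).
  have -> : (s ++ x == l) = false.
    by apply/eqP => /(congr1 size); rewrite size_cat /= => h; lia.
  rewrite mulr0 addr0 C_cat JS.
  case: s => [|c s].
    rewrite cat0s /Lop /= (@C_small t l) ?mulr0 ?ltnS //.
    congr (_ * _ + _ * (_ + _)); first exact: (C_cat t [::]).
    by apply: eq_bigr => b' _; congr (_ * _); exact: (C_cat t [:: b']).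
  rewrite /Lop /=; congr (_ * _ + _ * (_ * _ + _)).
  - exact: (C_cat t (c :: s)).
  - exact: C_cat.
  - by apply: eq_bigr => b' _; congr (_ * _); exact: (C_cat t [:: b', c & s]).
rewrite (C_out _ ncone) add0r /Lop (C_out _ ncone) mulr0 add0r.
have -> : (if y is c :: y' then w (oinv c) * C t y' else 0) = 0.
  case: y ncone => // c y ncone; rewrite C_out ?mulr0 //.
  by apply: contra ncone => /inconeP[s ->]; exact: (incone_cat x (c :: s)).
rewrite add0r; have [->|yl] := eqVneq y l.
  rewrite mulr1 (bigD1 b) //= Cpush eqxx mul1r big1 ?addr0 ?mulrA // => b' /andP[_ bb'].
  by rewrite Cpush (negbTE bb') mul0r mulr0.
rewrite mulr0 big1 ?mulr0 // => b' _; rewrite C_out ?mulr0 //.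
apply/negP => /inconeP[[|c s] [e1 e2]]; first by rewrite e2 eqxx in yl.
by move: ncone; rewrite e2 incone_cat.
Qed.

(** Trajectories are split at their last step from [l] into the cone of [x]; after it they are loops
    in a cone of type [b]. The term [C t y] accounts for those that have been in the cone from the
    start. The induction rests on [C_step]: [C] solves the equation of the walk except at [l], where
    the crossing contributes. *)
Lemma J_last_entrance t y : J None x t y = C t y +
  \sum_(s < t) J None l s y * (2^-1 * w b * g (Some b) (t.-1 - s)).
Proof.
elim: t y => [|t IH] y.
  rewrite big_ord0 addr0 J0.
  have [/inconeP[s ->]|ncone] := boolP (incone x y).
    rewrite C_cat J0; congr (nat_of_bool _)%:R.
    apply/idP/idP => [/eqP/(congr1 size)|/eqP->]; last by rewrite cat0s.
    by rewrite size_cat => h; apply/eqP/size0nil; lia.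
  rewrite C_out //; case: eqVneq ncone => // ->.
  by rewrite (incone_cat x [::]).
rewrite JS (eq_Lop v None y IH) LopD C_step -addrA.
congr (_ + _); rewrite big_ord_recl Lop_sum; congr (_ + _).
  by rewrite mulrC /= subn0.
apply: eq_bigr => s _; rewrite LopMr /=.
by congr (_ * (_ * g _ _)); rewrite /bump /=; lia.
Qed.

Lemma J_conv t : J None x t [::] =
  2^-1 * w b * conv (fun s => J None l s [::]) (g (Some b)) t.
Proof.
rewrite J_last_entrance C_small // add0r mulr_sumr; apply: eq_bigr => s _.
ring.
Qed.

End LastEntrance.
End Green.

(** * The ray to infinity as a Markov chain of labels *)

Section RayChain.
Variables (R : realType) (G : wmgraph R) (v : vertex G).
Local Notation O := (oedge G).
Local Notation w := (@weight R G).
Local Notation child := (child v).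
Local Notation r := (return_prob v).
Local Notation q := (no_return v).
Local Notation D := (green_inv v).
Local Notation J := (cone_prob v).
Local Notation g := (cone_loop v).

Fixpoint okst (l : seq O) : bool :=
  if l is b :: l' then child (top None l') b && okst l' else true.

Definition qT (tau : option O) : R := if tau is Some a then q a else 1.

(* The transition matrix of the labels of the ray, see [ray_prob_W].           *)
Definition ptr (tau : option O) (b : O) : R :=
  if child tau b then w b * q b / (D tau * qT tau) else 0.

Fixpoint ray_weight (l : seq O) : R :=
  if l is b :: l' then ray_weight l' * ptr (top None l') b else 1.
Local Notation W := ray_weight.

(** The Green function of the walk from the root, in closed form ([cvg_sum_J]). *)
Fixpoint green (l : seq O) : R :=
  if l is b :: l' then green l' * (w b / D (Some b)) else 2 / D None.

(* The probability that the ray goes through [l] and that the walk enters for  *)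
(* the last time the cone of [l] at time [t].                                  *)
Definition entry_prob (l : seq O) (t : nat) : R :=
  if okst l then match l, t with
  | b :: l', t'.+1 => J None l' t' [::] * (2^-1 * w b * q b)
  | [::], 0%N => 1
  | _, _ => 0
  end else 0.
Local Notation entry := entry_prob.

Definition ray_shift (u : seq O -> R) (l : seq O) : R :=
  \sum_b ptr (top None l) b * u (b :: l).
Local Notation T := ray_shift.

Fixpoint words (k : nat) : seq (seq O) :=
  if k is k'.+1 then [seq b :: l | l <- words k', b <- enum {: O}] else [:: [::]].

Lemma okst_cons b l : okst (b :: l) = child (top None l) b && okst l.
Proof. by []. Qed.

Lemma W_cons b l : W (b :: l) = W l * ptr (top None l) b. Proof. by []. Qed.

Lemma green_cons b l : green (b :: l) = green l * (w b / D (Some b)).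
Proof. by []. Qed.

Lemma qT_ge0 tau : 0 <= qT tau.
Proof. by case: tau => [a|] /=; [exact: q_ge0|]. Qed.

Lemma ptr_ge0 tau b : 0 <= ptr tau b.
Proof.
rewrite /ptr; case: ifP => // _.
by rewrite divr_ge0 ?mulr_ge0 ?wge0 ?q_ge0 ?D_ge0 ?qT_ge0.
Qed.

Lemma ptr_gt0 tau b : 0 < ptr tau b ->
  [/\ child tau b, 0 < w b, 0 < q b & 0 < qT tau].
Proof.
rewrite /ptr; case: ifP => [cb|]; last by rewrite ltxx.
rewrite lt_def => /andP[+ _]; rewrite mulf_eq0 invr_eq0 !mulf_eq0 !negb_or.
move=> /andP[/andP[w0 q0] /andP[_ qt0]].
by rewrite !lt_def w0 q0 qt0 wge0 q_ge0 qT_ge0.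
Qed.

Lemma W_ge0 l : 0 <= W l.
Proof. by elim: l => //= b l IH; rewrite mulr_ge0 ?ptr_ge0. Qed.

Lemma W_cons_gt0 b l : 0 < W (b :: l) -> 0 < W l /\ 0 < ptr (top None l) b.
Proof.
rewrite /= lt_def mulf_eq0 negb_or => /andP[/andP[h1 h2] _].
by rewrite !lt_def h1 h2 W_ge0 ptr_ge0.
Qed.

Lemma W_ok l : 0 < W l -> okst l.
Proof.
elim: l => //= b l IH /W_cons_gt0[/IH -> /ptr_gt0[-> _ _ _]] //.
Qed.

Lemma W_live l : 0 < W l -> 0 < qT (top None l).
Proof. by case: l => [|b l] //= /W_cons_gt0[_ /ptr_gt0[]]. Qed.

Lemma words_size k l : (l \in words k) = (size l == k).
Proof.
elim: k l => [|k IH] l; first by rewrite inE; case: l.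
apply/allpairsP/idP => [[[l' b] /= [+ _ ->]]|]; first by rewrite IH eqSS.
case: l => // b l; rewrite eqSS => h; exists (l, b); split => //=.
  by rewrite IH.
by rewrite mem_enum.
Qed.

Lemma words_uniq k : uniq (words k).
Proof.
elim: k => //= k IH; apply: allpairs_uniq => //; first exact: enum_uniq.
by move=> [l b] [l' b'] _ _ /= [-> ->].
Qed.

Lemma T_le u u' l : (forall b, 0 < ptr (top None l) b -> u (b :: l) <= u' (b :: l)) ->
  T u l <= T u' l.
Proof.
move=> h; apply: ler_sum => b _.
have := ptr_ge0 (top None l) b; rewrite le_eqVlt => /orP[/eqP<-|p0].
  by rewrite !mul0r.
by rewrite ler_wpM2l ?ptr_ge0 ?h.
Qed.

Lemma eq_T u u' l : (forall b, 0 < ptr (top None l) b -> u (b :: l) = u' (b :: l)) ->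
  T u l = T u' l.
Proof.
by move=> h; apply/le_anti/andP; split; apply: T_le => b /h ->.
Qed.

Lemma iterT_words k u : iter k T u [::] = \sum_(l <- words k) W l * u l.
Proof.
elim: k u => [|k IH] u; first by rewrite big_seq1 mul1r.
rewrite iterSr IH /= big_allpairs_dep; apply: eq_bigr => l _.
rewrite /T mulr_sumr big_enum /=; apply: eq_bigr => b _.
by rewrite mulrA.
Qed.

Lemma iterT_le k u u' :
  (forall l, size l = k -> 0 < W l -> u l <= u' l) ->
  iter k T u [::] <= iter k T u' [::].
Proof.
move=> h; rewrite !iterT_words big_seq [leRHS]big_seq; apply: ler_sum => l.
rewrite words_size => /eqP lk.
have := W_ge0 l; rewrite le_eqVlt => /orP[/eqP<-|W0]; first by rewrite !mul0r.
by rewrite ler_wpM2l ?W_ge0 ?h.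
Qed.

Lemma iterT_ge0 k u l : (forall s, 0 <= u s) -> 0 <= iter k T u l.
Proof.
move=> u0; elim: k l => [|k IH] l //=; apply: sumr_ge0 => b _.
by rewrite mulr_ge0 ?ptr_ge0.
Qed.

(** The left side is the part of the expectation at level [size l + k] carried by the rays through
    [l]. An estimate for the ray from the root thus passes to the chain started at any type visited
    with positive probability. *)
Lemma iterT_cond k u l : (forall s, 0 <= u s) ->
  W l * iter k T u l <= iter (size l + k) T u [::].
Proof.
move=> u0; elim: l k => [|b l IH] k; first by rewrite mul1r.
rewrite [size _]/= addSnnS; apply: le_trans (IH k.+1).
rewrite [W _]/= -mulrA ler_wpM2l ?W_ge0 // iterS /T (bigD1 b) //= lerDl.
by apply: sumr_ge0 => b' _; rewrite mulr_ge0 ?ptr_ge0 ?iterT_ge0.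
Qed.

Lemma TMr u k l : T (fun s => u s * k) l = T u l * k.
Proof. by rewrite /T mulr_suml; apply: eq_bigr => b _; rewrite mulrA. Qed.

Lemma TD u u' l : T (fun s => u s + u' s) l = T u l + T u' l.
Proof. by rewrite /T -big_split; apply: eq_bigr => b _; rewrite mulrDr. Qed.

Lemma iterT_Mr n u k l : iter n T (fun s => u s * k) l = iter n T u l * k.
Proof.
elim: n l => //= n IH l; rewrite -TMr; apply: eq_T => b _; exact: IH.
Qed.

Lemma iterT_D n u u' l :
  iter n T (fun s => u s + u' s) l = iter n T u l + iter n T u' l.
Proof.
elim: n l => //= n IH l; rewrite -TD; apply: eq_T => b _; exact: IH.
Qed.

Lemma entry_ge0 l t : 0 <= entry l t.
Proof.
rewrite /entry; case: ifP => // _; case: l t => [|b l] [|t] //.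
by rewrite !mulr_ge0 ?invr_ge0 ?J_ge0 ?wge0 ?q_ge0.
Qed.

Hypothesis Dpos : forall tau, 0 < D tau.

Lemma sum_ptr tau : 0 < qT tau -> \sum_b ptr tau b = 1.
Proof.
move=> q0; have := @sum_wq _ _ v tau.
have -> : D tau - back tau = D tau * qT tau.
  by case: tau {q0} => [a|] /=; rewrite ?subr0 ?mulr1 // -sum_wq_Some sum_wq.
move=> e; rewrite /ptr -big_mkcond /= -mulr_suml e mulfV //.
by rewrite mulf_neq0 ?gt_eqF.
Qed.

Lemma T1 l : 0 < qT (top None l) -> T (fun=> 1) l = 1.
Proof.
by move=> /sum_ptr e; rewrite -[RHS]e; apply: eq_bigr => b _; rewrite mulr1.
Qed.

Lemma iterT1 k l : 0 < qT (top None l) -> iter k T (fun=> 1) l = 1.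
Proof.
elim: k l => //= k IH l l0; rewrite -[RHS](T1 l0); apply: eq_T => b.
by move=> /ptr_gt0[_ _ q0 _]; apply: IH.
Qed.

Lemma sum_W k : \sum_(l <- words k) W l = 1.
Proof.
rewrite -[RHS](@iterT1 k [::]) // iterT_words.
by apply: eq_bigr => l _; rewrite mulr1.
Qed.

Lemma cvg_sum_J l : okst l ->
  \sum_(t < n) J None l t [::] @[n --> \oo] --> green l.
Proof.
elim: l => [|b l IH] /=; first by move=> _; exact: cvg_sum_g.
move=> /andP[cb /IH {}IH].
have -> : green l * (w b / D (Some b)) =
    2^-1 * w b * (green l * (2 / D (Some b))) by field; rewrite gt_eqF.
rewrite (_ : (fun n => _) = (fun n => 2^-1 * w b *
    \sum_(t < n) conv (fun s => J None l s [::]) (g (Some b)) t)).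
  apply: cvgMl_tmp; apply: cvg_sum_conv => //.
  - by move=> i; exact: J_ge0.
  - by move=> i; exact: g_ge0.
  - exact: cvg_sum_g.
apply/funext => n; rewrite mulr_sumr; apply: eq_bigr => t _; exact: J_conv.
Qed.

(** The factors [q] of successive transitions telescope; only the escape through the last edge
    remains. *)
Lemma W_green b l : okst (b :: l) -> W (b :: l) = green l * (2^-1 * w b * q b).
Proof.
elim: l b => [|c l IH] b /andP[cb okl].
  rewrite [W _]/= [green _]/= /ptr cb mul1r [qT _]/= mulr1; field.
  by rewrite gt_eqF.
rewrite [W _]/= -/(W (c :: l)) (IH c okl) /ptr cb [green (c :: l)]/= [qT _]/=.
(* If [q c = 0] the quotient in [ptr] is a division by zero, hence 0. The other side vanishes as
   well, since children of a recurrent type entered with positive weight are recurrent. *)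
have [q0|q0] := eqVneq (q c) 0; last by field; rewrite q0 gt_eqF.
rewrite q0 !mulr0 mul0r.
have := wge0 b; rewrite le_eqVlt => /orP[/eqP<-|w0]; first by rewrite mulr0 mul0r mulr0.
have rc1 : r c = 1 by apply/eqP; rewrite eq_sym -subr_eq0; exact/eqP.
by rewrite /q (r1_child rc1 cb w0) subrr !mulr0.
Qed.

Lemma cvg_sum_entry l : \sum_(t < n) entry l t @[n --> \oo] --> W l.
Proof.
rewrite -(cvg_shiftS (fun n => \sum_(t < n) entry l t)) /=.
case: l => [|b l].
  rewrite [X in X @ _ --> _](_ : _ = fun=> 1); first exact: cvg_cst.
  by apply/funext => n; rewrite big_ord_recl big1 ?addr0.
have [okb|nok] := boolP (okst (b :: l)); last first.
  have -> : W (b :: l) = 0.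
    apply/eqP; rewrite eq_le W_ge0 andbT leNgt; apply: contra nok; exact: W_ok.
  rewrite [X in X @ _ --> _](_ : _ = fun=> 0); first exact: cvg_cst.
  by apply/funext => n; rewrite big1 // => t _; rewrite /entry (negbTE nok).
rewrite W_green // [X in X @ _ --> _](_ : _ = fun n =>
    (\sum_(t < n) J None l t [::]) * (2^-1 * w b * q b)).
  by apply: cvgMr_tmp; apply: cvg_sum_J; case/andP: okb.
apply/funext => n; rewrite big_ord_recl /entry okb add0r mulr_suml.
by apply: eq_bigr.
Qed.

Lemma sum_entry_le n l : \sum_(t < n) entry l t <= W l.
Proof.
apply: (cvgr_to_ge (@cvg_sum_entry l)); near=> m.
by apply: sumn_le; [exact: entry_ge0|near: m; exact: nbhs_infty_ge].
Unshelve. all: by end_near. Qed.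

End RayChain.

(** * Exponential decay of the return times *)

Lemma near0_affine_lt (R : realType) (S B K : R) : S < K ->
  \forall e \near 0^'+, S + e * B < K.
Proof.
move=> SK.
have cv : S + e * B @[e --> 0^'+] --> S + 0 * B.
  apply: cvg_at_right_filter; apply: cvgD; first exact: cvg_cst.
  by apply: cvgMr_tmp; exact: cvg_id.
by apply: (cvgr_lt _ cv); rewrite mul0r addr0.
Qed.

Lemma finite_lt1 (R : realType) (I : finType) (f : I -> R) :
  (forall i, f i < 1) -> exists2 theta : R, 0 <= theta < 1 & forall i, f i <= theta.
Proof.
move=> f1; exists (\big[Num.max/0]_i f i); last by move=> i; exact: le_bigmax.
apply/andP; split; last by apply: bigmax_lt => // i _; exact: f1.
by elim/big_rec: _ => // i x _ x0; rewrite le_max x0 orbT.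
Qed.

Lemma finite_bound (R : realType) (I : finType) (f : I -> R) :
  exists2 C : R, 0 <= C & forall i, f i <= C.
Proof.
exists (\big[Num.max/0]_i f i); last by move=> i; exact: le_bigmax.
by elim/big_rec: _ => // i x _ x0; rewrite le_max x0 orbT.
Qed.

Section Decay.
Variables (R : realType) (G : wmgraph R) (v : vertex G).
Local Notation O := (oedge G).
Local Notation w := (@weight R G).
Local Notation child := (child v).
Local Notation Lop := (cone_step v).
Local Notation r := (return_prob v).
Local Notation q := (no_return v).
Local Notation D := (green_inv v).
Local Notation J := (cone_prob v).
Local Notation g := (cone_loop v).
Local Notation W := (ray_weight v).
Local Notation ptr := (ptr v).
Local Notation okst := (okst v).
Local Notation escape := (vertex_escape v).

Definition endv (l : seq O) : vertex G := if l is b :: _ then tgt b else v.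

Definition reach (l : seq O) : bool := okst l && all (fun a => 0 < w a) l.

Lemma reach_cons b l :
  reach (b :: l) = [&& child (top None l) b, 0 < w b & reach l].
Proof. by rewrite /reach okst_cons /= -!andbA; do !bool_congr. Qed.

Lemma reach_all : irreducible (@rw R G) ->
  forall u, exists2 l, reach l & endv l = u.
Proof.
move=> irr; apply: (irr_ind irr (x := v)); first by exists [::].
move=> a [l rl el] wa.
have push : child (top None l) a -> exists2 l0, reach l0 & endv l0 = tgt a.
  move=> ca; exists (a :: l) => //; by rewrite reach_cons ca wa rl.
case: l rl el push => [|c l] rl el push.
  by apply: push; rewrite /= -el.
have [ac|ac] := eqVneq a (oinv c); last by apply: push; rewrite /= /nb_next -el /= eqxx.
move: rl; rewrite reach_cons => /and3P[cc _ rl]; exists l => //.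
rewrite ac tgt_oinv; case: l cc {rl el push} => [|d l] /=; first by move/eqP.
by case/andP => /eqP.
Qed.

Hypothesis irr : irreducible (@rw R G).
Hypothesis Epos : forall u, 0 < escape u.

Lemma D_pos tau : 0 < D tau.
Proof.
case: tau => [a|]; last exact: Epos.
by rewrite D_escape ltr_pwDl // mulr_ge0 ?wge0 ?r_ge0.
Qed.

Lemma green_gt0 l : reach l -> 0 < green v l.
Proof.
elim: l => [|b l IH]; first by rewrite /= divr_gt0 ?D_pos.
rewrite reach_cons green_cons => /and3P[_ wb rl].
by rewrite mulr_gt0 ?IH // divr_gt0 ?D_pos.
Qed.

Lemma W_gt0 b l : reach (b :: l) -> 0 < q b -> 0 < W (b :: l).
Proof.
move=> rbl qb; have /andP[obl _] := rbl.
move: rbl; rewrite reach_cons => /and3P[_ wb rl].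
by rewrite W_green ?mulr_gt0 ?green_gt0 //; exact: D_pos.
Qed.

(** The degenerate situation in which the harmonic measure does not decay along some path; it
    contradicts [hW > 0]. *)
Definition flat_ray : Prop := exists2 w0 : R, 0 < w0 & exists k0 : nat,
  forall k, (k0 <= k)%N -> exists2 l, size l = k & W l = w0.

Definition rho : rel O := [rel a b | nb_next a b && (0 < w b)].

Lemma r1_connect x y : r x = 1 -> connect rho x y -> r y = 1.
Proof.
move=> rx /connectP[p]; elim: p x rx => [|z p IH] x rx /=; first by move=> _ ->.
move=> /andP[/andP[xz wz] hp] e; apply: IH hp e.
exact: r1_child rx xz wz.
Qed.

Lemma connect_last (e : rel O) x y : connect e x y -> x = y \/
  exists2 z, connect e x z & e z y.
Proof.
case/connectP => p; case: (lastP p) => [|p' z] /=; first by move=> _ ->; left.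
rewrite rcons_path last_rcons => /andP[hp hz] ->; right.
by exists (last x p') => //; apply/connectP; exists p'.
Qed.

(** The walk escapes from [tgt c] with positive probability, but not through the recurrent cone of
    [c], so it has to escape backwards. *)
Lemma recurrent_back c : r c = 1 -> 0 < w (oinv c) /\ 0 < q (oinv c).
Proof.
move=> rc; have : 0 < w (oinv c) * q (oinv c).
  have := Epos (tgt c); rewrite /vertex_escape (sum_out_child v).
  have : \sum_(b | child (Some c) b) w b * r b = 1 - w (oinv c).
    have := sum_wq_Some v c; rewrite /no_return rc subrr mulr0.
    under eq_bigr do rewrite mulrBr mulr1.
    by rewrite sumrB sum_child /=; lra.
  by rewrite /no_return; lra.
have := wge0 (oinv c); rewrite le_eqVlt => /orP[/eqP<-|w0].
  by rewrite mul0r ltxx.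
by rewrite pmulr_rgt0.
Qed.

(** Along a cycle of recurrent types the walk can escape only by running the cycle backwards. At a
    vertex of type [oinv c'], with [d] the predecessor of [c'], every child of positive weight other
    than [oinv d] is also a possible successor of [d], hence recurrent. So the ray continues by
    [oinv d] with probability 1 and [W] stays constant. *)
Lemma recurrent_cycle a b : r a = 1 -> rho a b -> connect rho b a -> flat_ray.
Proof.
move=> ra ab ba.
have rb : r b = 1 by apply: r1_connect ra (connect1 ab).
pose C c := connect rho b c && connect rho c a.
have Cr c : C c -> r c = 1 by case/andP => /(r1_connect rb).
have pred c : C c -> exists2 c', C c' & rho c' c.
  case/andP => bc ca; case: (connect_last bc) => [<-|[z bz zc]].
    by exists a => //; rewrite /C ba connect0.
  by exists z => //; rewrite /C bz (connect_trans (connect1 zc) ca).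
(* A stack that ends with [c] cannot be extended by [oinv c]; then [c] is popped and a predecessor
   of [c] in the cycle takes its place. *)
have start l c : reach l -> endv l = tgt c -> C c ->
    exists c' l', C c' /\ reach (oinv c' :: l').
  elim: l c => [|d l IH] c rl el Cc.
    exists c, [::]; split => //; rewrite reach_cons /= src_oinv -el /= eqxx.
    by rewrite (proj1 (recurrent_back (Cr _ Cc))).
  have [dc|dc] := eqVneq d c; last first.
    exists c, (d :: l); split => //; rewrite reach_cons rl.
    rewrite (proj1 (recurrent_back (Cr _ Cc))) !andbT /= /nb_next src_oinv.
    rewrite -el eqxx /=.
    by apply: contra dc => /eqP /(congr1 (fun x => oinv x)); rewrite !oinvK => ->.
  have [c' Cc' /andP[cc' _]] := pred c Cc.
  move: rl; rewrite reach_cons => /and3P[cl _ rl].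
  apply: (IH c') => //.
  move: cc' => /andP[/eqP -> _]; rewrite -dc; case: l cl {IH rl el} => [|z l] /=.
    by move/eqP.
  by case/andP => /eqP.
have [l0 rl0 el0] := reach_all irr (tgt b).
have [|c [l [Cc rl]]] := start l0 b rl0 el0; first by rewrite /C connect0.
exists (W (oinv c :: l)).
  by apply: W_gt0 => //; case: (recurrent_back (Cr _ Cc)).
exists (size l).+1 => k.
suff : forall n, exists c' l', [/\ C c', size l' = (size l + n)%N
    & W (oinv c' :: l') = W (oinv c :: l)].
  move=> h lk; have [c' [l' [_ sl' Wl']]] := h (k - (size l).+1)%N.
  by exists (oinv c' :: l') => //=; rewrite sl'; lia.
elim=> [|n [c' [l' [Cc' sl' Wl']]]]; first by exists c, l; rewrite addn0.
have [d Cd dc'] := pred c' Cc'.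
exists d, (oinv c' :: l'); split => //; first by rewrite /= sl' addnS.
rewrite -[RHS]Wl' -[RHS]mulr1 -[W (_ :: _ :: _)]/(W (oinv c' :: l') * ptr _ _).
congr (_ * _).
have q0 : 0 < qT v (Some (oinv c')) by case: (recurrent_back (Cr _ Cc')).
rewrite -(sum_ptr D_pos q0) (bigD1 (oinv d)) //= big1 ?addr0 // => e ed.
apply/eqP; rewrite eq_le ptr_ge0 andbT leNgt; apply/negP => /ptr_gt0[ce we qe _].
move: dc' => /andP[/andP[/eqP dc' _] _].
have : r e = 1.
  apply: r1_child (Cr _ Cd) _ we; rewrite /= /nb_next ed andbT dc'.
  by move: ce => /andP[+ _]; rewrite tgt_oinv.
by move=> re; rewrite /no_return re subrr ltxx in qe.
Qed.

Hypothesis Nflat : ~ flat_ray.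

(** A depth for recurrent types: in the absence of a flat ray it decreases at every positive step
    from such a type. *)
Definition rank (a : O) : nat := #|[pred x | connect rho a x]|.

Lemma rank_gt0 a : (0 < rank a)%N.
Proof. by apply/card_gt0P; exists a; rewrite inE connect0. Qed.

Lemma rank_lt a b : r a = 1 -> rho a b -> (rank b < rank a)%N.
Proof.
move=> ra ab; apply: proper_card; apply/properP; split.
  apply/fintype.subsetP => x; rewrite !inE => bx.
  exact: connect_trans (connect1 ab) bx.
exists a; rewrite !inE ?connect0 //; apply/negP => ba.
exact: Nflat (recurrent_cycle ra ab ba).
Qed.

(** Large enough for [w (oinv a) * rate > 1] whenever [w (oinv a) > 0]; the inverse of a zero weight
    counts for 0. *)
Definition rate : R := 1 + \sum_a (w (oinv a))^-1.

Definition corr (a : O) : R :=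
  if r a == 1 then rate ^+ rank a else if r a == 0 then 1 else 0.

(* At a transient type, the strict Jensen inequality makes [Num.sqrt r] a      *)
(* strict supersolution; the correction does it at the recurrent types, whose  *)
(* positive descendants have bounded depth, and keeps [psi] positive where     *)
(* [r] vanishes.                                                               *)
Definition psi (e : R) (a : O) : R := Num.sqrt (r a) + e * corr a.

Lemma rate_ge1 : 1 <= rate.
Proof. by rewrite lerDl sumr_ge0 // => a _; rewrite invr_ge0 wge0. Qed.

Lemma corr_ge0 a : 0 <= corr a.
Proof.
rewrite /corr; case: ifP => _; last by case: ifP.
by rewrite exprn_ge0 // (le_trans _ rate_ge1).
Qed.

Lemma psi_gt0 e a : 0 < e -> 0 < psi e a.
Proof.
move=> e0; rewrite /psi; have [ra|ra] := eqVneq (r a) 0.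
  rewrite ra sqrtr0 add0r /corr ra eqxx eq_sym oner_eq0 mulr1 //.
rewrite ltr_pwDl ?mulr_ge0 ?corr_ge0 1?ltW // sqrtr_gt0 lt_def ra r_ge0 //.
Qed.

Lemma psi_sum e (Q : pred O) : \sum_(b | Q b) w b * psi e b =
  \sum_(b | Q b) w b * Num.sqrt (r b) + e * \sum_(b | Q b) w b * corr b.
Proof.
rewrite mulr_sumr -big_split; apply: eq_bigr => b _ /=; rewrite /psi; ring.
Qed.

Lemma sqrt_le_mean (x : R) : 0 <= x -> Num.sqrt x <= 2^-1 * (1 + x).
Proof.
move=> x0; have := sqr_sqrtr x0; have := sqr_ge0 (Num.sqrt x - 1); nra.
Qed.

Lemma sum_sqrt_le (Q : pred O) : \sum_(b | Q b) w b * Num.sqrt (r b) <=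
  2^-1 * (\sum_(b | Q b) w b + \sum_(b | Q b) w b * r b).
Proof.
rewrite -big_split mulr_sumr; apply: ler_sum => b _ /=.
have := ler_wpM2l (wge0 b) (sqrt_le_mean (r_ge0 v b)); lra.
Qed.

(** If [Psi] is the product of [psi e] over a stack with top [a], one step multiplies [Psi] by
    [(1 + loss e (Some a)) / 2]; so [loss < 1] says that [Psi] is a strict supersolution. *)
Definition loss (e : R) (tau : option O) : R :=
  (if tau is Some a then w (oinv a) / psi e a else 0) +
  \sum_(b | child tau b) w b * psi e b.

Lemma loss_transient tau :
  (if tau is Some a then r a < 1 else true) ->
  \forall e \near 0^'+, loss e tau < 1.
Proof.
move=> ht.
pose S := (if tau is Some a then w (oinv a) / Num.sqrt (r a) else 0) +
  \sum_(b | child tau b) w b * Num.sqrt (r b).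
have lossE : \forall e \near 0^'+,
    loss e tau = S + e * \sum_(b | child tau b) w b * corr b.
  near=> e; rewrite /loss psi_sum addrA; congr (_ + _ + _).
  case: tau ht {S} => // a ra.
  have [ra0|ra0] := eqVneq (r a) 0.
    by rewrite -(Dr v) -/(r a) ra0 mulr0 !mul0r.
  by rewrite /psi /corr (negbTE ra0) lt_eqF // mulr0 addr0.
have S1 : S < 1.
  have Dt := D_pos tau; rewrite /green_inv in Dt.
  have := sum_sqrt_le (child tau); rewrite sum_child; rewrite /S.
  case: tau ht {S lossE} Dt => [a|] ht Dt; last first.
    by rewrite /=; lra.
  have /= := Dr v a; rewrite /green_inv -/(r a).
  set x := \sum_(b | _) w b * r b in Dt *; set y := \sum_(b | _) _.
  set W1 := w (oinv a) => e ht0.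
  have := r_ge0 v a; rewrite le_eqVlt -/(r a) => /orP[/eqP ra0|ra0].
    have W10 : W1 = 0 by rewrite -e -ra0 mulr0.
    by rewrite /= W10 mul0r; lra.
  have s0 : 0 < Num.sqrt (r a) by rewrite sqrtr_gt0.
  have sE := sqr_sqrtr (ltW ra0).
  set s := Num.sqrt (r a) in s0 sE *.
  have s1 : s < 1 by rewrite -[1]sqrtr1 ltr_sqrt.
  have eW : W1 = (1 - x) * s ^+ 2 by rewrite sE e.
  have -> : W1 / s = (1 - x) * s by rewrite eW; field; rewrite gt_eqF.
  (* The mean inequality for square roots leaves [S <= 1 - (1 - x) * (1 - s) ^+ 2 / 2], where
     [1 - x] is [D (Some a)]. *)
  have : 0 < (1 - x) * (1 - s) ^+ 2 by rewrite mulr_gt0 ?exprn_gt0 ?subr_gt0; lra.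
  move: ht0; rewrite /= eW; lra.
near=> e; rewrite (near lossE e) //; near: e.
exact: near0_affine_lt.
Unshelve. all: by end_near. Qed.

(** At a recurrent type the loss would be exactly 1 for [e = 0], so the first order in [e] decides.
    Its sign is right because the children of positive weight have smaller rank, which makes their
    corrections sum to less than [w (oinv a) * corr a]. *)
Lemma loss_recurrent a : r a = 1 -> \forall e \near 0^'+, loss e (Some a) < 1.
Proof.
move=> ra.
have wa : D (Some a) = w (oinv a) by rewrite -(Dr v) ra mulr1.
have wa0 : 0 < w (oinv a) by rewrite -wa D_pos.
pose B := \sum_(b | child (Some a) b) w b * corr b.
have eta0 : 0 < corr a.
  by rewrite /corr ra eqxx exprn_gt0 // (lt_le_trans _ rate_ge1).
have BE : B < w (oinv a) * corr a.
  have rw1 : 1 < w (oinv a) * rate.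
    rewrite /rate mulrDr mulr1 (bigD1 a) //= mulrDr mulfV ?gt_eqF //.
    rewrite addrCA ltrDl ltr_pwDl // mulr_ge0 ?wge0 ?sumr_ge0 // => b _.
    by rewrite invr_ge0 wge0.
  apply: (@le_lt_trans _ _ (rate ^+ (rank a).-1)).
    apply: (@le_trans _ _ (\sum_(b | child (Some a) b) w b * rate ^+ (rank a).-1)).
      apply: ler_sum => b ab.
      have := wge0 b; rewrite le_eqVlt => /orP[/eqP<-|wb]; first by rewrite !mul0r.
      rewrite ler_wpM2l ?wge0 // /corr (r1_child ra ab wb) eqxx.
      rewrite ler_weXn2l ?rate_ge1 // -ltnS prednK ?rank_gt0 //.
      by apply: rank_lt => //; rewrite /rho /= wb andbT.
    rewrite -mulr_suml sum_child /= ler_piMl ?exprn_ge0 ?(le_trans _ rate_ge1) //.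
    by rewrite gerBl wge0.
  rewrite /corr ra eqxx -{2}(prednK (rank_gt0 a)) exprS mulrA.
  by rewrite ltr_pMl // exprn_gt0 // (lt_le_trans _ rate_ge1).
have sumE : \sum_(b | child (Some a) b) w b * Num.sqrt (r b) = 1 - w (oinv a).
  rewrite -[w (oinv a)]/(back (Some a)) -(sum_child v); apply: eq_bigr => b ab.
  have := wge0 b; rewrite le_eqVlt => /orP[/eqP<-|wb]; first by rewrite mul0r.
  by rewrite (r1_child ra ab wb) sqrtr1 mulr1.
(* [B * corr a] is the coefficient of the second order in [e] once the denominator [1 + e * corr a]
   is cleared. *)
have := near0_affine_lt (B * corr a) BE => nB.
near=> e.
have e0 : 0 < e by near: e; exact: nbhs_right_gt.
have : B + e * (B * corr a) < w (oinv a) * corr a by near: e.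
rewrite /loss psi_sum sumE -/B /psi ra sqrtr1 => hB.
have p0 : 0 < 1 + e * corr a by rewrite ltr_pwDl // mulr_ge0 ?ltW.
rewrite addrA -ltrBrDr -ltrBrDr ltr_pdivrMr //; nra.
Unshelve. all: by end_near. Qed.

Lemma psi_exists : exists (ps : O -> R) (theta : R),
  [/\ forall a, 0 < ps a, 0 <= theta < 1 &
    forall tau, (if tau is Some a then w (oinv a) / ps a else 0) +
      \sum_(b | child tau b) w b * ps b <= theta].
Proof.
have : \forall e \near 0^'+, forall tau, loss e tau < 1.
  apply: filter_forall => -[a|]; last exact: loss_transient.
  have := r_le1 v a; rewrite le_eqVlt => /orP[/eqP ra|ra].
    exact: loss_recurrent.
  exact: loss_transient.
move=> h.
have : \forall e \near (0 : R)^'+, (forall tau, loss e tau < 1) /\ 0 < e.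
  near=> e; split; near: e; first exact: h.
  exact: nbhs_right_gt.
move=> /(@filter_ex _ _ (at_right_proper_filter 0)) [e [he e0]].
have [theta th hth] := finite_lt1 he.
by exists (psi e), theta; split => // a; exact: psi_gt0.
Unshelve. all: by end_near. Qed.

Lemma g_decay : exists2 theta : R, 0 < theta < 1 &
  forall tau t, g tau t <= theta ^+ t.
Proof.
have [ps [th [ps0 /andP[th0 th1] hps]]] := psi_exists.
pose Psi (l : seq O) := \prod_(c <- l) ps c.
have Psi0 l : 0 < Psi l by apply: prodr_gt0.
have PsiC c l : Psi (c :: l) = ps c * Psi l by rewrite /Psi big_cons.
pose th' := 2^-1 * (1 + th).
exists th'; first by rewrite /th'; lra.
have th'0 : 0 < th' by rewrite /th'; lra.
have step tau l : Lop tau Psi l <= Psi l * th'.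
  have -> : Lop tau Psi l = Psi l * (2^-1 * (1 +
      ((if l is c :: _ then w (oinv c) / ps c else 0) +
       \sum_(b | child (top tau l) b) w b * ps b))).
    rewrite /cone_step; under eq_bigr do rewrite PsiC mulrA.
    rewrite -mulr_suml; case: l => [|c l]; first by ring.
    by rewrite PsiC; field; rewrite gt_eqF.
  rewrite ler_pM2l ?Psi0 // /th' ler_pM2l ?invr_gt0 // lerD2l.
  case: l => [|c l]; last exact: (hps (Some c)).
  apply: le_trans (hps tau); rewrite lerD2r; case: tau => // a.
  by rewrite divr_ge0 ?wge0 // ltW.
have bound tau t l : J tau [::] t l <= Psi l * th' ^+ t.
  elim: t l => [|t IH] l.
    rewrite J0 mulr1; case: eqVneq => [->|_]; last exact: ltW.
    by rewrite /Psi big_nil.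
  rewrite JS (le_trans (Lop_le v tau l IH)) // LopMr exprS mulrA.
  by rewrite ler_wpM2r ?exprn_ge0 ?(ltW th'0).
move=> tau t; apply: le_trans (bound tau t [::]) _.
by rewrite /Psi big_nil mul1r.
Qed.

End Decay.

(** * Additive functionals of the ray *)

Section RealFacts.
Variable R : realType.

Lemma expR_le_quadratic (x : R) : expR x <= 1 + x + 4 * x ^+ 2 * expR `|x|.
Proof.
have E : 1 <= expR `|x| by rewrite -(expR0 R) ler_expR.
have x2 := sqr_ge0 x.
have [x1|x1] := leP (2^-1) x.
  have : expR x <= expR `|x| by rewrite ler_expR ler_norm.
  have : 1 <= 4 * x ^+ 2 by nra.
  nra.
have [x3|x3] := leP x (- 2^-1).
  have : expR x <= 1 by rewrite -(expR0 R) ler_expR; lra.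
  nra.
have : expR x <= (1 - x)^-1.
  have h := expR_ge1Dx (- x); rewrite -[expR x]invrK lef_pV2 ?posrE ?invr_gt0 ?expR_gt0; try lra.
  by rewrite -expRN.
have : (1 - x)^-1 <= 1 + x + 4 * x ^+ 2.
  have h : 0 < 1 - x by lra.
  rewrite -[_^-1]mul1r ler_pdivrMr //; nra.
nra.
Qed.

(** The right-hand side lies in the image as soon as it is orthogonal to the kernel of the
    transpose; the columns of [cokermx] belong to that kernel and suffice to test membership. *)
Lemma fredholm (I : finType) (A : I -> I -> R) (f : I -> R) :
  (forall mu : I -> R, (forall j, \sum_i A i j * mu i = 0) ->
     \sum_i f i * mu i = 0) ->
  exists g : I -> R, forall i, \sum_j A i j * g j = f i.
Proof.
move=> h.
pose M := \matrix_(i < #|I|, j < #|I|) A (enum_val i) (enum_val j).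
pose F := \row_(i < #|I|) f (enum_val i).
have enumE (u : I -> R) : \sum_i u i = \sum_(i < #|I|) u (enum_val i).
  by rewrite -big_enum_val; apply: eq_bigl => i; rewrite inE.
have : (F <= M^T)%MS.
  rewrite submxE; apply/eqP/rowP => k; rewrite !mxE.
  pose mu i := cokermx M^T (enum_rank i) k.
  rewrite -[RHS](h mu) => [|j].
    have /= -> := enumE (fun i => f i * mu i); apply: eq_bigr => i _.
    have -> : F 0 i = f (enum_val i) by rewrite mxE.
    by rewrite /mu enum_valK.
  have /matrixP/(_ (enum_rank j) k) := mulmx_coker M^T.
  rewrite !mxE => e; rewrite -[RHS]e; have /= -> := enumE (fun i => A i j * mu i); apply: eq_bigr => i _.
  have -> : M^T (enum_rank j) i = A (enum_val i) j by rewrite !mxE enum_rankK.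
  by rewrite /mu enum_valK.
case/submxP => X FX; exists (fun i => X 0 (enum_rank i)) => i.
have /rowP/(_ (enum_rank i)) := FX; rewrite !mxE enum_rankK => ->.
have /= -> := enumE (fun j => A i j * X 0 (enum_rank j)); apply: eq_bigr => j _.
by rewrite !mxE enum_rankK enum_valK mulrC.
Qed.

End RealFacts.

Section Additive.
Variables (R : realType) (G : wmgraph R) (v : vertex G).
Local Notation O := (oedge G).
Local Notation D := (green_inv v).
Local Notation W := (ray_weight v).
Local Notation ptr := (ptr v).
Local Notation T := (ray_shift v).
Local Notation qT := (qT v).

Variables (F : option O -> O -> R) (c : R).

Fixpoint addf (l : seq O) : R :=
  if l is b :: l' then addf l' + F (top None l') b else 0.

Definition dev (l : seq O) : R := addf l - c * (size l)%:R.

Definition visited (tau : option O) : Prop := exists2 l, 0 < W l & top None l = tau.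

Definition drift (tau : option O) : R := \sum_b ptr tau b * (F tau b - c).

Fixpoint cumdrift (k : nat) (tau : option O) : R :=
  if k is k'.+1 then drift tau + \sum_b ptr tau b * cumdrift k' (Some b) else 0.

Lemma dev_cons b l : dev (b :: l) = dev l + (F (top None l) b - c).
Proof. rewrite /dev /= -addn1 natrD; ring. Qed.

Lemma visited_next tau b : visited tau -> 0 < ptr tau b -> visited (Some b).
Proof.
move=> [l Wl tl] p0; exists (b :: l) => //.
by rewrite W_cons mulr_gt0 // tl.
Qed.

Lemma visited_live tau : visited tau -> 0 < qT tau.
Proof. by case=> l /W_live + <-. Qed.

Hypothesis Dpos : forall tau, 0 < D tau.
Hypothesis dev_cvg : forall delta : R, 0 < delta ->
  iter k T (fun l => (delta * (size l)%:R < `|dev l|)%R%:R) [::] @[k --> \oo] --> 0.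

Lemma dev_bound : exists2 B : R, 0 <= B & forall l, `|dev l| <= B * (size l)%:R.
Proof.
have [B B0 hB] := finite_bound (fun x : option O * O => `|F x.1 x.2 - c|).
exists B => //; elim=> [|b l IH]; first by rewrite /dev /= !mulr0 subrr normr0.
rewrite dev_cons (le_trans (ler_normD _ _)) //= -addn1 natrD mulrDr mulr1.
by rewrite lerD // (hB (top None l, b)).
Qed.

(** The increments are bounded, so [dev l / size l] is bounded and its convergence in probability is
    a convergence in mean. *)
Lemma dev_L1 (e : R) : 0 < e -> exists N : nat, forall k, (N <= k)%N ->
  iter k T (fun l => `|dev l|) [::] <= e * k%:R.
Proof.
move=> e0; have [B B0 hB] := dev_bound.
have d0 : 0 < e / 2 by rewrite divr_gt0.
have e2 : 0 < e / (2 * (B + 1)) by rewrite divr_gt0 // mulr_gt0 //; lra.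
have /cvgr0Pnorm_lt /(_ _ e2) [N _ hN] := dev_cvg d0.
exists N => k Nk; have := hN k Nk; set ind := fun l => _; set p := iter _ _ _ _.
have p0 : 0 <= p by apply: iterT_ge0 => s; rewrite ler0n.
rewrite (ger0_norm p0) => pe.
apply: (@le_trans _ _ (iter k T (fun l => 1 * (e / 2 * k%:R) + ind l * (B * k%:R)) [::])).
  apply: iterT_le => l lk _; rewrite mul1r /ind lk.
  have := hB l; rewrite lk; case: ltP => [_ h|h _].
    by rewrite mul1r (le_trans h) // lerDr !mulr_ge0 // ltW.
  by rewrite mul0r addr0.
rewrite iterT_D !iterT_Mr iterT1 // mul1r -/p.
have -> : e * k%:R = e / 2 * k%:R + e / 2 * k%:R :> R by field.
rewrite lerD2l mulrA ler_wpM2r //.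
have : p * (2 * (B + 1)) <= e.
  by rewrite -ler_pdivlMr ?(ltW pe) // mulr_gt0 //; lra.
nra.
Qed.

Lemma iterT_dev k l : 0 < qT (top None l) ->
  iter k T dev l = dev l + cumdrift k (top None l).
Proof.
elim: k l => [|k IH] l ql; first by rewrite addr0.
rewrite iterS (@eq_T _ _ _ _ (fun s => if s is b :: s' then
    dev s' + (F (top None s') b - c) + cumdrift k (Some b) else 0)); last first.
  move=> b /ptr_gt0[_ _ qb _]; rewrite (IH (b :: l)) // dev_cons //.
rewrite /ray_shift (eq_bigr (fun b => ptr (top None l) b * dev l +
    (ptr (top None l) b * (F (top None l) b - c) +
     ptr (top None l) b * cumdrift k (Some b)))); last by move=> b _; ring.
by rewrite !big_split /= -mulr_suml sum_ptr // mul1r.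
Qed.

Lemma iterT_norm k u l : `|iter k T u l| <= iter k T (fun s => `|u s|) l.
Proof.
elim: k l => //= k IH l; rewrite /ray_shift (le_trans (ler_norm_sum _ _ _)) //.
by apply: ler_sum => b _; rewrite normrM ger0_norm ?ptr_ge0 ?ler_wpM2l ?ptr_ge0.
Qed.

(** A visited type is the top of some [l] with [W l > 0], and conditioning the ray to pass through
    [l] costs only the constant factor [(W l)^-1]. *)
Lemma cumdrift_small tau (e : R) : visited tau -> 0 < e ->
  exists N : nat, forall k, (N <= k)%N -> `|cumdrift k tau| <= e * k%:R.
Proof.
move=> [l Wl tl] e0.
have e1 : 0 < e / 2 * W l by rewrite mulr_gt0 // divr_gt0.
have [N hN] := dev_L1 e1.
pose C := e / 2 * (size l)%:R + `|dev l|.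
have C0 : 0 <= C by rewrite addr_ge0 // mulr_ge0 // ltW // divr_gt0.
exists (N + Num.bound (C / (e / 2)))%N => k Nk.
have kC : C <= e / 2 * k%:R.
  rewrite mulrC -ler_pdivrMr ?divr_gt0 //.
  apply: le_trans (ltW (archi_boundP _)) _; first by rewrite divr_ge0 // ltW // divr_gt0.
  by rewrite ler_nat (leq_trans (leq_addl _ _) Nk).
have := hN (size l + k)%N (leq_trans (leq_trans (leq_addr _ _) Nk) (leq_addl _ _)).
have := @iterT_cond _ _ v k (fun s => `|dev s|) l (fun s => normr_ge0 _).
move=> /le_trans h /h {h}.
rewrite mulrAC [e / 2 * _ * _]mulrC ler_pM2l // => h.
have := iterT_norm k dev l; rewrite iterT_dev ?W_live // tl => h2.
have := ler_normB (dev l + cumdrift k tau) (dev l).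
rewrite addrAC subrr add0r => h3.
have := le_trans h2 h; rewrite natrD /C in kC *; lra.
Qed.

(* The convergence in probability of [dev] forces [cumdrift k] to be [o(k)],   *)
(* which is the solvability condition of the Poisson equation.                 *)
Lemma poisson : exists g : option O -> R, forall tau, visited tau ->
  g tau - \sum_b ptr tau b * g (Some b) = drift tau.
Proof.
pose Q (tau tau' : option O) : R :=
  if `[< visited tau >] then if tau' is Some b then ptr tau b else 0 else 0.
pose f tau := if `[< visited tau >] then drift tau else 0.
have sumQ tau (u : option O -> R) : \sum_tau' Q tau tau' * u tau' =
    if `[< visited tau >] then \sum_b ptr tau b * u (Some b) else 0.
  rewrite /Q; case: ifP => _; last by rewrite big1 // => t _; rewrite mul0r.
  rewrite (bigD1 None) //= mul0r add0r.
  rewrite (reindex_omap (@Some O) id) //=; last by case.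
  by apply: eq_bigl => b; rewrite eqxx.
have [|g hg] := @fredholm R (option O : finType) (fun i j => (i == j)%:R - Q i j) f.
  move=> mu hmu.
  have muQ j : mu j = \sum_i Q i j * mu i.
    have := hmu j; under eq_bigr do rewrite mulrBl.
    rewrite sumrB (bigD1 j) //= eqxx mul1r big1 ?addr0; last first.
      by move=> i /negbTE ->; rewrite mul0r.
    by move/eqP; rewrite subr_eq0 => /eqP.
  pose V k tau := if `[< visited tau >] then cumdrift k tau else 0.
  have VS k tau : V k.+1 tau = f tau + \sum_tau' Q tau tau' * V k tau'.
    rewrite sumQ /V /f; case: ifP => /asboolP vt; last by rewrite addr0.
    rewrite /=; congr (_ + _); apply: eq_bigr => b _.
    have := ptr_ge0 v tau b; rewrite le_eqVlt => /orP[/eqP<-|p0].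
      by rewrite !mul0r.
    by rewrite asboolT //; exact: visited_next p0.
  (* As [mu] is invariant under [Q], each further step adds the same amount; a sublinear total then
     forces that amount to be 0. *)
  have kf k : k%:R * \sum_i f i * mu i = \sum_i V k i * mu i.
    elim: k => [|k IH].
      by rewrite mul0r big1 // => i _; rewrite /V /=; case: ifP; rewrite mul0r.
    under [RHS]eq_bigr do rewrite VS mulrDl.
    rewrite big_split /= -natr1 mulrDl mul1r addrC IH; congr (_ + _).
    under [RHS]eq_bigr do rewrite mulr_suml.
    rewrite exchange_big /=; apply: eq_bigr => j _.
    rewrite {1}(muQ j) mulr_sumr; apply: eq_bigr => i _; ring.
  apply/eqP; rewrite -normr_le0; apply/ler_addgt0Pr => e e0; rewrite add0r.
  pose m := 1 + \sum_i `|mu i|.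
  have m0 : 0 < m by rewrite ltr_pwDl // sumr_ge0.
  have hN (i : option O) : exists N : nat, forall k, (N <= k)%N ->
      `|V k i| <= e / m * k%:R.
    rewrite /V; have [vi|nvi] := pselect (visited i); last first.
      exists 0%N => k _; rewrite asboolF // normr0 mulr_ge0 //.
      by rewrite divr_ge0 // ltW.
    by rewrite asboolT //; apply: cumdrift_small => //; rewrite divr_gt0.
  have [N hN'] := choice hN.
  pose k := (\max_i N i).+1.
  have k0 : 0 < k%:R :> R by rewrite ltr0n.
  rewrite -(ler_pM2l k0) -{1}(ger0_norm (ltW k0)) -normrM kf.
  apply: le_trans (ler_norm_sum _ _ _) _.
  apply: (@le_trans _ _ (\sum_i (e / m * k%:R) * `|mu i|)).
    apply: ler_sum => i _; rewrite normrM ler_wpM2r // hN' //.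
    by rewrite ltnW // ltnS; exact: leq_bigmax.
  have -> : k%:R * e = e / m * k%:R * m by field; rewrite gt_eqF.
  rewrite -mulr_sumr ler_wpM2l ?mulr_ge0 ?invr_ge0 ?(ltW e0) ?(ltW m0) //.
  by rewrite /m lerDr.
exists g => tau vt; have := hg tau.
under eq_bigr do rewrite mulrBl.
rewrite sumrB sumQ /f asboolT //; rewrite (bigD1 tau) //= eqxx mul1r.
by rewrite big1 ?addr0 // => i; rewrite eq_sym => /negbTE ->; rewrite mul0r.
Qed.

(* Corrected by the solution [g] of the Poisson equation, [dev] is a           *)
(* martingale with bounded increments.                                         *)
Lemma dev_exp : exists C1 C2 : R, [/\ 0 <= C1, 0 <= C2 &
  forall (lam : R) k, `|lam| <= 1 ->
    iter k T (fun l => expR (lam * dev l)) [::] <=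
    C1 * expR (C2 * lam ^+ 2 * k%:R)].
Proof.
have [g hg] := poisson.
pose y tau b := F tau b - c + g (Some b) - g tau.
have [Y Y0 hY] := finite_bound (fun x : option O * O => `|y x.1 x.2|).
have [H H0 hH] := finite_bound (fun tau => `|g tau|).
pose C2 := 4 * Y ^+ 2 * expR Y.
have C20 : 0 <= C2 by rewrite !mulr_ge0 ?expR_ge0 ?exprn_ge0.
exists (expR (2 * H)), C2; split; rewrite ?expR_ge0 // => lam k lam1.
have stepE tau : visited tau ->
    \sum_b ptr tau b * expR (lam * y tau b) <= expR (C2 * lam ^+ 2).
  move=> vt; have st := sum_ptr Dpos (visited_live vt).
  have sy : \sum_b ptr tau b * y tau b = 0.
    have := hg _ vt; rewrite /drift => e.
    rewrite (eq_bigr (fun b => ptr tau b * (F tau b - c) +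
      ptr tau b * g (Some b) + ptr tau b * (- g tau))); last first.
      by move=> b _; rewrite /y; ring.
    by rewrite !big_split /= -mulr_suml st mul1r -e; ring.
  apply: (@le_trans _ _ (1 + C2 * lam ^+ 2)); last exact: expR_ge1Dx.
  apply: (@le_trans _ _ (\sum_b (ptr tau b * (1 + C2 * lam ^+ 2) +
      lam * (ptr tau b * y tau b)))).
    apply: ler_sum => b _.
    have -> : ptr tau b * (1 + C2 * lam ^+ 2) + lam * (ptr tau b * y tau b) =
      ptr tau b * (1 + C2 * lam ^+ 2 + lam * y tau b) by ring.
    rewrite ler_wpM2l ?ptr_ge0 //.
    apply: le_trans (expR_le_quadratic _) _.
    have yY := hY (tau, b); rewrite /= in yY.
    have ll : lam ^+ 2 <= 1 by rewrite -real_normK ?num_real // expr_le1.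
    have ly : `|lam * y tau b| <= Y.
      by rewrite normrM -[Y]mul1r ler_pM.
    rewrite addrAC lerD2r lerD2l exprMn /C2.
    have -> : 4 * (lam ^+ 2 * y tau b ^+ 2) * expR `|lam * y tau b| =
      (4 * lam ^+ 2) * (y tau b ^+ 2 * expR `|lam * y tau b|) by ring.
    have -> : 4 * Y ^+ 2 * expR Y * lam ^+ 2 = (4 * lam ^+ 2) * (Y ^+ 2 * expR Y) by ring.
    apply: ler_wpM2l; first by rewrite mulr_ge0 ?sqr_ge0.
    apply: ler_pM; rewrite ?sqr_ge0 ?expR_ge0 ?ler_expR //.
    by rewrite -real_normK ?num_real // ler_pXn2r ?nnegrE.
  by rewrite big_split /= -mulr_suml st mul1r -mulr_sumr sy mulr0 addr0.
pose u l := expR (lam * (dev l + g (top None l))).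
have EkE : expR (C2 * lam ^+ 2 * k%:R) = expR (C2 * lam ^+ 2) ^+ k.
  by rewrite mulrC expRM_natl.
have E0 : 0 <= expR (C2 * lam ^+ 2) by exact: expR_ge0.
move: stepE E0; rewrite {}EkE; set E := expR (C2 * lam ^+ 2) => stepE E0.
have hu l : visited (top None l) ->
    iter k T u l <= u l * E ^+ k.
  elim: k l => [|k IH] l vl; first by rewrite mulr1.
  rewrite iterS; apply: (@le_trans _ _ (T (fun s => u s * E ^+ k) l)).
    apply: T_le => b p0; apply: IH; exact: visited_next p0.
  rewrite TMr exprS mulrA ler_wpM2r ?exprn_ge0 //.
  have -> : T u l = u l * \sum_b ptr (top None l) b * expR (lam * y (top None l) b).
    rewrite mulr_sumr; apply: eq_bigr => b _; rewrite mulrCA -expRD.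
    by congr (_ * expR _); rewrite dev_cons /y; ring.
  by rewrite ler_wpM2l ?expR_ge0 // stepE.
have lH (tau : option O) : - H <= lam * g tau <= H.
  rewrite -ler_norml normrM -[H]mul1r ler_pM //; exact: hH.
have v0 : visited None by exists [::].
apply: (@le_trans _ _ (iter k T (fun l => u l * expR H) [::])).
  apply: iterT_le => l _ _; rewrite /u -expRD ler_expR (mulrDr lam (dev l)).
  have /andP[] := lH (top None l). lra.
rewrite iterT_Mr.
have -> : expR (2 * H) = expR H * expR H by rewrite -expRD; congr expR; ring.
rewrite [leRHS]mulrAC ler_wpM2r ?expR_ge0 //.
apply: le_trans (hu [::] v0) _; rewrite ler_wpM2r ?exprn_ge0 //.
rewrite /u ler_expR /dev /= mulr0 subrr add0r.
by have /andP[] := lH None; lra.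
Qed.

End Additive.

(** * Last entrance times *)

Section PowerSums.
Variable R : realType.

Lemma sum_geom_le (x : R) n : 0 <= x < 1 -> \sum_(t < n) x ^+ t <= (1 - x)^-1.
Proof.
move=> /andP[x0 x1]; rewrite -[leRHS]mul1r ler_pdivlMr ?subr_gt0 //.
suff -> : (\sum_(t < n) x ^+ t) * (1 - x) = 1 - x ^+ n by rewrite gerBl exprn_ge0.
elim: n => [|n IH]; first by rewrite big_ord0 mul0r expr0 subrr.
rewrite big_ord_recr /= mulrDl IH exprS; ring.
Qed.

Lemma sqr_nat_le_exp (mu : R) (t : nat) : 0 < mu ->
  t%:R ^+ 2 <= 2 / mu ^+ 2 * expR mu ^+ t.
Proof.
move=> m0; rewrite mulrAC ler_pdivlMr ?exprn_gt0 // -expRM_natl.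
have x0 : 0 <= t%:R * mu :> R by rewrite mulr_ge0 // ltW.
have := expR_ge1Dxn 1 x0; rewrite -exprMn.
have -> : (2`!)%:R = 2 :> R by [].
have := sqr_ge0 (t%:R * mu); lra.
Qed.

End PowerSums.

Section Times.
Variables (R : realType) (G : wmgraph R) (v : vertex G).
Local Notation O := (oedge G).
Local Notation w := (@weight R G).
Local Notation D := (green_inv v).
Local Notation J := (cone_prob v).
Local Notation g := (cone_loop v).
Local Notation W := (ray_weight v).
Local Notation green := (green v).
Local Notation entry := (entry_prob v).

Hypothesis Dpos : forall tau, 0 < D tau.
Hypothesis decay : exists2 theta : R, 0 < theta < 1 &
  forall tau t, g tau t <= theta ^+ t.

Definition moment1 (tau : option O) : R := limn (fun n => \sum_(t < n) t%:R * g tau t).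

(* The mean time between the last entrances of the ray at two consecutive      *)
(* levels, given that the first of its vertices has type [tau].                *)
Definition mean_step (tau : option O) : R := 1 + moment1 tau * D tau / 2.
Local Notation fT := mean_step.

Definition mean_time (l : seq O) : R := addf (fun tau _ => fT tau) l.
Local Notation meantime := mean_time.

Lemma g_exp : exists lam0 C : R, [/\ 0 < lam0 <= 1, 0 <= C &
  forall tau (lam : R) n, `|lam| <= lam0 ->
    \sum_(t < n) g tau t * expR lam ^+ t <=
    2 / D tau * expR (lam * (fT tau - 1) + C * lam ^+ 2)].
Proof.
have [theta /andP[th0 th1] hg] := decay.
pose L := - ln theta.
have L0 : 0 < L by rewrite oppr_gt0 ln_lt0 // th0.
pose lam0 := Num.min 1 (L / 3).
have l00 : 0 < lam0 by rewrite lt_min ltr01 divr_gt0.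
have l01 : lam0 <= 1 by rewrite ge_min lexx.
have l0L : lam0 <= L / 3 by rewrite ge_min lexx orbT.
(* One factor [expR lam0] absorbs [t ^+ 2], the other the exponential weight; [lam0 <= L / 3] keeps
   [x] below 1. *)
pose x := expR lam0 * expR lam0 * theta.
have x01 : 0 <= x < 1.
  rewrite !mulr_ge0 ?expR_ge0 ?(ltW th0) //= /x -expRD -[X in _ * X](@lnK _ theta) ?posrE //.
  rewrite -expRD -[X in _ < X](expR0 R) ltr_expR -/L; rewrite /L in L0 l0L *; lra.
pose Q := 2 / lam0 ^+ 2 * (1 - x)^-1.
have sqb tau t : t%:R ^+ 2 * expR lam0 ^+ t * g tau t <= 2 / lam0 ^+ 2 * x ^+ t.
  rewrite /x !exprMn !mulrA ler_pM ?g_ge0 ?mulr_ge0 ?exprn_ge0 ?expR_ge0 //.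
  by rewrite ler_wpM2r ?exprn_ge0 ?expR_ge0 // sqr_nat_le_exp.
have Q0 : 0 <= Q.
  by case/andP: x01 => _ x1; rewrite /Q mulr_ge0 ?divr_ge0 ?invr_ge0 ?sqr_ge0 // subr_ge0 ltW.
have sumQ tau n : \sum_(t < n) t%:R ^+ 2 * expR lam0 ^+ t * g tau t <= Q.
  apply: (@le_trans _ _ (\sum_(t < n) 2 / lam0 ^+ 2 * x ^+ t)).
    by apply: ler_sum => t _; exact: sqb.
  by rewrite -mulr_sumr ler_wpM2l ?divr_ge0 ?sqr_ge0 // sum_geom_le.
have e1 : 1 <= expR lam0 by rewrite -(expR0 R) ler_expR ltW.
have cvB tau : \sum_(t < n) t%:R * g tau t @[n --> \oo] --> moment1 tau.
  apply: (@ndecr_cvg_lim _ (fun n => \sum_(t < n) t%:R * g tau t) Q).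
    by move=> n; rewrite big_ord_recr lerDl mulr_ge0 // g_ge0.
  move=> n; apply: le_trans (sumQ tau n); apply: ler_sum => t _.
  rewrite ler_wpM2r ?g_ge0 // -[leLHS]mulr1 ler_pM ?exprn_ege1 //.
  by rewrite -natrX ler_nat; case: (nat_of_ord t) => // k; rewrite expnS leq_pmulr.
have Q20 : 0 <= 2 * Q by rewrite pmulr_rge0.
exists lam0, (2 * Q); split => //; first by rewrite l00.
move=> tau lam n lamle.
have D0 := Dpos tau.
have D2 : 0 < 2 / D tau by rewrite divr_gt0.
have cvU : (\sum_(t < m) g tau t + lam * (\sum_(t < m) t%:R * g tau t) +
      4 * lam ^+ 2 * Q) @[m --> \oo] --> 2 / D tau + lam * moment1 tau + 4 * lam ^+ 2 * Q.
  apply: cvgD; last exact: cvg_cst.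
  apply: cvgD; first exact: cvg_sum_g.
  exact: cvgMl_tmp.
apply: (@le_trans _ _ (2 / D tau + lam * moment1 tau + 4 * lam ^+ 2 * Q)).
  apply: (cvgr_to_ge cvU); near=> m.
  apply: (@le_trans _ _ (\sum_(t < m) g tau t * expR lam ^+ t)).
    apply: (@sumn_le _ (fun t => g tau t * expR lam ^+ t)).
      by move=> i; rewrite mulr_ge0 ?g_ge0 ?exprn_ge0 ?expR_ge0.
    by near: m; exact: nbhs_infty_ge.
  apply: (@le_trans _ _ (\sum_(t < m) (g tau t + lam * (t%:R * g tau t) +
      4 * lam ^+ 2 * (t%:R ^+ 2 * expR lam0 ^+ t * g tau t)))).
    apply: ler_sum => t _.
    have -> : g tau t + lam * (t%:R * g tau t) +
      4 * lam ^+ 2 * (t%:R ^+ 2 * expR lam0 ^+ t * g tau t) =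
      g tau t * (1 + t%:R * lam + 4 * (t%:R * lam) ^+ 2 * expR lam0 ^+ t) by ring.
    rewrite ler_wpM2l ?g_ge0 // -!expRM_natl.
    apply: le_trans (expR_le_quadratic _) _.
    rewrite lerD2l; apply: ler_wpM2l; first by rewrite mulr_ge0 ?sqr_ge0.
    by rewrite ler_expR normrM ger0_norm // ler_wpM2l.
  rewrite !big_split /= -!mulr_sumr lerD2l; apply: ler_wpM2l.
    by rewrite mulr_ge0 ?sqr_ge0.
  exact: sumQ.
have -> : 2 / D tau + lam * moment1 tau + 4 * lam ^+ 2 * Q =
  2 / D tau * (1 + (lam * (fT tau - 1) + (2 * Q) * lam ^+ 2 * D tau)).
  by rewrite /fT; field; rewrite gt_eqF.
rewrite ler_pM2l //; apply: le_trans (expR_ge1Dx _) _; rewrite ler_expR lerD2l.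
by rewrite ler_piMr ?D_le1 // (mulr_ge0 Q20) ?sqr_ge0.
Unshelve. all: by end_near. Qed.

Lemma meantime_cons b l : meantime (b :: l) = meantime l + fT (top None l).
Proof. by []. Qed.

(** By [J_conv] the law of the entrance time is an iterated convolution of loop laws, so its
    generating function is bounded by a product with one factor from [g_exp] per level. The total
    masses combine into [W l] by [W_green]. *)
Lemma entry_exp : exists lam0 C : R, [/\ 0 < lam0 <= 1, 0 <= C &
  forall (lam : R) l n, `|lam| <= lam0 ->
    \sum_(t < n) entry l t * expR lam ^+ t <=
    W l * expR (lam * meantime l + C * lam ^+ 2 * (size l)%:R)].
Proof.
have [lam0 [C [hl0 C0 hg]]] := g_exp.
exists lam0, C; split => // lam l n lamle.
set E := expR lam; have E0 : 0 < E by exact: expR_gt0.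
have hJ l' m : okst v l' -> \sum_(t < m) J None l' t [::] * E ^+ t <= green l' *
    expR (lam * (meantime l' + fT (top None l') - 1) + C * lam ^+ 2 * (size l').+1%:R).
  elim: l' m => [|b l' IH] m.
    move=> _; rewrite /meantime /= add0r mulr1; exact: hg.
  rewrite okst_cons => /andP[cb okl].
  rewrite (eq_bigr (fun t : 'I_m => 2^-1 * w b * E * conv
      (fun s => J None l' s [::] * E ^+ s) (fun s => g (Some b) s * E ^+ s) t));
    last by move=> t _; rewrite (J_conv cb) -(mulrA (_ * w b)) (conv_exp _ _ _ E0) mulrA.
  rewrite -mulr_sumr green_cons meantime_cons.
  apply: (@le_trans _ _ (2^-1 * w b * E *
     ((green l' * expR (lam * (meantime l' + fT (top None l') - 1) +
        C * lam ^+ 2 * (size l').+1%:R)) *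
      (2 / D (Some b) * expR (lam * (fT (Some b) - 1) + C * lam ^+ 2))))).
    rewrite ler_wpM2l ?mulr_ge0 ?wge0 ?invr_ge0 ?(ltW E0) //.
    have g0 t : 0 <= g (Some b) t * E ^+ t by rewrite mulr_ge0 ?g_ge0 ?exprn_ge0 ?ltW.
    have J0 t : 0 <= J None l' t [::] * E ^+ t.
      by rewrite mulr_ge0 ?J_ge0 ?exprn_ge0 ?ltW.
    apply: le_trans (sum_conv_le m J0 g0) _.
    by apply: ler_pM; rewrite ?sumr_ge0 ?IH ?hg.
  rewrite le_eqVlt; apply/orP; left; apply/eqP.
  have -> : lam * (meantime l' + fT (top None l') + fT (top None (b :: l')) - 1) +
      C * lam ^+ 2 * (size (b :: l')).+1%:R =
      lam + ((lam * (meantime l' + fT (top None l') - 1) +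
        C * lam ^+ 2 * (size l').+1%:R) +
      (lam * (fT (Some b) - 1) + C * lam ^+ 2)).
    rewrite /= -[(size l').+2]addn1 natrD; ring.
  rewrite !expRD -/E; field; rewrite gt_eqF //.
have lb : 0 <= C * lam ^+ 2 * (size l)%:R.
  by rewrite mulr_ge0 // mulr_ge0 // sqr_ge0.
have nokc : ~~ okst v l -> \sum_(t < n) entry l t * E ^+ t <=
    W l * expR (lam * meantime l + C * lam ^+ 2 * (size l)%:R).
  move=> nok; rewrite big1 ?mulr_ge0 ?W_ge0 ?expR_ge0 // => t _.
  by rewrite /entry_prob (negbTE nok) mul0r.
case: l lb nokc => [|b l] lb nokc.
  case: n {nokc} => [|n]; first by rewrite big_ord0 mulr_ge0 ?expR_ge0.
  rewrite big_ord_recl big1 => [|t _]; last by rewrite mul0r.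
  by rewrite addr0 !mul1r expr0 -(expR0 R) ler_expR /meantime /= mulr0 add0r.
have [okb|/nokc //] := boolP (okst v (b :: l)).
case: n {nokc} => [|n]; first by rewrite big_ord0 mulr_ge0 ?W_ge0 ?expR_ge0.
rewrite big_ord_recl [X in X * _](_ : _ = 0); last by rewrite /entry_prob okb.
rewrite mul0r add0r.
rewrite (eq_bigr (fun t : 'I_n => (J None l t [::] * E ^+ t) *
  (2^-1 * w b * no_return v b * E))); last first.
  by move=> t _; rewrite lift0 /entry_prob okb exprS; ring.
rewrite -mulr_suml W_green //.
have okl : okst v l by move: okb; rewrite okst_cons => /andP[].
apply: le_trans (ler_wpM2r _ (hJ _ _ okl)) _.
  by rewrite !mulr_ge0 ?invr_ge0 ?wge0 ?q_ge0 ?ltW.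
rewrite le_eqVlt; apply/orP; left; apply/eqP.
have -> : lam * meantime (b :: l) + C * lam ^+ 2 * (size (b :: l))%:R =
   lam + (lam * (meantime l + fT (top None l) - 1) +
   C * lam ^+ 2 * (size l).+1%:R) by rewrite meantime_cons /=; ring.
rewrite [expR (lam + _)]expRD -/E; ring.
Qed.

End Times.

(** * Probabilities of events as real numbers, and countable partitions *)

Section RealProbability.
Variables (R : realType) (d : measure_display) (Omega : measurableType d).
Variable P : probability Omega R.
Implicit Types A B : set Omega.

Definition prob A : R := fine (P A).
Local Notation pr := prob.

Lemma prE A : measurable A -> P A = (pr A)%:E.
Proof. by move=> mA; rewrite fineK // fin_num_measure. Qed.

Lemma pr_ge0 A : 0 <= pr A.
Proof. by rewrite fine_ge0. Qed.

Lemma pr_le A B : measurable A -> measurable B -> A `<=` B -> pr A <= pr B.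
Proof.
by move=> mA mB AB; rewrite -lee_fin -!prE // le_measure // inE.
Qed.

Lemma prT : pr setT = 1.
Proof. by rewrite /pr probability_setT. Qed.

Lemma pr_le1 A : measurable A -> pr A <= 1.
Proof. by move=> mA; rewrite -prT pr_le. Qed.

Lemma pr0 : pr set0 = 0.
Proof. by rewrite /pr measure0. Qed.

Lemma prID A B : measurable A -> measurable B ->
  pr A = pr (A `&` B) + pr (A `\` B).
Proof.
move=> mA mB; apply: EFin_inj; rewrite EFinD -!prE //; first last.
  exact: measurableI.
  exact: measurableD.
by rewrite addeC; exact: measureDI.
Qed.

Lemma prU_le A B : measurable A -> measurable B ->
  pr (A `|` B) <= pr A + pr B.
Proof.
move=> mA mB; rewrite -lee_fin EFinD -!prE //; last exact: measurableU.
exact: measureU2.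
Qed.

Lemma prC A : measurable A -> pr (~` A) = 1 - pr A.
Proof.
move=> mA; rewrite -prT (@prID setT A) // setTI setTD; lra.
Qed.

Lemma sum_pr_le (I : eqType) (s : seq I) (F : I -> set Omega) B :
  uniq s -> measurable B -> (forall i, i \in s -> measurable (F i)) ->
  (forall i, i \in s -> F i `<=` B) ->
  (forall i j, i \in s -> j \in s -> i != j -> F i `&` F j = set0) ->
  \sum_(i <- s) pr (F i) <= pr B.
Proof.
elim: s B => [|i s IH] B; first by rewrite big_nil pr_ge0.
move=> /= /andP[nis us] mB mF FB disj; rewrite big_cons.
have mi : measurable (F i) by apply: mF; rewrite mem_head.
rewrite (@prID B (F i)) // setIidr; last by apply: FB; rewrite mem_head.
rewrite lerD2l; apply: IH => //.
- exact: measurableD.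
- by move=> j js; apply: mF; rewrite inE js orbT.
- move=> j js w Fj; split; first by apply: (FB j); rewrite ?inE ?js ?orbT.
  move=> Fi; have : (F i `&` F j) w by [].
  rewrite disj ?mem_head ?inE ?js ?orbT //.
  by apply: contraNneq nis => ->.
- by move=> j k js ks; apply: disj; rewrite inE ?js ?ks orbT.
Qed.

Lemma pr_bigcup_null (F : nat -> set Omega) :
  (forall n, measurable (F n)) -> (forall n, pr (F n) = 0) ->
  pr (\bigcup_n F n) = 0.
Proof.
move=> mF F0; apply: EFin_inj; rewrite -prE; last exact: bigcupT_measurable.
apply/eqP; rewrite eq_le measure_ge0 andbT.
apply: le_trans (generalized_Boole_inequality P mF (bigcupT_measurable _ mF)) _.
by rewrite eseries0 // => n _ _; rewrite /= prE // F0.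
Qed.

Lemma cvg_sum_pr (F : nat -> set Omega) :
  (forall n, measurable (F n)) -> trivIset setT F ->
  \sum_(i < n) pr (F i) @[n --> \oo] --> pr (\bigcup_n F n).
Proof.
move=> mF tF.
have mU := bigcupT_measurable _ mF.
have : (\sum_(0 <= i < n) P (F i))%E @[n --> \oo] --> (pr (\bigcup_n F n))%:E.
  by rewrite -(prE mU); exact: measure_semi_sigma_additive.
have E n : (\sum_(0 <= i < n) P (F i))%E = (\sum_(i < n) pr (F i))%:E.
  by rewrite -sumEFin big_mkord; apply: eq_bigr => i _; rewrite prE.
by under eq_fun do rewrite E; move/fine_cvgP => [].
Qed.

Lemma cvg_pr_bigcap (F : nat -> set Omega) :
  (forall n, measurable (F n)) -> (forall n, F n.+1 `<=` F n) ->
  pr (F n) @[n --> \oo] --> pr (\bigcap_n F n).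
Proof.
move=> mF FS.
have mI := bigcapT_measurable mF.
have h : (P \o F) n @[n --> \oo] --> P (\bigcap_n F n).
  have P0 : (P (F 0%N) < +oo)%E by rewrite prE ?ltry.
  apply: nonincreasing_cvg_mu => //.
  move=> m n /subnK <-; rewrite subsetEset.
  by elim: (n - m)%N => [|k IH] //; rewrite addSn; exact: subset_trans (FS _) IH.
by rewrite (prE mI) in h; move/fine_cvgP : h => [].
Qed.

Section Countable.
Variables (I : countType) (f : Omega -> I).
Hypothesis mf : forall i, measurable [set w | f w = i].

Lemma measurable_preim (Q : set I) : measurable [set w | Q (f w)].
Proof.
rewrite (_ : [set w | Q (f w)] =
    \bigcup_i (if `[< Q i >] then [set w | f w = i] else set0)).
  apply: countable_bigcupT_measurable; first exact: countableP.
  by move=> i; case: asboolP => // _; exact: measurable0.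
apply/seteqP; split => [w /= Qw|w [i _]].
  by exists (f w) => //; case: asboolP.
by case: asboolP => [Qi /= ->|_ []].
Qed.

(** Serves to extend the Markov property from single trajectories to arbitrary past events, and to
    prove that an event is null state by state. *)
Lemma pr_scale_fibers (A B : set Omega) (k : R) :
  measurable A -> measurable B ->
  (forall i, pr (A `&` [set w | f w = i]) = k * pr (B `&` [set w | f w = i])) ->
  pr A = k * pr B.
Proof.
move=> mA mB h.
pose F (C : set Omega) n := C `&` [set w | pickle (f w) = n].
have mF C : measurable C -> forall n, measurable (F C n).
  by move=> mC n; apply: measurableI => //; exact: (measurable_preim (fun i => pickle i = n)).
have tF C : trivIset setT (F C).
  apply/trivIsetP => i j _ _ /eqP ij; apply/seteqP; split => // w [[_ /= e1] [_ /= e2]].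
  by case: ij; rewrite -e1.
have UF C : \bigcup_n F C n = C.
  by apply/seteqP; split => [w [n _ []]|w Cw] //; exists (pickle (f w)).
have FE n : pr (F A n) = k * pr (F B n).
  have [[i ni]|none] := pselect (exists i : I, pickle i = n).
    have e C : F C n = C `&` [set w | f w = i].
      apply/seteqP; split => w [Cw /=].
        by rewrite -ni => /(pcan_inj (@pickleK _)).
      by move=> e; split => //=; rewrite e.
    by rewrite !e h.
  have e C : F C n = set0.
    by apply/seteqP; split => // w [_ /= e]; case: none; exists (f w).
  by rewrite !e pr0 mulr0.
have cA := cvg_sum_pr (mF A mA) (tF A); rewrite UF in cA.
have cB := cvg_sum_pr (mF B mB) (tF B); rewrite UF in cB.
have cB' : k * (\sum_(i < n) pr (F B i)) @[n --> \oo] --> k * pr B.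
  exact: cvgMl_tmp.
have e : (fun n => \sum_(i < n) pr (F A i)) = (fun n => k * \sum_(i < n) pr (F B i)).
  by apply/funext => n; rewrite mulr_sumr; apply: eq_bigr => i _.
by rewrite e in cA; rewrite -(cvg_lim _ cA) // -(cvg_lim _ cB').
Qed.

Lemma pr_split_fibers (A : set Omega) (s : seq I) : measurable A -> uniq s ->
  pr A = \sum_(i <- s) pr (A `&` [set w | f w = i]) +
    pr (A `&` [set w | f w \notin s]).
Proof.
move=> mA; elim: s => [_|i s IH /= /andP[nis us]].
  by rewrite big_nil add0r; congr pr; apply/seteqP; split => // w [].
rewrite (IH us) big_cons -addrA addrCA; congr (_ + _).
rewrite (@prID (A `&` [set w | f w \notin s]) [set w | f w = i]) //.
  congr (pr _ + pr _); apply/seteqP; split => w /=.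
  - by move=> [[]].
  - by move=> [Aw ->].
  - by move=> [[Aw nw] /eqP ne]; split => //; rewrite inE negb_or ne.
  - by move=> [Aw]; rewrite inE negb_or => /andP[/eqP ne nw].
by apply: measurableI => //; exact: (measurable_preim (fun i => i \notin s)).
Qed.

End Countable.

End RealProbability.

(** * The random walk on the universal cover *)

Section CoverStacks.
Variables (R : realType) (G : wmgraph R) (v : vertex G).
Local Notation O := (oedge G).
Local Notation w := (@weight R G).
Local Notation child := (child v).
Local Notation Lop := (cone_step v).
Local Notation okst := (okst v).
Local Notation endv := (endv v).
Local Notation U := (ucover v).
Implicit Types (x y z : U) (l : seq O).

(** With the last label first, a step of the walk acts on the head of the list, and [subtree]
    becomes the suffix relation [incone]. *)
Definition stk x : seq O := rev (val x).

Lemma nb_path_okst (p : seq O) : nb_path v p = okst (rev p).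
Proof.
elim/last_ind: p => // p a IH; rewrite rev_rcons okst_cons -IH.
case: p {IH} => [|b p]; first by rewrite /nb_path /= !andbT.
have -> : child (top None (rev (b :: p))) a = nb_next (last b p) a.
  by rewrite lastI rev_rcons.
by rewrite /nb_path rcons_cons /= rcons_path andbA andbC.
Qed.

Lemma stk_ok x : okst (stk x).
Proof. by rewrite /stk -nb_path_okst; exact: valP x. Qed.

Lemma stk_inj : injective stk.
Proof. by move=> x y /(can_inj revK) /val_inj. Qed.

Lemma stk_surj l : okst l -> exists x, stk x = l.
Proof.
rewrite -[l]revK -nb_path_okst => h.
by exists (exist _ (rev l) h).
Qed.

Definition move_st l (a : O) : seq O :=
  if l is c :: l' then if a == oinv c then l' else a :: l else [:: a].

Lemma move_st_ok l a : okst l -> src a = endv l -> okst (move_st l a).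
Proof.
case: l => [|c l] okl sa; first by rewrite /= sa /= eqxx.
rewrite /move_st; case: eqVneq => [_|ac].
  by move: okl; rewrite okst_cons => /andP[].
by rewrite okst_cons okl andbT /= /nb_next ac sa eqxx.
Qed.

Definition move y (a : O) : U :=
  insubd (y : {p | nb_path v p}) (rev (move_st (stk y) a)).

Lemma stk_move y a : src a = endv (stk y) -> stk (move y a) = move_st (stk y) a.
Proof.
move=> sa; have h : nb_path v (rev (move_st (stk y) a)).
  by rewrite nb_path_okst revK move_st_ok // stk_ok.
by rewrite /stk /move /insubd insubT /= revK.
Qed.

Lemma cover_arc_stk y a z : cover_arc y a z =
  (stk z == a :: stk y) || (stk y == oinv a :: stk z).
Proof.
by rewrite /cover_arc /stk -!rev_rcons !(inj_eq (can_inj revK)).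
Qed.

Lemma endv_pop c l : okst (c :: l) -> endv l = src c.
Proof.
rewrite okst_cons => /andP[+ _]; case: l => [|d l] /=; first by move/eqP.
by case/andP => /eqP.
Qed.

Lemma cover_arcE y a z :
  cover_arc y a z = (src a == endv (stk y)) && (move y a == z).
Proof.
rewrite cover_arc_stk; have oky := stk_ok y; have okz := stk_ok z.
apply/idP/idP => [/orP[/eqP e|/eqP e]|/andP[/eqP sa /eqP <-]].
- rewrite e in okz; have sa : src a = endv (stk y) by rewrite (endv_pop okz).
  rewrite sa eqxx /=; apply/eqP/stk_inj; rewrite stk_move // e.
  move: okz; rewrite okst_cons => /andP[+ _].
  by case: (stk y) => //= c l /andP[_ /negbTE ->].
- have sa : src a = endv (stk y) by rewrite e /= tgt_oinv.
  rewrite sa eqxx /=; apply/eqP/stk_inj; rewrite stk_move // e /=.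
  by rewrite oinvK eqxx.
- rewrite stk_move //; case: (stk y) => [|c l].
    by apply/orP; left; apply/eqP.
  rewrite /move_st; case: (eqVneq a (oinv c)) => [->|_]; apply/orP; last by left.
  by right; rewrite oinvK.
Qed.

Definition stepU (u : U -> R) y : R :=
  2^-1 * u y + 2^-1 * \sum_(a | src a == endv (stk y)) w a * u (move y a).

Lemma stepU_Lop (f : seq O -> R) y :
  stepU (fun z => f (stk z)) y = Lop None f (stk y).
Proof.
rewrite /stepU /cone_step; congr (_ + _ * _).
transitivity (\sum_(a | src a == endv (stk y)) w a * f (move_st (stk y) a)).
  by apply: eq_bigr => a /eqP sa; rewrite stk_move.
case: (stk y) => [|c l] /=; first by rewrite add0r.
rewrite (sum_out_child v) eqxx; congr (_ + _).
by apply: eq_bigr => b /andP[_ /negbTE ->].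
Qed.

Definition nbrs y : seq U :=
  undup (y :: [seq move y a | a <- enum {: O} & src a == endv (stk y)]).

Lemma nbrs_uniq y : uniq (nbrs y). Proof. exact: undup_uniq. Qed.

Lemma sum_cover_rw y (u : U -> R) :
  \sum_(z <- nbrs y) cover_rw y z * u z = stepU u y.
Proof.
have pick z0 : z0 \in nbrs y -> \sum_(z <- nbrs y) (z0 == z)%:R * u z = u z0.
  move=> z0n; rewrite (bigD1_seq z0) //= ?undup_uniq // eqxx mul1r big1 ?addr0 //.
  by move=> z zz0; rewrite eq_sym (negbTE zz0) mul0r.
rewrite (eq_bigr (fun z => 2^-1 * ((y == z)%:R * u z) + 2^-1 *
   \sum_(a | src a == endv (stk y)) w a * ((move y a == z)%:R * u z))); last first.
  move=> z _; rewrite /cover_rw /lazy_kernel mulrDl -!mulrA mulr_suml.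
  congr (_ + _ * _); rewrite [RHS]big_mkcond [LHS]big_mkcond /=.
  apply: eq_bigr => a _; rewrite cover_arcE.
  by case: (_ == _) => //=; case: (_ == z); rewrite ?mul1r // mul0r mulr0.
rewrite big_split /= -!mulr_sumr pick ?mem_undup ?mem_head //; congr (_ + _ * _).
rewrite exchange_big /=; apply: eq_bigr => a sa; rewrite -mulr_sumr pick //.
by rewrite mem_undup inE map_f ?orbT // mem_filter sa mem_enum.
Qed.

Lemma sum_cover_rw1 y : \sum_(z <- nbrs y) cover_rw y z = 1.
Proof.
under eq_bigr do rewrite -[cover_rw _ _]mulr1.
by rewrite (sum_cover_rw y (fun=> 1)) (stepU_Lop (fun=> 1)) Lop1; case: stk;
  rewrite ?subr0 //= mulr0 subr0.
Qed.

Lemma cover_rw_push y x b l : stk y = l -> stk x = b :: l ->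
  cover_rw y x = 2^-1 * w b.
Proof.
move=> yl xl; rewrite /cover_rw /lazy_kernel.
have -> : (y == x) = false.
  by apply/eqP => e; move: xl; rewrite -e yl => /(congr1 size) /=; lia.
rewrite mulr0 add0r (bigD1 b) /=; last first.
  by rewrite cover_arc_stk xl yl eqxx.
rewrite big1 ?addr0 // => a; rewrite cover_arc_stk xl yl.
move=> /andP[/orP[/eqP[->]|/eqP /(congr1 size) /=]]; first by rewrite eqxx.
by lia.
Qed.

Lemma nbrs_stk y z : z \in nbrs y ->
  [\/ stk z = stk y, exists b, stk z = b :: stk y | exists b, stk y = b :: stk z].
Proof.
rewrite mem_undup inE => /orP[/eqP->|]; first by constructor 1.
move=> /mapP[a]; rewrite mem_filter => /andP[/eqP sa _] ->.
rewrite stk_move //; case: (stk y) => [|c l] /=; first by constructor 2; exists a.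
by case: ifP => _; [constructor 3; exists c|constructor 2; exists a].
Qed.

Lemma subtree_incone x y : subtree x y <-> incone (stk x) (stk y).
Proof.
rewrite /subtree /=; split => [/prefixP[s e]|/inconeP[s e]].
  have e' : val y = val x ++ s by [].
  by apply/inconeP; exists (rev s); rewrite /stk e' rev_cat.
apply/prefixP; exists (rev s); apply: (can_inj revK).
by rewrite rev_cat revK -/(stk x) -e.
Qed.

End CoverStacks.

Section CoverWalk.
Variables (R : realType) (G : wmgraph R) (v : vertex G).
Variables (d : measure_display) (Omega : measurableType d).
Variables (P : probability Omega R) (X : nat -> Omega -> ucover v).
Local Notation O := (oedge G).
Local Notation w := (@weight R G).
Local Notation U := (ucover v).
Local Notation root := (cover_root v).
Local Notation pr := (prob P).
Local Notation Lop := (cone_step v).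
Local Notation Hit := (Hit v).
Local Notation J := (cone_prob v).
Local Notation q := (no_return v).
Local Notation okst := (okst v).

Hypothesis X_rw : markov_chain (@cover_rw R G v) root P X.

Lemma mX t x : measurable [set w | X t w = x].
Proof. by case: X_rw. Qed.

Lemma mXQ t (Q : set U) : measurable [set w | Q (X t w)].
Proof. exact: measurable_preim (mX t) Q. Qed.

Lemma pr_root : pr [set w | X 0%N w = root] = 1.
Proof. by case: X_rw => _ h _; rewrite /prob h. Qed.

Lemma pr_full (F A : set Omega) : measurable F -> measurable A -> pr F = 1 ->
  pr (A `&` F) = pr A.
Proof.
move=> mF mA F1; rewrite [RHS](prID P mA mF) -[LHS]addr0; congr (_ + _).
apply/le_anti; rewrite pr_ge0 /= -(subrr 1) -{2}F1 -prC //; apply: pr_le.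
- exact: measurableD.
- exact: measurableC.
- by move=> x [].
Qed.

Lemma pr_null (F A : set Omega) : measurable F -> measurable A -> pr F = 0 ->
  A `<=` F -> pr A = 0.
Proof. by move=> mF mA F0 AF; apply/le_anti; rewrite pr_ge0 -F0 pr_le. Qed.

Definition past t (A : set Omega) : Prop := forall w1 w2,
  (forall i, (i <= t)%N -> X i w1 = X i w2) -> A w1 -> A w2.

Let cyl t (x : nat -> U) : set Omega :=
  [set w | forall i, (i <= t)%N -> X i w = x i].

Let mcyl t x : measurable (cyl t x).
Proof.
rewrite (_ : cyl t x = \bigcap_i [set w | (i <= t)%N -> X i w = x i]); last first.
  by apply/seteqP; split => [w h i _|w h i] //; exact: h.
apply: bigcapT_measurable => i; case: (leqP i t) => it.
  rewrite (_ : [set _ | _] = [set w | X i w = x i]); first exact: mX.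
  by apply/seteqP; split => [w /= h|w h _] //; exact: h.
by rewrite (_ : [set _ | _] = setT) //; apply/seteqP; split.
Qed.

Let traj t w : seq U := [seq X i w | i <- iota 0 t.+1].

Let trajE t w s : traj t w = s <->
  size s = t.+1 /\ forall i, (i <= t)%N -> X i w = nth root s i.
Proof.
split=> [<-|[st h]].
  split; first by rewrite size_map size_iota.
  by move=> i it; rewrite (nth_map 0%N) ?size_iota // nth_iota.
apply: (@eq_from_nth _ root); first by rewrite size_map size_iota st.
move=> i; rewrite size_map size_iota => it.
by rewrite (nth_map 0%N) ?size_iota // nth_iota // h.
Qed.

Let mtraj t s : measurable [set w | traj t w = s].
Proof.
have [st|st] := eqVneq (size s) t.+1.
  rewrite (_ : [set _ | _] = cyl t (nth root s)); first exact: mcyl.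
  by apply/seteqP; split => w /= => [/trajE[]|h] //; apply/trajE.
rewrite (_ : [set _ | _] = set0) //.
by apply/seteqP; split => // w /= /trajE[e]; rewrite e eqxx in st.
Qed.

(** [markov_chain] speaks of single trajectories only. An event of the past is a union of
    trajectories up to time [t], and these are countably many. *)
Lemma markov_step t A x y : measurable A -> past t A ->
  pr (A `&` [set w | X t w = x] `&` [set w | X t.+1 w = y]) =
  cover_rw x y * pr (A `&` [set w | X t w = x]).
Proof.
move=> mA pA.
have mB := measurableI _ _ mA (mX t x).
have mC := measurableI _ _ mB (mX t.+1 y).
apply: (@pr_scale_fibers _ _ _ P _ (traj t) _ _ _ _ mC mB); first exact: mtraj.
move=> s; have [[w0 [[Aw0 xw0] sw0]]|none] := pselect (exists w0,
    (A `&` [set w | X t w = x] `&` [set w | traj t w = s]) w0); last first.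
  rewrite [X in prob _ X = _](_ : _ = set0); last first.
    by apply/seteqP; split => // w [[hw _] tw]; apply: none; exists w.
  rewrite [X in _ = _ * prob _ X](_ : _ = set0); last first.
    by apply/seteqP; split => // w hw; apply: none; exists w.
  by rewrite pr0 mulr0.
have [ss hs] := (trajE t w0 s).1 sw0.
pose xs i := if (i <= t)%N then nth root s i else y.
have e1 : A `&` [set w | X t w = x] `&` [set w | traj t w = s] = cyl t xs.
  apply/seteqP; split => [w' [_ /trajE[_ h]] i it|w' h].
    by rewrite /xs it h.
  have hw i : (i <= t)%N -> X i w0 = X i w'.
    by move=> it; rewrite h // hs // /xs it.
  split; first split.
  - exact: pA hw Aw0.
  - by rewrite /= -hw // xw0.
  - by apply/trajE; split => // i it; rewrite h // /xs it.
have e2 : A `&` [set w | X t w = x] `&` [set w | X t.+1 w = y] `&`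
    [set w | traj t w = s] = cyl t.+1 xs.
  apply/seteqP; split => [w' [[hw yw] sw] i it|w' h].
    have hc : cyl t xs w' by rewrite -e1.
    move: it; rewrite leq_eqVlt => /orP[/eqP->|]; last by rewrite ltnS; exact: hc.
    by rewrite /xs ltnn.
  have [h1 h2] : (A `&` [set w | X t w = x] `&` [set w | traj t w = s]) w'.
    by rewrite e1 => i it; apply: h; exact: leqW.
  by split => //; split => //; rewrite /= h // /xs ltnn.
have E : P (cyl t.+1 xs) = (P (cyl t xs) * (cover_rw (xs t) (xs t.+1))%:E)%E.
  by case: X_rw => _ _; exact.
rewrite e1 e2 /prob E (prE P (mcyl t xs)) -EFinM /= mulrC; congr (cover_rw _ _ * _).
  by rewrite /xs leqnn -hs.
by rewrite /xs ltnn.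
Qed.

Lemma nbrs_null t A y : measurable A -> past t A ->
  pr (A `&` [set w | X t w = y] `&` [set w | X t.+1 w \notin nbrs y]) = 0.
Proof.
move=> mA pA; have mB := measurableI _ _ mA (mX t y).
have := pr_split_fibers P (mX t.+1) mB (nbrs_uniq y).
under eq_bigr do rewrite markov_step //.
by rewrite -mulr_suml sum_cover_rw1 mul1r; lra.
Qed.

Lemma past_setT t : past t setT. Proof. by []. Qed.

Lemma past_X t i A : (i <= t)%N -> past t A -> forall x : U,
  past t (A `&` [set w | X i w = x]).
Proof.
move=> it pA x w1 w2 h [Aw /= xw]; split; first exact: pA h Aw.
by rewrite /= -h.
Qed.

Lemma pastS t A : past t A -> past t.+1 A.
Proof. by move=> pA w1 w2 h; apply: pA => i it; apply: h; exact: leqW. Qed.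

(* Backward equation for events [ev m t] about the positions between times     *)
(* [t] and [t + m], with [V m y] their probability from [y]. *)
Lemma markov_future (ev : nat -> nat -> set Omega) (V : nat -> U -> R)
    (S : pred U) :
  (forall m t, measurable (ev m t)) ->
  (forall t y A, measurable A ->
     pr (A `&` [set w | X t w = y] `&` ev 0%N t) =
     pr (A `&` [set w | X t w = y]) * V 0%N y) ->
  (forall m t w, S (X t w) -> ev m.+1 t w <-> ev m t.+1 w) ->
  (forall m t w, ~~ S (X t w) -> ~ ev m.+1 t w) ->
  (forall m y, V m.+1 y = if S y then stepU (V m) y else 0) ->
  forall m t A y, measurable A -> past t A ->
    pr (A `&` [set w | X t w = y] `&` ev m t) =
    pr (A `&` [set w | X t w = y]) * V m y.
Proof.
move=> mev ev0 evS evN VS; elim=> [|m IH] t A y mA pA; first exact: ev0.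
have mB := measurableI _ _ mA (mX t y).
rewrite VS; case: ifP => Sy; last first.
  rewrite mulr0 -[RHS](pr0 P); congr pr; apply/seteqP; split => // w [[_ /= xy]].
  by apply: evN; rewrite xy Sy.
have -> : A `&` [set w | X t w = y] `&` ev m.+1 t =
    A `&` [set w | X t w = y] `&` ev m t.+1.
  by apply/seteqP; split => w [[Aw /= xy] h]; split => //;
    move: h; rewrite evS // xy Sy.
have mC := measurableI _ _ mB (mev m t.+1).
rewrite (pr_split_fibers P (mX t.+1) mC (nbrs_uniq y)).
have mN := mXQ t.+1 (fun z => z \notin nbrs y).
rewrite (@pr_null _ _ _ _ (nbrs_null y mA pA)); first last.
- by move=> w [[[? ?] _] ?].
- exact: (measurableI _ _ mC mN).
- exact: (measurableI _ _ mB mN).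
rewrite addr0 -sum_cover_rw mulr_sumr; apply: eq_bigr => z _.
rewrite (setIAC (A `&` _)) IH //; last first.
  by apply: pastS; apply: past_X.
by rewrite markov_step // mulrAC mulrC mulrA.
Qed.

Lemma pr_X t x : pr [set w | X t w = x] = J None (stk x) t [::].
Proof.
have h := @markov_future (fun m t => [set w | X (t + m)%N w = x])
  (fun m y => J None (stk x) m (stk y)) predT.
have := h _ _ _ _ _ t 0%N setT root.
rewrite setTI pr_root mul1r => <- //.
- by rewrite setIC pr_full //; [exact: mX|exact: mX|exact: pr_root].
- by move=> m t'; exact: mX.
- move=> t' y A mA; rewrite J0; case: eqVneq => [/stk_inj->|yx].
    rewrite mulr1; congr pr; apply/seteqP; split => [w' []|w' [Aw /= xw]] //.
    by split => //=; rewrite addn0.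
  rewrite mulr0 -[RHS](pr0 P); congr pr; apply/seteqP; split => // w' [[_ /= e]].
  by rewrite addn0 e => e'; rewrite e' eqxx in yx.
- by move=> m t' w' _ /=; rewrite addSnnS.
- by move=> m y; rewrite stepU_Lop.
Qed.

Section Stay.
Variables (a : O) (l0 : seq O).
Let xs := a :: l0.

(** Leaving the cone of [xs] from [s ++ xs] amounts to popping [s ++ [:: a]]. *)
Let stayF m := coneF (fun s => 1 - Hit m (s ++ [:: a])) xs.

Let stayF_step m s : Lop None (stayF m) (s ++ xs) = stayF m.+1 (s ++ xs).
Proof.
have sF t : stayF m (t ++ xs) = 1 - Hit m (t ++ [:: a]) by exact: coneF_cat.
rewrite /stayF coneF_cat -/(stayF m).
have main c t t' : stayF m (c :: t) = 1 - Hit m (c :: t') ->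
    stayF m t = 1 - Hit m t' ->
    (forall b, stayF m [:: b, c & t] = 1 - Hit m [:: b, c & t']) ->
    Lop None (stayF m) (c :: t) = 1 - Hit m.+1 (c :: t').
  move=> e1 e2 e3; rewrite [Hit m.+1 _]/= /cone_step e1 e2 [top _ _]/= [top _ _]/=.
  under eq_bigr do rewrite e3 mulrBr mulr1.
  rewrite sumrB sum_child /=; lra.
case: s => [|c s].
  apply: main => [||b]; [exact: (sF [::])| |exact: (sF [:: b])].
  by rewrite Hit_nil subrr /stayF coneF_out //; apply/negP => /incone_size /=; lia.
apply: main => [||b]; [exact: (sF (c :: s))|exact: sF|exact: (sF [:: b, c & s])].
Qed.

Let stay m t : set Omega :=
  [set w | forall i, (i <= m)%N -> incone xs (stk (X (t + i)%N w))].

Let mstay m t : measurable (stay m t).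
Proof.
rewrite (_ : stay m t =
    \bigcap_i [set w | (i <= m)%N -> incone xs (stk (X (t + i)%N w))]); last first.
  by apply/seteqP; split => [w h i _|w h i] //; exact: h.
apply: bigcapT_measurable => i.
exact: (mXQ _ (fun z => (i <= m)%N -> incone xs (stk z))).
Qed.

Let pr_stay m t A y : measurable A -> past t A ->
  pr (A `&` [set w | X t w = y] `&` stay m t) =
  pr (A `&` [set w | X t w = y]) * stayF m (stk y).
Proof.
apply: (@markov_future stay (fun m y => stayF m (stk y)) (fun y => incone xs (stk y))).
- exact: mstay.
- move=> t' y' A' mA'; rewrite /stayF /coneF; case: ifP => c.
    have -> : Hit 0 (take (size (stk y') - size xs) (stk y') ++ [:: a]) = 0.
      by case: take.
    rewrite subr0 mulr1; congr pr; apply/seteqP; split => [w' []|w' [Aw /= xw]] //.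
    by split => // i; rewrite leqn0 => /eqP->; rewrite addn0 xw.
  rewrite mulr0 -[RHS](pr0 P); congr pr; apply/seteqP; split => // w' [[_ /= xw] h].
  by have := h 0%N isT; rewrite addn0 xw c.
- move=> m' t' w' cw; split => h i im.
    by rewrite addSnnS; apply: h.
  case: i im => [|i] im; first by rewrite addn0.
  by rewrite -addSnnS; apply: h.
- by move=> m' t' w' /negP nc h; apply: nc; have := h 0%N isT; rewrite addn0.
- move=> m' y'; rewrite stepU_Lop; case: ifP => [/inconeP[s ->]|c].
    by rewrite -stayF_step.
  by rewrite /stayF coneF_out ?c.
Qed.

Definition stay_forever t : set Omega :=
  [set w | forall i, (t <= i)%N -> incone xs (stk (X i w))].

Lemma stay_forever_cap t : stay_forever t = \bigcap_m stay m t.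
Proof.
apply/seteqP; split => [w h m _ i _|w h i ti]; first by apply: h; exact: leq_addr.
by have := h (i - t)%N I (i - t)%N (leqnn _); rewrite subnKC.
Qed.

Lemma pr_stay_forever t A y : measurable A -> past t A -> stk y = xs ->
  pr (A `&` [set w | X t w = y] `&` stay_forever t) =
  pr (A `&` [set w | X t w = y]) * q a.
Proof.
move=> mA pA yx; have mB := measurableI _ _ mA (mX t y).
have c1 : pr (A `&` [set w | X t w = y] `&` stay m t) @[m --> \oo] -->
    pr (A `&` [set w | X t w = y] `&` stay_forever t).
  rewrite stay_forever_cap -bigcapIr; last by exists 0%N.
  apply: cvg_pr_bigcap => [m|m]; first exact: measurableI.
  by apply: setIS => w' h i im; apply: h; exact: leqW.
have c2 : pr (A `&` [set w | X t w = y] `&` stay m t) @[m --> \oo] -->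
    pr (A `&` [set w | X t w = y]) * q a.
  under eq_fun do rewrite pr_stay // yx /stayF (coneF_cat _ xs [::]) /=.
  apply: cvgMl_tmp; apply: cvgB; first exact: cvg_cst.
  exact: Hit_cvg.
by rewrite -(cvg_lim _ c1) // -(cvg_lim _ c2).
Qed.

End Stay.

End CoverWalk.

(** * Law of the ray *)

Section Ray.
Variables (R : realType) (G : wmgraph R) (v : vertex G).
Variables (d : measure_display) (Omega : measurableType d).
Variables (P : probability Omega R) (X : nat -> Omega -> ucover v).
Local Notation O := (oedge G).
Local Notation w := (@weight R G).
Local Notation U := (ucover v).
Local Notation root := (cover_root v).
Local Notation pr := (prob P).
Local Notation D := (green_inv v).
Local Notation q := (no_return v).
Local Notation W := (ray_weight v).
Local Notation okst := (okst v).
Local Notation entry := (entry_prob v).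

Hypothesis X_rw : markov_chain (@cover_rw R G v) root P X.

(* The last entrance of the walk in the cone of [l] is at time [t]. *)
Definition Ev (l : seq O) (t : nat) : set Omega :=
  [set om | [/\ stk (X t om) = l,
    forall i, (t <= i)%N -> incone l (stk (X i om)) &
    if t is t'.+1 then l <> [::] /\ stk (X t' om) = behead l else l = [::]]].

Let mQ t (Q : set U) : measurable [set om | Q (X t om)] := mXQ X_rw t Q.

Let m_stay (l : seq O) t :
  measurable [set om | forall i, (t <= i)%N -> incone l (stk (X i om))].
Proof.
rewrite (_ : [set _ | _] =
    \bigcap_i [set om | (t <= i)%N -> incone l (stk (X i om))]); last first.
  by apply/seteqP; split => [om h i _|om h i]; [exact: h|move=> ti; exact: (h i)].
apply: bigcapT_measurable => i.
exact: (mQ i (fun z => (t <= i)%N -> incone l (stk z))).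
Qed.

Lemma measurable_Ev l t : measurable (Ev l t).
Proof.
rewrite (_ : Ev l t = [set om | stk (X t om) = l] `&`
  [set om | forall i, (t <= i)%N -> incone l (stk (X i om))] `&`
  [set om | if t is t'.+1 then l <> [::] /\ stk (X t' om) = behead l else l = [::]]).
  apply: measurableI; first apply: measurableI => //.
    exact: (mQ t (fun z => stk z = l)).
  case: t => [|t]; last exact: (mQ t (fun z => l <> [::] /\ stk z = behead l)).
  exact: (mQ 0%N (fun z => l = [::])).
by apply/seteqP; split => om [] => [h1 h2 h3|[h1 h2] h3].
Qed.

Lemma stk_root : stk root = [::]. Proof. by []. Qed.

(** The event is a succession of three: being at the parent one step before, crossing the last edge,
    and never leaving the cone again. *)
Lemma pr_Ev l t : pr (Ev l t) = entry l t.
Proof.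
rewrite /entry_prob; case: ifP => okl; last first.
  rewrite -[RHS](pr0 P); congr pr; apply/seteqP; split => // om [e _ _].
  by have := stk_ok (X t om); rewrite e okl.
case: l t okl => [|b l] [|t] okl.
- rewrite -(pr_root X_rw); congr pr; apply/seteqP; split => om /=.
    by case=> e _ _; apply: stk_inj.
  move=> e; split => //; first by rewrite e.
  by move=> i _; apply/inconeP; exists (stk (X i om)); rewrite cats0.
- by rewrite -[RHS](pr0 P); congr pr; apply/seteqP; split => // om [_ _ []].
- by rewrite -[RHS](pr0 P); congr pr; apply/seteqP; split => // om [_ _ []].
have okl' : okst l by move: okl; rewrite okst_cons => /andP[].
have [x xl] := stk_surj okl; have [y yl] := stk_surj okl'.
have -> : Ev (b :: l) t.+1 = (setT `&` [set om | X t om = y]) `&` [set om | X t.+1 om = x] `&`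
    stay_forever X b l t.+1.
  apply/seteqP; split => om.
    case=> e1 h [_ e2]; split => //; split; first split => //=.
      by apply: stk_inj; rewrite e2 yl.
    by apply: stk_inj; rewrite e1 xl.
  by case=> [[[_ /= e1] /= e2] h]; split => //; rewrite ?e1 ?e2.
have mT : measurable (setT `&` [set om | X t om = y]).
  by rewrite setTI; exact: mX X_rw t y.
have pT : past X t.+1 (setT `&` [set om | X t om = y]).
  by apply: pastS; apply: past_X.
rewrite (pr_stay_forever X_rw mT pT xl) (markov_step X_rw) //.
by rewrite setTI (pr_X X_rw) yl (cover_rw_push yl xl); ring.
Qed.

Lemma incone_eq l l' s : size l = size l' -> @incone O l s -> incone l' s -> l = l'.
Proof. by rewrite /incone => -> /eqP {1}<- /eqP. Qed.

Lemma Ev_disj l l' t t' om : size l = size l' -> Ev l t om -> Ev l' t' om ->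
  l = l' /\ t = t'.
Proof.
move=> sl E1 E2; have [_ h1 _] := E1; have [_ h2 _] := E2.
have ll : l = l'.
  apply: incone_eq sl (h1 (maxn t t') _) (h2 (maxn t t') _).
    exact: leq_maxl.
  exact: leq_maxr.
split=> //; rewrite -{l' sl}ll in E2 h2 *.
wlog : t t' E1 E2 h1 h2 / (t <= t')%N.
  move=> H; have [tt|/ltnW tt] := leqP t t'; first exact: H.
  by apply/esym; exact: H.
rewrite leq_eqVlt => /orP[/eqP //|].
case: t' E2 {h2} => // t' [_ _ [ln e]]; rewrite ltnS => tt.
have := h1 _ tt; rewrite e => /incone_size; rewrite size_behead.
by case: l ln {E1 h1 e} => //= b l _; lia.
Qed.

Definition good : set Omega :=
  [set om | X 0%N om = root /\ forall t, X t.+1 om \in nbrs (X t om)].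

Let m_pair t (Q : U -> U -> Prop) :
  measurable [set om | Q (X t om) (X t.+1 om)].
Proof.
apply: (@measurable_preim _ _ (U * U)%type (fun om => (X t om, X t.+1 om)) _
  (fun p => Q p.1 p.2)) => -[y z].
rewrite (_ : [set _ | _] = [set om | X t om = y] `&` [set om | X t.+1 om = z]).
  by apply: measurableI; exact: mX X_rw _ _.
by apply/seteqP; split => om /= => [[]|[-> ->]].
Qed.

Let bad t : set Omega := [set om | X t.+1 om \notin nbrs (X t om)].

Let m_bad t : measurable (bad t).
Proof. exact: (m_pair t (fun y z => z \notin nbrs y)). Qed.

Let pr_bad t : pr (bad t) = 0.
Proof.
have mT : measurable (setT : set Omega) := measurableT.
rewrite -(mul0r (pr setT)).
apply: (@pr_scale_fibers _ _ _ P _ _ (mX X_rw t) _ _ _ (m_bad t) mT) => y.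
rewrite mul0r -(nbrs_null X_rw y mT (past_setT (X := X) (t := t))).
congr pr; apply/seteqP; split => om /=.
  by case=> h e; split => //; rewrite -e.
by case=> [[_ e] h]; split => //; rewrite /bad /= e.
Qed.

Lemma goodE : good = [set om | X 0%N om = root] `&` ~` (\bigcup_t bad t).
Proof.
apply/seteqP; split => om [h1 h2]; split => //.
  by case=> t _; rewrite /bad /= h2.
move=> t; apply: contrapT => /negP h; apply: h2; exists t => //.
Qed.

Lemma measurable_good : measurable good.
Proof.
rewrite goodE; apply: measurableI; first exact: mX X_rw _ _.
exact/measurableC/bigcupT_measurable.
Qed.

Lemma pr_good : pr good = 1.
Proof.
have mB := bigcupT_measurable _ m_bad.
have B1 : pr (~` (\bigcup_t bad t)) = 1.
  by rewrite prC // pr_bigcup_null // subr0.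
rewrite goodE pr_full ?(pr_root X_rw) //; last exact: mX X_rw _ _.
exact: measurableC.
Qed.

Lemma good_lip om t i : good om ->
  (size (stk (X (t + i)%N om)) <= size (stk (X t om)) + i)%N /\
  (size (stk (X t om)) <= size (stk (X (t + i)%N om)) + i)%N.
Proof.
move=> [_ h]; elim: i => [|i [IH1 IH2]]; first by rewrite !addn0.
rewrite addnS; have := h (t + i)%N => /nbrs_stk[->|[b ->]|[b e]] /=; try lia.
by rewrite e /= in IH1 IH2; lia.
Qed.

Lemma Ev_ray x t : Ev (stk x) t `<=` [set om | ray X om x].
Proof.
move=> om [e h _]; exists t; split; first exact: stk_inj.
by move=> i ti; apply/subtree_incone; exact: h.
Qed.

(** On [good] the walk stays in place or moves along one edge at each step, so the first time from
    which it stays in the cone for ever is reached by a step from the parent, unless it is time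
    0. *)
Lemma ray_Ev x : [set om | ray X om x] `&` good `<=` \bigcup_t Ev (stk x) t.
Proof.
move=> om [[s [_ hs]] [r0 hn]].
pose Q s := `[< forall i, (s <= i)%N -> incone (stk x) (stk (X i om)) >].
have exQ : exists s, Q s.
  by exists s; apply/asboolP => i /hs /subtree_incone.
case: (ex_minnP exQ) => s0 /asboolP h0 hmin; exists s0 => //.
case: s0 h0 hmin => [|s1] h0 hmin.
  have xn : stk x = [::].
    by apply: size0nil; have := h0 0%N isT; rewrite r0 stk_root => /incone_size /=; lia.
  by split; rewrite ?r0 ?xn // -xn.
have nc : ~~ incone (stk x) (stk (X s1 om)).
  apply/negP => c1; have : Q s1.
    apply/asboolP => i; rewrite leq_eqVlt => /orP[/eqP<- //|]; exact: h0.
  by move=> /hmin; rewrite ltnn.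
have c2 := h0 s1.+1 (leqnn _).
have [e|[b e]|[b e]] := nbrs_stk (hn s1).
- by rewrite e (negbTE nc) in c2.
- rewrite e in c2; have [[|c s'] e2] := inconeP _ _ c2.
    by rewrite cat0s in e2; split => //; rewrite -?e2 //; split.
  case: e2 => _ e2; move/negP: nc; case; apply/inconeP; by exists s'.
- move/negP: nc; case; rewrite e; have [s' e2] := inconeP _ _ c2.
  by apply/inconeP; exists (b :: s'); rewrite e2.
Qed.

Lemma measurable_ray x : measurable [set om | ray X om x].
Proof.
rewrite (_ : [set _ | _] = \bigcup_s ([set om | X s om = x] `&`
    [set om | forall i, (s <= i)%N -> incone (stk x) (stk (X i om))])).
  apply: bigcupT_measurable => s; apply: measurableI => //; exact: mX X_rw _ _.
apply/seteqP; split => om.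
  by case=> s [e h]; exists s => //; split => //= i /h /subtree_incone.
by case=> s _ [e h]; exists s; split => // i ti; apply/subtree_incone/h.
Qed.

Lemma cvg_entry_ray x :
  \sum_(t < n) entry (stk x) t @[n --> \oo] --> ray_prob P X x.
Proof.
have mE := measurable_Ev (stk x).
have mU := bigcupT_measurable _ mE.
have tE : trivIset setT (Ev (stk x)).
  apply/trivIsetP => i j _ _ /eqP ij; apply/seteqP; split => // om [h1 h2].
  by case: ij; case: (Ev_disj erefl h1 h2).
have -> : ray_prob P X x = pr (\bigcup_t Ev (stk x) t).
  rewrite -[LHS]/(pr [set om | ray X om x]); apply/le_anti/andP; split.
    rewrite -(pr_full measurable_good (measurable_ray x) pr_good).
    apply: pr_le => //; last exact: ray_Ev.
    apply: measurableI; [exact: measurable_ray|exact: measurable_good].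
  apply: pr_le => //; first exact: measurable_ray.
  by move=> om [t _]; exact: Ev_ray.
have := cvg_sum_pr (P := P) mE tE.
by under eq_fun do under eq_bigr do rewrite pr_Ev.
Qed.

Lemma ray_unique om x y : ray X om x -> ray X om y -> height x = height y -> x = y.
Proof.
case=> s [_ hs] [s' [_ hs']] h; apply: stk_inj.
apply: (@incone_eq _ _ (stk (X (maxn s s') om))).
- by rewrite /stk !size_rev.
- by apply/subtree_incone/hs; rewrite leq_maxl.
- by apply/subtree_incone/hs'; rewrite leq_maxr.
Qed.

Lemma ray_vertexE om x k : ray X om x -> height x = k -> ray_vertex X k om = x.
Proof.
move=> rx hx; rewrite /ray_vertex.
apply: xget_unique => // y [ry hy]; apply: ray_unique ry rx _.
by rewrite hy hx.
Qed.

Lemma ray_vertexP om k : ray_vertex X k om = root \/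
  (ray X om (ray_vertex X k om) /\ height (ray_vertex X k om) = k).
Proof.
rewrite /ray_vertex; case: xgetP => [x _ [rx hx]|]; first by right.
by left.
Qed.

Lemma measurable_ray_vertex k x : measurable [set om | ray_vertex X k om = x].
Proof.
have mray : measurable (\bigcup_(y : U)
    (if height y == k then [set om | ray X om y] else set0)).
  apply: countable_bigcupT_measurable; first exact: countableP.
  by move=> y; case: ifP => // _; exact: measurable_ray.
have [xr|xr] := eqVneq x root; last first.
  have [hx|hx] := eqVneq (height x) k.
    rewrite (_ : [set _ | _] = [set om | ray X om x]); first exact: measurable_ray.
    apply/seteqP; split => om /=; last by move=> rx; exact: ray_vertexE.
    move=> e; case: (ray_vertexP om k) => [|[+ _]]; rewrite e // => e2.
    by rewrite e2 eqxx in xr.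
  rewrite (_ : [set _ | _] = set0) //; apply/seteqP; split => // om /= e.
  case: (ray_vertexP om k) => [|[_]]; rewrite e => e2.
    by rewrite e2 eqxx in xr.
  by rewrite e2 eqxx in hx.
rewrite xr; have [k0|k0] := eqVneq k 0%N.
  rewrite (_ : [set _ | _] = setT) //; apply/seteqP; split => // om _ /=.
  case: (ray_vertexP om k) => // -[_]; rewrite k0 => /size0nil e.
  exact: val_inj.
rewrite (_ : [set _ | _] = ~` (\bigcup_(y : U)
    (if height y == k then [set om | ray X om y] else set0))).
  exact: measurableC.
apply/seteqP; split => om /=.
  move=> e [y _]; case: ifP => // /eqP hy /= ry.
  by rewrite (ray_vertexE ry hy) in e; move: k0; rewrite -hy e.
move=> h; case: (ray_vertexP om k) => // -[ry hy]; case: h.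
by exists (ray_vertex X k om) => //; rewrite hy eqxx.
Qed.

Lemma ray_prob_root : ray_prob P X root = 1.
Proof.
apply/le_anti; rewrite (pr_le1 P (measurable_ray root)) /= -(pr_root X_rw).
apply: pr_le; [exact: mX X_rw _ _|exact: measurable_ray|].
move=> om /= e; exists 0%N; split => // t _; apply/subtree_incone.
by apply/inconeP; exists (stk (X t om)); rewrite cats0.
Qed.

Section InProbability.
Variable hW : R.
Hypothesis hW0 : 0 < hW.
Hypothesis W_cvg : cvg_in_probability P
  (fun k om => - (k%:R^-1 * ln (ray_prob P X (ray_vertex X k om)))) hW.

Let far (delta : R) k : set Omega := [set om |
  delta < `|- (k%:R^-1 * ln (ray_prob P X (ray_vertex X k om))) - hW|].

Let m_far delta k : measurable (far delta k).
Proof.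
exact: (measurable_preim (measurable_ray_vertex k) (fun x => delta <
  `|- (k%:R^-1 * ln (ray_prob P X x)) - hW|)).
Qed.

Let cvg_far (delta : R) : 0 < delta -> pr (far delta k) @[k --> \oo] --> 0.
Proof.
move=> d0; have := W_cvg d0.
under eq_fun do rewrite (prE P (m_far delta _)).
by move/fine_cvgP => [].
Qed.

(** Otherwise no vertex but the root would be on the ray with positive probability. Then
    [ray_vertex] would almost surely be its default value, the root, whose [ray_prob] is 1, and the
    averages would vanish instead of converging to [hW > 0]. *)
Lemma exists_transient : exists b, 0 < w b /\ return_prob v b < 1.
Proof.
apply: contrapT => none.
have wq b : w b * q b = 0.
  have := wge0 b; rewrite le_eqVlt => /orP[/eqP<-|wb]; first by rewrite mul0r.
  have : ~~ (return_prob v b < 1) by apply/negP => rb; apply: none; exists b.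
  rewrite -leNgt => rb; have -> : q b = 0; last by rewrite mulr0.
  by apply/le_anti; rewrite q_ge0 /no_return subr_le0 rb.
have ray0 x : x <> root -> pr [set om | ray X om x] = 0.
  move=> xr.
  have sx : stk x <> [::] by move=> e; apply: xr; apply: stk_inj.
  have e0 t : entry (stk x) t = 0.
    rewrite /entry_prob; case: ifP => // _; case: (stk x) sx t => // b l _ [|t] //.
    by rewrite -mulrA wq !mulr0.
  have h := @cvg_entry_ray x.
  have e : (fun n => \sum_(t < n) entry (stk x) t) = fun=> 0.
    by apply/funext => n; rewrite big1.
  rewrite e in h; rewrite -[LHS]/(ray_prob P X x) -(cvg_lim (@Rhausdorff _) h).
  exact: lim_cst.
have half : 0 < hW / 2 by rewrite divr_gt0.
have far1 k : pr (far (hW / 2) k) = 1.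
  have mrv := measurable_ray_vertex k.
  have mN : measurable [set om | ray_vertex X k om <> root].
    exact: (measurable_preim mrv (fun x => x <> root)).
  have N0 : pr [set om | ray_vertex X k om <> root] = 0.
    rewrite -(mul0r (pr setT)).
    apply: (@pr_scale_fibers _ _ _ P _ _ mrv _ _ _ mN measurableT) => x.
    rewrite mul0r; have [->|/eqP xr] := eqVneq (x : U) root.
      by rewrite -[RHS](pr0 P); congr pr; apply/seteqP; split => // om [/= h1 h2].
    apply: (pr_null (measurable_ray x) _ (ray0 x xr)).
      exact: (measurableI _ _ mN (mrv x)).
    move=> om [/= h1 h2]; case: (ray_vertexP om k) => // -[].
    by rewrite h2.
  have C1 : pr (~` [set om | ray_vertex X k om <> root]) = 1.
    by rewrite prC // N0 subr0.
  apply/le_anti; rewrite pr_le1 //= -[leLHS]C1.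
  apply: pr_le => //; first exact: measurableC.
  move=> om /= /contrapT e; rewrite /far /= e ray_prob_root ln1 mulr0 oppr0 sub0r.
  by rewrite normrN gtr0_norm //; lra.
have := cvg_far half; under eq_fun do rewrite far1.
by move/(cvg_lim (@Rhausdorff _)); rewrite lim_cst // => /eqP; rewrite oner_eq0.
Qed.

Hypothesis Dpos : forall tau, 0 < D tau.

Lemma ray_prob_W x : ray_prob P X x = W (stk x).
Proof.
have c1 := @cvg_entry_ray x; have c2 := @cvg_sum_entry _ _ _ Dpos (stk x).
by rewrite -(cvg_lim _ c1) // -(cvg_lim _ c2).
Qed.

Let rayst (l : seq O) : set Omega := [set om | exists2 x, stk x = l & ray X om x].

Let rayst_stk x : rayst (stk x) = [set om | ray X om x].
Proof.
apply/seteqP; split => om /=; first by case=> y /stk_inj ->.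
by move=> rx; exists x.
Qed.

Let rayst_nok l : ~~ okst l -> rayst l = set0.
Proof.
move=> nok; apply/seteqP; split => // om [x e _].
by move: nok; rewrite -e stk_ok.
Qed.

Let m_rayst l : measurable (rayst l).
Proof.
have [/stk_surj[x <-]|/rayst_nok -> //] := boolP (okst l).
by rewrite rayst_stk; exact: measurable_ray.
Qed.

Let pr_rayst l : pr (rayst l) = W l.
Proof.
have [/stk_surj[x <-]|nok] := boolP (okst l).
  by rewrite rayst_stk -ray_prob_W.
rewrite rayst_nok // pr0; apply/esym/eqP; rewrite eq_le W_ge0 andbT leNgt.
by apply: contra nok; exact: W_ok.
Qed.

Lemma W_in_prob (delta : R) : 0 < delta ->
  \sum_(l <- words G k) W l * (delta < `|- (k%:R^-1 * ln (W l)) - hW|)%R%:R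
    @[k --> \oo] --> 0.
Proof.
move=> d0; apply: (@squeeze_cvgr _ _ _ _ (fun=> 0) (fun k => pr (far delta k))).
- near=> k; apply/andP; split.
    by apply: sumr_ge0 => l _; rewrite mulr_ge0 ?W_ge0.
  rewrite (eq_bigr (fun l => if delta < `|- (k%:R^-1 * ln (W l)) - hW| then
    pr (rayst l) else 0)); last first.
    by move=> l _; case: ifP; rewrite ?mulr1 ?mulr0 // pr_rayst.
  rewrite -big_mkcond -big_filter; apply: sum_pr_le => //.
  + by rewrite filter_uniq // words_uniq.
  + move=> l; rewrite mem_filter words_size => /andP[dl /eqP lk] om [x xl rx].
    rewrite /far /= (ray_vertexE rx) ?ray_prob_W ?xl //.
    by rewrite /height -(size_rev (val x)) -/(stk x) xl.
  + move=> l l'; rewrite !mem_filter !words_size => /andP[_ /eqP lk] /andP[_ /eqP lk'].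
    move=> /eqP ll; apply/seteqP; split => // om [[x xl rx] [y yl ry]]; apply: ll.
    rewrite -xl -yl; congr stk; apply: ray_unique rx ry _.
    by rewrite /height -(size_rev (val x)) -(size_rev (val y)) -/(stk x) -/(stk y) xl yl lk lk'.
- exact: cvg_cst.
- exact: cvg_far.
Unshelve. all: by end_near. Qed.

End InProbability.

End Ray.

(** * Concentration of the harmonic measure and of the entrance times *)

Section Concentration.
Variables (R : realType) (G : wmgraph R) (v : vertex G).
Variables (d : measure_display) (Omega : measurableType d).
Variables (P : probability Omega R) (X : nat -> Omega -> ucover v).
Local Notation O := (oedge G).
Local Notation root := (cover_root v).
Local Notation pr := (prob P).
Local Notation W := (ray_weight v).
Local Notation T := (ray_shift v).
Local Notation ptr := (ptr v).
Local Notation entry := (entry_prob v).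
Local Notation words := (words G).
Local Notation Ev := (Ev X).
Local Notation fT := (mean_step v).
Local Notation meantime := (mean_time v).

Hypothesis irr : irreducible (@rw R G).
Hypothesis X_rw : markov_chain (@cover_rw R G v) root P X.
Variables (s hW : R).
Hypotheses (s0 : 0 < s) (hW0 : 0 < hW).
Hypothesis H_cvg :
  cvg_in_probability P (fun t om => (height (X t om))%:R / t%:R) s.
Hypothesis W_cvg : cvg_in_probability P
  (fun k om => - (k%:R^-1 * ln (ray_prob P X (ray_vertex X k om)))) hW.

Lemma escape_pos u : 0 < vertex_escape v u.
Proof. exact: escape_gt0 irr (exists_transient X_rw hW0 W_cvg) u. Qed.

Let Dpos := D_pos escape_pos.

Let W_small := W_in_prob X_rw W_cvg Dpos.

(** A word of weight [w0] at every high level [k] keeps at least probability [w0] on values of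
    [- ln W / k] close to 0, hence away from [hW]. *)
Lemma not_flat : ~ flat_ray v.
Proof.
move=> [w0 w00 [k0 flat]].
have h2 : 0 < hW / 2 by rewrite divr_gt0.
have /cvgr0Pnorm_lt /(_ _ w00) [N _ hN] := W_small h2.
have [bnd hbnd] : exists b, `|ln w0| / (hW / 2) < b%:R.
  by exists (Num.bound (`|ln w0| / (hW / 2))); apply: archi_boundP; rewrite divr_ge0 // ltW.
have [k [kk0 kN kb]] : exists k, [/\ (k0 <= k)%N, (N <= k)%N & (bnd < k)%N].
  by exists (k0 + N + bnd.+1)%N; split; lia.
have [l lk Wl] := flat k kk0.
have := hN k kN; set S := \sum_(_ <- _) _ => Sw.
suff : w0 <= S by move: Sw; rewrite ltr_norml => /andP[_ Sw]; lra.
have lw : l \in words k by rewrite words_size lk.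
rewrite /S (bigD1_seq l) ?words_uniq //= Wl.
apply: (@le_trans _ _ (w0 * 1 + 0)); first by rewrite mulr1 addr0.
apply: lerD; last by apply: sumr_ge0 => l' _; rewrite mulr_ge0 ?W_ge0.
rewrite ler_wpM2l ?(ltW w00) //.
have kpos : 0 < k%:R :> R by rewrite ltr0n; lia.
have bk : `|k%:R^-1 * ln w0| < hW / 2.
  rewrite normrM gtr0_norm ?invr_gt0 // mulrC ltr_pdivrMr // mulrC -ltr_pdivrMr //.
  by apply: lt_le_trans hbnd _; rewrite ler_nat ltnW.
have -> : hW / 2 < `|- (k%:R^-1 * ln w0) - hW|; last by [].
rewrite -normrN opprD !opprK.
have := ler_normB (k%:R^-1 * ln w0 + hW) (k%:R^-1 * ln w0).
rewrite addrAC subrr add0r gtr0_norm //; lra.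
Qed.

Let decay := g_decay irr escape_pos not_flat.

Definition logstep (tau : option O) (b : O) : R := - ln (ptr tau b).

Lemma addf_logstep l : 0 < W l -> addf logstep l = - ln (W l).
Proof.
elim: l => [|b l IH]; first by rewrite /= ln1 oppr0.
move=> /W_cons_gt0[Wl p0]; rewrite W_cons lnM ?posrE // opprD -IH //.
Qed.

Lemma dev_logstep (delta : R) : 0 < delta ->
  iter k T (fun l => (delta * (size l)%:R < `|dev logstep hW l|)%R%:R) [::]
    @[k --> \oo] --> 0.
Proof.
move=> d0; have := W_small d0.
rewrite -(cvg_shiftS (fun k => iter k T _ [::])) /=.
rewrite -(cvg_shiftS (fun k => \sum_(l <- words k) _)) /=.
rewrite (_ : (fun n => \sum_(l <- words n.+1) _) = (fun n => iter n.+1 T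
  (fun l => (delta * (size l)%:R < `|dev logstep hW l|)%R%:R) [::])) //.
apply/funext => k; rewrite iterT_words; apply: eq_big_seq => l.
rewrite words_size => /eqP lk.
have := W_ge0 v l; rewrite le_eqVlt => /orP[/eqP<-|Wl]; first by rewrite !mul0r.
congr (_ * (nat_of_bool _)%:R); rewrite /dev addf_logstep // lk.
have k0 : 0 < k.+1%:R :> R by [].
rewrite -[in RHS]ltr_pdivlMr // -[X in _ = (_ < _ / X)](gtr0_norm k0) -normf_div.
by congr (_ < `|_|); field; rewrite gt_eqF.
Qed.

Lemma W_tail : exists C1 C2 : R, [/\ 0 <= C1, 0 <= C2 &
  forall (lam rr : R) k, 0 <= lam <= 1 ->
    \sum_(l <- words k | W l <= expR (- (hW * k%:R + rr))) W l <=
    C1 * expR (C2 * lam ^+ 2 * k%:R - lam * rr)].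
Proof.
have [C1 [C2 [C10 C20 h]]] := dev_exp Dpos dev_logstep.
exists C1, C2; split => // lam rr k /andP[l0 l1].
have := h lam k; rewrite ger0_norm // => /(_ l1) {}h.
rewrite expRD (mulrA C1) [expR (- (lam * rr))]expRN ler_pdivlMr ?expR_gt0 //.
apply: le_trans h; rewrite iterT_words mulr_suml big_mkcond /=.
rewrite big_seq [leRHS]big_seq; apply: ler_sum => l; rewrite words_size => /eqP lk.
case: ifP => Wle; last by rewrite mulr_ge0 ?W_ge0 ?expR_ge0.
have := W_ge0 v l; rewrite le_eqVlt => /orP[/eqP<-|Wl]; first by rewrite !mul0r.
rewrite ler_wpM2l ?W_ge0 // ler_expR ler_wpM2l // /dev addf_logstep // lk.
have : ln (W l) <= - (hW * k%:R + rr) by rewrite -(expRK (- _)) ler_ln ?posrE ?expR_gt0.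
lra.
Qed.

Lemma ind_le_exp (x : R) (b : bool) : (b -> 0 <= x) -> b%:R <= expR x.
Proof.
case: b => [/(_ isT) x0|_]; last exact: expR_ge0.
by rewrite -(expR0 R) ler_expR.
Qed.

(** A two-sided Chernoff bound from [entry_exp]. The centre [c] is left free: it will be the
    conditional mean [meantime l] in one use and [k / s] in the other. *)
Lemma entry_conc : exists lam0 C : R, [/\ 0 < lam0 <= 1, 0 <= C &
  forall (lam rr c : R) l n, 0 <= lam <= lam0 ->
    \sum_(t < n) entry l t * (rr <= `|t%:R - c|)%R%:R <=
    W l * expR (C * lam ^+ 2 * (size l)%:R - lam * rr) *
      (expR (lam * (meantime l - c)) + expR (- lam * (meantime l - c)))].
Proof.
have [lam0 [C [hl0 C0 h]]] := entry_exp Dpos decay.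
exists lam0, C; split => // lam rr c l n /andP[l0 l1].
have h1 := h lam l n; rewrite ger0_norm // in h1; move/(_ l1) in h1.
have h2 := h (- lam) l n; rewrite normrN ger0_norm // in h2; move/(_ l1) in h2.
apply: (@le_trans _ _ (\sum_(t < n) (entry l t * expR lam ^+ t * expR (- lam * c - lam * rr) +
   entry l t * expR (- lam) ^+ t * expR (lam * c - lam * rr)))).
  apply: ler_sum => t _; rewrite -!mulrA -mulrDr ler_wpM2l ?entry_ge0 //.
  rewrite -!expRM_natl -!expRD.
  have [ct|tc] := leP c t%:R.
    rewrite ger0_norm ?subr_ge0 //; apply: (@le_trans _ _ (expR (t%:R * lam + (- lam * c - lam * rr)))).
      by apply: ind_le_exp => hr; have := ler_wpM2l l0 hr; lra.
    by rewrite lerDl expR_ge0.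
  rewrite ltr0_norm ?subr_lt0 //.
  apply: (@le_trans _ _ (expR (t%:R * - lam + (lam * c - lam * rr)))).
    by apply: ind_le_exp => hr; have := ler_wpM2l l0 hr; lra.
  by rewrite lerDr expR_ge0.
rewrite big_split /= -!mulr_suml.
apply: (@le_trans _ _ (W l * expR (lam * meantime l + C * lam ^+ 2 * (size l)%:R) *
    expR (- lam * c - lam * rr) +
  W l * expR (- lam * meantime l + C * (- lam) ^+ 2 * (size l)%:R) * expR (lam * c - lam * rr))).
  by apply: lerD; rewrite ler_wpM2r ?expR_ge0.
rewrite sqrrN -!mulrA -mulrDr -!expRD [in leRHS]mulrDr -!expRD.
rewrite le_eqVlt; apply/orP; left; apply/eqP; congr (_ * (expR _ + expR _)); ring.
Qed.

Lemma meantime_bound : exists2 B : R, 0 < B & forall l, `|meantime l| <= B * (size l)%:R.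
Proof.
have [B B0 hB] := finite_bound (fun tau : option O => `|fT tau|).
exists (B + 1); first by lra.
elim=> [|b l IH]; first by rewrite /mean_time /= mulr0 normr0.
rewrite meantime_cons (le_trans (ler_normD _ _)) //= -addn1 natrD mulrDr mulr1.
by apply: lerD => //; apply: le_trans (hB (top None l)) _; rewrite lerDl.
Qed.

Let far (delta : R) t : set Omega :=
  [set om | delta < `|(height (X t om))%:R / t%:R - s|].

Let m_far delta t : measurable (far delta t).
Proof. exact: (mXQ X_rw t (fun x => delta < `|(height x)%:R / t%:R - s|)). Qed.

Let cvg_far (delta : R) : 0 < delta -> pr (far delta t) @[t --> \oo] --> 0.
Proof.
move=> d0; have := H_cvg d0.
under eq_fun do rewrite (prE P (m_far delta _)).
by move/fine_cvgP => [].
Qed.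

Lemma heightE x : height x = size (@stk R G v x).
Proof. by rewrite /height /stk size_rev. Qed.

Lemma sum_entry_le_pr k n (Q : seq O -> nat -> bool) (B : set Omega) :
  measurable B ->
  (forall l t om, size l = k -> (t < n)%N -> Q l t -> Ev l t om -> good X om ->
     B om) ->
  \sum_(l <- words k) \sum_(t < n | Q l t) entry l t <= pr B.
Proof.
move=> mB hQ.
pose F (p : seq O * 'I_n) := Ev p.1 p.2 `&` good X.
have mF p : measurable (F p).
  apply: measurableI; first exact: measurable_Ev X_rw _ _.
  exact: measurable_good X_rw.
have FE p : pr (F p) = entry p.1 p.2.
  rewrite (pr_full (measurable_good X_rw) (measurable_Ev X_rw _ _) (pr_good X_rw)).
  exact: pr_Ev X_rw _ _.
rewrite (_ : \sum_(l <- words k) _ = \sum_(p <- [seq (l, t) | l <- words k,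
    t <- enum [pred t : 'I_n | Q l t]]) pr (F p)).
  apply: sum_pr_le => //.
  - apply: allpairs_uniq_dep; first exact: words_uniq.
      by move=> l _; exact: enum_uniq.
    by move=> [l t] [l' t'] _ _ /= [-> ->].
  - move=> p /allpairsPdep[l [t [lk]]]; rewrite mem_enum inE => Qlt -> om [E gd].
    by rewrite words_size in lk; exact: (hQ l t) (eqP lk) (ltn_ord t) Qlt E gd.
  - move=> p p' /allpairsPdep[l [t [lk _ ->]]] /allpairsPdep[l' [t' [lk' _ ->]]] /eqP ne.
    apply/seteqP; split => // om [[E1 _] [E2 _]]; apply: ne.
    rewrite !words_size in lk lk'.
    have [|e1 e2] := Ev_disj _ E1 E2; first by rewrite /= (eqP lk) (eqP lk').
    by congr (_, _) => //; apply: val_inj.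
rewrite big_allpairs_dep; apply: eq_bigr => l _; rewrite big_enum /=.
by apply: eq_bigr => t _; rewrite FE.
Qed.

(* At the time of the last entrance in the cone of a ray vertex of height [k]  *)
(* the walk is at height [k]; comparing with the speed at the times of a grid  *)
(* of mesh [m] shows that this time cannot be far from [k / s].                *)
Lemma grid_bound (delta' : R) k m M (Q : seq O -> nat -> bool) : (0 < m)%N ->
  (forall l t, Q l t -> [/\ (t < M * m)%N &
     forall j (hh : nat), (0 < j <= M)%N -> (t <= j * m <= t + m)%N ->
       (hh <= k + m)%N -> (k <= hh + m)%N ->
       delta' < `|hh%:R / (j * m)%:R - s|]) ->
  \sum_(l <- words k) \sum_(t < M * m | Q l t) entry l t <=
  \sum_(j < M) pr (far delta' (j.+1 * m)).
Proof.
move=> m0 hQ.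
pose B : set Omega := \big[setU/set0]_(j < M) far delta' (j.+1 * m).
have mB : measurable B by apply: bigsetU_measurable => j _.
have prB : pr B <= \sum_(j < M) pr (far delta' (j.+1 * m)).
  rewrite /B; elim: (index_enum _) => [|j r IH]; first by rewrite !big_nil pr0.
  rewrite !big_cons; apply: le_trans (prU_le P (m_far _ _) _) _.
    by apply: bigsetU_measurable.
  by rewrite lerD2l.
apply: le_trans prB; apply: sum_entry_le_pr => // l t om lk _ Qlt [e _ _] gd.
have [tM hj] := hQ _ _ Qlt.
have tm : (t %/ m < M)%N by rewrite ltn_divLR.
rewrite /B (bigD1 (Ordinal tm)) //=; left.
have ht : (t <= (t %/ m).+1 * m <= t + m)%N.
  by have := divn_eq t m; have := ltn_pmod t m0; rewrite mulSn; lia.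
rewrite /far /= heightE; have [] := good_lip t ((t %/ m).+1 * m - t) gd.
rewrite subnKC ?e ?lk; last by case/andP: ht.
by move=> h1 h2; apply: hj => //; move: h1 h2 ht; lia.
Qed.

Lemma sum_supp_le (x : nat -> R) n N : (forall t, 0 <= x t) ->
  (forall t, (N <= t)%N -> x t = 0) -> \sum_(t < n) x t <= \sum_(t < N) x t.
Proof.
move=> x0 xN; have [nN|/ltnW Nn] := leqP n N; first exact: sumn_le.
rewrite -(subnKC Nn) big_split_ord /= [X in _ + X]big1 ?addr0 // => i _.
by rewrite xN // leq_addr.
Qed.

Lemma exists_nat_gt (x : R) : exists n : nat, x < n%:R.
Proof.
exists (Num.bound `|x|); apply: le_lt_trans (ler_norm _) _.
exact: archi_boundP.
Qed.

(** If [meantime l] is far from [k / s], at least half of the mass [W l] sits on entrance times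
    close to [meantime l] ([half]). At such times the walk is at height [k], against the speed [s];
    [grid_bound] makes this improbable. *)
Lemma dev_meantime (delta : R) : 0 < delta ->
  iter k T (fun l => (delta * (size l)%:R <
    `|dev (fun tau _ => fT tau) s^-1 l|)%R%:R) [::] @[k --> \oo] --> 0.
Proof.
move=> d0.
have [lam0 [C [/andP[lam00 lam01] C0 hconc]]] := entry_conc.
have [B B0 hB] := meantime_bound.
(* The mesh and the time window, both about [eta * k], cost [(2 * s + 1) * eta * k], a quarter of
   the gap [s * delta * k]; rounding the mesh costs at most another quarter ([K2]). *)
pose eta := s * delta / (4 * (2 * s + 1)).
have s21 : 0 < 2 * s + 1 by rewrite addr_gt0 // mulr_gt0.
have eta0 : 0 < eta by rewrite divr_gt0 // mulr_gt0.
have etaE : eta * (2 * s + 1) = s * delta / 4.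
  by rewrite /eta; field; rewrite gt_eqF //; lra.
clearbody eta.
pose lam := Num.min lam0 (eta / (2 * (C + 1))).
have C1 : 0 < 2 * (C + 1) by lra.
have lamp : 0 < lam by rewrite lt_min lam00 divr_gt0.
have lam_le0 : lam <= lam0 by rewrite ge_min lexx.
have lam_eta : C * lam <= eta / 2.
  have : lam * (2 * (C + 1)) <= eta by rewrite -ler_pdivlMr // ge_min lexx orbT.
  nra.
clearbody lam.
(* [M] points of mesh at least [eta * k] cover all times up to [(B + eta) * k]. As [M] does not
   depend on [k], the union bound over the grid tends to 0. *)
have [M hM] := exists_nat_gt ((B + eta) / eta).
have M0 : 0 < M%:R :> R by apply: lt_trans hM; rewrite divr_gt0 // addr_gt0.
pose delta' := s * delta / (4 * (M%:R * (eta + 1))).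
have Me : 0 < M%:R * (eta + 1) by rewrite mulr_gt0 //; lra.
have delta'0 : 0 < delta' by rewrite divr_gt0 // mulr_gt0.
apply/cvgr0Pnorm_lt => e e0.
have e1 : 0 < e / (4 * (M%:R + 1)) by rewrite divr_gt0 // mulr_gt0 //; lra.
have /cvgr0Pnorm_lt /(_ _ e1) [N0 _ hN0] := cvg_far delta'0.
have [k1 hk1] := exists_nat_gt (6 / (lam * eta)).
have [k2 hk2] := exists_nat_gt (4 * (s + 1) / (s * delta)).
have [k3 hk3] := exists_nat_gt (N0%:R / eta).
near=> k.
have kk1 : (k1 <= k)%N by near: k; exact: nbhs_infty_ge.
have kk2 : (k2 <= k)%N by near: k; exact: nbhs_infty_ge.
have kk3 : (k3 <= k)%N by near: k; exact: nbhs_infty_ge.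
have kp : (0 < k)%N by near: k; exact: nbhs_infty_gt.
have K1 : 6 <= lam * eta * k%:R.
  rewrite [leRHS]mulrC -ler_pdivrMr ?mulr_gt0 //; apply: le_trans (ltW hk1) _.
  by rewrite ler_nat.
have K2 : 4 * (s + 1) <= s * delta * k%:R.
  rewrite [leRHS]mulrC -ler_pdivrMr ?mulr_gt0 //; apply: le_trans (ltW hk2) _.
  by rewrite ler_nat.
have K3 : N0%:R <= eta * k%:R.
  rewrite [leRHS]mulrC -ler_pdivrMr //; apply: le_trans (ltW hk3) _.
  by rewrite ler_nat.
have kR : 1 <= k%:R :> R by rewrite ler1n.
pose m := (Num.truncn (eta * k%:R)).+1.
have m_ge : eta * k%:R <= m%:R by rewrite /m ltW // truncnS_gt.
have m_le : m%:R <= eta * k%:R + 1.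
  rewrite /m -addn1 natrD lerD2r truncn_le //.
  by rewrite mulr_ge0 // ltW.
pose Q l (t : nat) := [&& size l == k, `|t%:R - meantime l| < eta * k%:R &
  delta * k%:R < `|meantime l - s^-1 * k%:R|].
have grid : \sum_(l <- words k) \sum_(t < M * m | Q l t) entry l t <=
    \sum_(j < M) pr (far delta' (j.+1 * m)).
  apply: grid_bound => // l t /and3P[/eqP lk tS Sk].
  have hS := hB l; rewrite lk in hS.
  have tM : (t < M * m)%N.
    rewrite -(ltr_nat R) natrM.
    have : (B + eta) * k%:R <= M%:R * m%:R.
      apply: (@le_trans _ _ (M%:R * (eta * k%:R))); last by rewrite ler_pM2l.
      rewrite mulrA ler_wpM2r // -ler_pdivrMr //; exact: ltW.
    move: tS hS; rewrite ltr_norml ler_norml => /andP[_ tS] /andP[_ hS].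
    lra.
  split=> // j hh /andP[j0 jM] /andP[tj jt] h1 h2.
  pose y : R := (j * m)%:R.
  have y0 : 0 < y by rewrite /y ltr0n muln_gt0 j0.
  have yM : y <= M%:R * m%:R by rewrite /y -natrM ler_nat leq_mul2r jM orbT.
  have ty : `|t%:R - y| <= m%:R.
    have a1 : t%:R <= y by rewrite ler_nat.
    have a2 : y <= t%:R + m%:R by rewrite -natrD ler_nat.
    by rewrite ler_norml; apply/andP; split; lra.
  have hk : `|hh%:R - k%:R| <= m%:R :> R.
    have a1 : hh%:R <= k%:R + m%:R :> R by rewrite -natrD ler_nat.
    have a2 : k%:R <= hh%:R + m%:R :> R by rewrite -natrD ler_nat.
    by rewrite ler_norml; apply/andP; split; lra.
  have sS : s * delta * k%:R < `|s * meantime l - k%:R|.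
    have -> : s * meantime l - k%:R = s * (meantime l - s^-1 * k%:R).
      by rewrite mulrBr mulrA divff ?mul1r // gt_eqF.
    by rewrite normrM gtr0_norm // -mulrA ltr_pM2l.
  have tri : s * delta * k%:R < `|hh%:R - s * y| + m%:R + s * m%:R + s * (eta * k%:R).
    apply: lt_le_trans sS _.
    have -> : s * meantime l - k%:R = (hh%:R - k%:R) - (hh%:R - s * y) +
      s * (t%:R - y) - s * (t%:R - meantime l) by ring.
    apply: le_trans (ler_normB _ _) _; rewrite normrM (gtr0_norm s0).
    apply: le_trans (lerD (ler_normD _ _) (lexx _)) _.
    rewrite normrM (gtr0_norm s0).
    apply: le_trans (lerD (lerD (ler_normB _ _) (lexx _)) (lexx _)) _.
    have b1 : s * `|t%:R - y| <= s * m%:R by rewrite ler_pM2l.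
    have b2 : s * `|t%:R - meantime l| <= s * (eta * k%:R).
      by rewrite ler_pM2l // ltW.
    lra.
  have key : s * delta * k%:R / 2 <= `|hh%:R - s * y|.
    have : (s + 1) * m%:R <= (s + 1) * (eta * k%:R + 1) by rewrite ler_wpM2l //; lra.
    have : eta * (2 * s + 1) * k%:R = s * delta / 4 * k%:R by rewrite etaE.
    lra.
  rewrite -/y; have -> : hh%:R / y - s = (hh%:R - s * y) / y by rewrite mulrBl mulfK ?gt_eqF.
  rewrite normrM normfV (gtr0_norm y0) ltr_pdivlMr //.
  apply: lt_le_trans key; apply: (@le_lt_trans _ _ (delta' * (M%:R * ((eta + 1) * k%:R)))).
    rewrite ler_wpM2l ?(ltW delta'0) //; apply: le_trans yM _.
    by rewrite ler_pM2l //; lra.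
  have -> : delta' * (M%:R * ((eta + 1) * k%:R)) = s * delta * k%:R / 4.
    by rewrite /delta'; field; rewrite ?gt_eqF //; lra.
  have : 0 < s * delta * k%:R by rewrite !mulr_gt0 // ltr0n.
  lra.
(* Centred at [meantime l], the two exponentials of [entry_conc] equal 1; so at most half of [W l]
   lies outside the window. *)
have ewE : 2 * expR (C * lam ^+ 2 * k%:R - lam * (eta * k%:R)) <= 2^-1.
  have h : expR (C * lam ^+ 2 * k%:R - lam * (eta * k%:R)) <=
      (expR (lam * eta * k%:R / 2))^-1.
    rewrite -expRN ler_expR.
    have : (C * lam) * (lam * k%:R) <= (eta / 2) * (lam * k%:R).
      by rewrite ler_wpM2r // mulr_ge0 // ltW.
    lra.
  have h4 : 4 <= expR (lam * eta * k%:R / 2).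
    by apply: le_trans (expR_ge1Dx _); lra.
  have : (expR (lam * eta * k%:R / 2))^-1 <= 4^-1 by rewrite lef_pV2 ?posrE // expR_gt0.
  lra.
have half l : size l = k -> delta * k%:R < `|meantime l - s^-1 * k%:R| ->
    W l <= 2 * \sum_(t < M * m | Q l t) entry l t.
  move=> lk Sl.
  have bound n : \sum_(t < n) entry l t <=
      \sum_(t < M * m | Q l t) entry l t + W l / 2.
    have -> : \sum_(t < n) entry l t =
        \sum_(t < n) entry l t * (`|t%:R - meantime l| < eta * k%:R)%R%:R +
        \sum_(t < n) entry l t * (eta * k%:R <= `|t%:R - meantime l|)%R%:R.
      rewrite -big_split; apply: eq_bigr => t _ /=; rewrite -mulrDr.
      by rewrite leNgt; case: ltP => _ /=; rewrite ?addr0 ?add0r mulr1.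
    apply: lerD.
      rewrite [leRHS]big_mkcond /=.
      pose x t := if Q l t then entry l t else 0.
      apply: (@le_trans _ _ (\sum_(t < n) x t)).
        apply: ler_sum => t _; rewrite /x /Q lk eqxx Sl andbT /=.
        by case: ifP => _; rewrite ?mulr1 ?mulr0.
      apply: sum_supp_le => [t|t tM]; first by rewrite /x; case: ifP => // _; exact: entry_ge0.
      rewrite /x; case: ifP => // /and3P[_ tS _].
      have hS := hB l; rewrite lk in hS.
      exfalso; move: tM; rewrite leqNgt => /negP; apply.
      rewrite -(ltr_nat R) natrM.
      have : (B + eta) * k%:R <= M%:R * m%:R.
        apply: (@le_trans _ _ (M%:R * (eta * k%:R))); last by rewrite ler_pM2l.
        rewrite mulrA ler_wpM2r // -ler_pdivrMr //; exact: ltW.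
      move: tS hS; rewrite ltr_norml ler_norml => /andP[_ tS] /andP[_ hS].
      lra.
    have := hconc lam (eta * k%:R) (meantime l) l n; rewrite (ltW lamp) lam_le0.
    move=> /(_ isT) h; apply: le_trans h _.
    rewrite subrr !mulr0 expR0 lk -mulrA ler_wpM2l ?W_ge0 //.
    by rewrite -[1 + 1]/(2 : R) mulrC.
  have : W l <= \sum_(t < M * m | Q l t) entry l t + W l / 2.
    by apply: (cvgr_to_le (@cvg_sum_entry _ _ _ Dpos l)); exact: nearW.
  by lra.
rewrite iterT_words ger0_norm; last by apply: sumr_ge0 => l _; rewrite mulr_ge0 ?W_ge0.
apply: (@le_lt_trans _ _ (2 * \sum_(l <- words k) \sum_(t < M * m | Q l t) entry l t)).
  rewrite mulr_sumr big_seq [leRHS]big_seq; apply: ler_sum => l.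
  rewrite words_size => /eqP lk.
  rewrite /dev -/(meantime l) lk; case: ltP => [Sl|_]; first by rewrite mulr1 half.
  by rewrite mulr0 mulr_ge0 // sumr_ge0 // => t _; exact: entry_ge0.
apply: (@le_lt_trans _ _ (2 * \sum_(j < M) e / (4 * (M%:R + 1)))).
  rewrite ler_pM2l //; apply: le_trans grid _; apply: ler_sum => j _.
  have /hN0 /ltW : (N0 <= j.+1 * m)%N.
    rewrite -(ler_nat R) natrM; apply: le_trans K3 _; apply: le_trans m_ge _.
    by rewrite ler_peMl // ler1n.
  by rewrite ger0_norm ?pr_ge0.
rewrite sumr_const card_ord -[_ *+ M]mulr_natr.
have -> : 2 * (e / (4 * (M%:R + 1)) * M%:R) = e * (M%:R / (2 * (M%:R + 1))).
  by field; rewrite gt_eqF //; lra.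
rewrite gtr_pMr // ltr_pdivrMr; lra.
Unshelve. all: by end_near. Qed.

(** Two fluctuations are combined: that of the entrance time around its mean given the ray
    ([entry_conc]), and that of this mean around [k / s] ([dev_exp]). *)
Lemma time_tail : exists lam0 C1 C2 : R, [/\ 0 < lam0 <= 1, 0 <= C1, 0 <= C2 &
  forall (lam rr : R) k n, 0 <= lam <= lam0 ->
    \sum_(l <- words k) \sum_(t < n)
      entry l t * (rr <= `|t%:R - s^-1 * k%:R|)%R%:R <=
    C1 * expR (C2 * lam ^+ 2 * k%:R - lam * rr)].
Proof.
have [lam0 [C [hl0 C0 hconc]]] := entry_conc.
have [D1 [D2 [D10 D20 hdev]]] := dev_exp Dpos dev_meantime.
exists lam0, (2 * D1), (C + D2); split; rewrite ?mulr_ge0 ?addr_ge0 //.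
move=> lam rr k n /andP[l0 l1].
have lam1 : `|lam| <= 1 by rewrite ger0_norm //; case/andP: hl0 => _; exact: le_trans.
have h1 := hdev lam k lam1; have h2 := hdev (- lam) k.
rewrite normrN sqrrN in h2; move/(_ lam1) in h2.
rewrite !iterT_words in h1 h2.
pose E := expR (C * lam ^+ 2 * k%:R - lam * rr).
apply: (@le_trans _ _ (E * (\sum_(l <- words k) W l * expR (lam * dev (fun tau _ => fT tau) s^-1 l) +
   \sum_(l <- words k) W l * expR (- lam * dev (fun tau _ => fT tau) s^-1 l)))).
  rewrite -big_split mulr_sumr big_seq [leRHS]big_seq; apply: ler_sum => l.
  rewrite words_size => /eqP lk.
  have := hconc lam rr (s^-1 * k%:R) l n; rewrite l0 l1 => /(_ isT) h.
  by apply: le_trans h _; rewrite lk -/E /dev lk [W l * E]mulrC -mulrA (mulrDr (W l)).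
apply: (@le_trans _ _ (E * (D1 * expR (D2 * lam ^+ 2 * k%:R) + D1 * expR (D2 * lam ^+ 2 * k%:R)))).
  by rewrite ler_wpM2l ?expR_ge0 // lerD.
have -> : (C + D2) * lam ^+ 2 * k%:R - lam * rr =
  (C * lam ^+ 2 * k%:R - lam * rr) + D2 * lam ^+ 2 * k%:R by ring.
rewrite expRD -/E le_eqVlt; apply/orP; left; apply/eqP; ring.
Qed.

End Concentration.

(** * Confinement of the walk on the tree to few vertices *)

Section ShortWords.
Variable O : finType.

Fixpoint short (m : nat) : seq (seq O) :=
  if m is m'.+1 then [::] :: [seq b :: l | l <- short m', b <- enum O]
  else [:: [::]].

Lemma mem_short m l : (size l <= m)%N -> l \in short m.
Proof.
elim: m l => [|m IH] [|b l] //=; rewrite ltnS => lm.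
rewrite inE /=; apply/allpairsP; exists (l, b) => /=.
by split=> //; [exact: IH|rewrite mem_enum].
Qed.

Lemma size_short m : (size (short m) <= #|O|.+1 ^ m)%N.
Proof.
elim: m => //= m IH; rewrite size_allpairs -cardE expnS mulSn.
by rewrite -add1n leq_add ?expn_gt0 // mulnC leq_mul2l IH orbT.
Qed.

End ShortWords.

Lemma exp_decay_le (R : realType) (C c a e : R) : 0 <= C -> 0 < a -> 0 < e ->
  exists2 A1 : R, 0 <= A1 & forall A, A1 <= A -> C * expR (c - a * A) <= e.
Proof.
move=> C0 a0 e0.
have Cc : 0 <= C * expR c by rewrite mulr_ge0 ?expR_ge0.
exists (C * expR c / (a * e)); first by rewrite divr_ge0 // mulr_ge0 ?ltW.
move=> A hA; rewrite expRD expRN mulrA ler_pdivrMr ?expR_gt0 //.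
have h : C * expR c <= e * (a * A).
  by move: hA; rewrite ler_pdivrMr ?mulr_gt0 //; lra.
apply: le_trans h _; rewrite ler_pM2l //.
by have := expR_ge1Dx (a * A); lra.
Qed.

Section Spread.
Variables (R : realType) (G : wmgraph R) (v : vertex G).
Variables (d : measure_display) (Omega : measurableType d).
Variables (P : probability Omega R) (X : nat -> Omega -> ucover v).
Local Notation O := (oedge G).
Local Notation pr := (prob P).
Local Notation W := (ray_weight v).
Local Notation entry := (entry_prob v).
Local Notation words := (words G).

Hypothesis irr : irreducible (@rw R G).
Hypothesis X_rw : markov_chain (@cover_rw R G v) (cover_root v) P X.
Variables (s hW : R).
Hypotheses (s0 : 0 < s) (hW0 : 0 < hW).
Hypothesis H_cvg :
  cvg_in_probability P (fun t om => (height (X t om))%:R / t%:R) s.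
Hypothesis W_cvg : cvg_in_probability P
  (fun k om => - (k%:R^-1 * ln (ray_prob P X (ray_vertex X k om)))) hW.

Let Dpos : forall tau, 0 < green_inv v tau := D_pos (escape_pos irr X_rw hW0 W_cvg).

Lemma count_heavy (th : R) k : 0 < th ->
  (size [seq l <- words k | th < W l])%:R <= th^-1.
Proof.
move=> th0; rewrite -[leRHS]mul1r ler_pdivlMr //.
have -> : (size [seq l <- words k | th < W l])%:R * th =
    \sum_(l <- [seq l <- words k | th < W l]) th.
  by rewrite big_const_seq count_predT iter_addr_0 mulr_natl.
rewrite -(sum_W Dpos k) big_filter [leLHS]big_mkcond /=.
by apply: ler_sum => l _; case: ltP => [/ltW //|_]; exact: W_ge0.
Qed.

(* Take the last entrance at the level [k] close to [s (t - A0 sqrt t)]: it    *)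
(* occurs during the [m] steps before [t], with [m] of order [sqrt t], at a    *)
(* vertex [l] with [W l > th], and there are at most [th^-1] such vertices.    *)
Lemma spread (delta : R) : 0 < delta -> exists2 A : R, 0 <= A &
  forall t : nat, exists2 B : seq (seq O),
    (size B)%:R <= expR (s * hW * t%:R + A * Num.sqrt t.+1%:R) &
    1 - delta <= pr [set om | stk (X t om) \in B].
Proof.
move=> d0; have d2 : 0 < delta / 2 by rewrite divr_gt0.
have [C1 [C2 [C10 C20 hWt]]] := W_tail irr X_rw hW0 W_cvg.
have [lam0 [D1 [D2 [/andP[lam00 lam01] D10 D20 hTt]]]] := time_tail irr X_rw s0 hW0 H_cvg W_cvg.
have [A1 A10 hA1] := exp_decay_le (C2 * s) C10 ltr01 d2.
have [A2 A20 hA2] := exp_decay_le (D2 * lam0 ^+ 2 * s) D10 lam00 d2.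
pose A0 := Num.max A1 A2.
have A0A1 : A1 <= A0 by rewrite le_max lexx.
have A0A2 : A2 <= A0 by rewrite le_max lexx orbT.
have A00 : 0 <= A0 by exact: le_trans A10 A0A1.
clearbody A0.
pose lnN : R := ln (#|{: O}|.+1)%:R.
have N1 : 1 <= (#|{: O}|.+1)%:R :> R by rewrite ler1n.
have lnN0 : 0 <= lnN by exact: ln_ge0.
have si0 : 0 < s^-1 by rewrite invr_gt0.
exists (A0 + (2 * A0 + s^-1 + 1) * lnN).
  by rewrite addr_ge0 // mulr_ge0 // !addr_ge0 // ?mulr_ge0 // ltW.
move=> t; pose sg : R := Num.sqrt t.+1%:R.
have sg2 : sg ^+ 2 = t%:R + 1 by rewrite sqr_sqrtr // -natr1.
have t0 : 0 <= t%:R :> R by [].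
have sg1 : 1 <= sg by rewrite -[1](sqrtr1 R) ler_wsqrtr // ler1n.
rewrite -/sg; clearbody sg.
pose rr := A0 * sg.
have rr0 : 0 <= rr by rewrite mulr_ge0 //; lra.
(* For small [t] the target time is truncated at 0; then [k = 0] and the only last entrance is that
   of the root, at time 0. *)
pose u := Num.max 0 (t%:R - rr).
have u0 : 0 <= u by rewrite le_max lexx.
have ut : u <= t%:R by rewrite ge_max t0 lerBlDr lerDl.
have u_ge : t%:R - rr <= u by rewrite le_max lexx orbT.
have u_max : u = t%:R - rr \/ u = 0 by rewrite /u; case: (leP 0 (t%:R - rr)); [left|right].
pose k := Num.truncn (s * u).
have k_le : k%:R <= s * u by rewrite truncn_le // mulr_ge0 // ltW.
have k_gt : s * u < k%:R + 1 by rewrite natr1 truncnS_gt.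
have k0u : u = 0 -> k = 0%N.
  by move=> u00; rewrite /k u00 mulr0 truncn0.
clearbody k.
have kst : k%:R <= s * sg ^+ 2.
  by apply: le_trans k_le _; rewrite ler_pM2l // sg2; lra.
have ks : s^-1 * k%:R <= u by rewrite mulrC ler_pdivrMr // mulrC.
have ks' : u - s^-1 < s^-1 * k%:R.
  by rewrite -(ltr_pM2l s0) mulrBr mulrA !divff ?gt_eqF // mul1r; lra.
clearbody u.
pose th := expR (- (hW * k%:R + rr)).
have th0 : 0 < th by exact: expR_gt0.
(* The time [k / s] exceeds [t - rr - s^-1], so an entrance within [rr] of it happens less than
   [2 * rr + s^-1] before [t]. *)
pose m := (Num.truncn (2 * rr + s^-1)).+1.
have m_gt : 2 * rr + s^-1 < m%:R by rewrite /m truncnS_gt.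
have m_le : m%:R <= 2 * rr + s^-1 + 1.
  rewrite /m -addn1 natrD lerD2r truncn_le // addr_ge0 ?(ltW si0) //.
  by rewrite pmulr_rge0.
clearbody m.
exists [seq s' ++ l | l <- [seq l <- words k | th < W l], s' <- short {: O} m].
  rewrite size_allpairs natrM.
  apply: (@le_trans _ _ (th^-1 * expR (m%:R * lnN))).
    apply: ler_pM => //; first exact: count_heavy.
    rewrite expRM_natl lnK ?posrE; last by apply: lt_le_trans N1.
    by rewrite -natrX ler_nat size_short.
  rewrite /th -expRN opprK -expRD ler_expR.
  have e1 : hW * k%:R <= s * hW * t%:R.
    rewrite mulrC -mulrA [hW * _]mulrC mulrA ler_pM2r //.
    by apply: le_trans k_le _; rewrite ler_pM2l.
  have e2 : m%:R * lnN <= (2 * A0 + s^-1 + 1) * sg * lnN.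
    rewrite ler_wpM2r //; apply: le_trans m_le _; rewrite /rr.
    have : (s^-1 + 1) * 1 <= (s^-1 + 1) * sg by rewrite ler_wpM2l //; lra.
    lra.
  move: e1 e2; rewrite /rr; lra.
pose Q l (T : nat) := (th < W l) && (`|T%:R - s^-1 * k%:R| < rr).
set Bset := [set om | _].
have mB : measurable Bset by exact: (mXQ X_rw t (fun x => stk x \in _)).
have main n : \sum_(l <- words k) \sum_(T < n) entry l T <= pr Bset + delta.
  apply: (@le_trans _ _ (\sum_(l <- words k) \sum_(T < n | Q l T) entry l T +
    (\sum_(l <- words k) \sum_(T < n) entry l T * (rr <= `|T%:R - s^-1 * k%:R|)%R%:R +
     \sum_(l <- words k | W l <= th) W l))).
    rewrite [X in _ + (_ + X)]big_mkcond /= -!big_split /=; apply: ler_sum => l _.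
    have [tW|Wt] := ltP th (W l).
      rewrite addr0 [X in X + _]big_mkcond -big_split /=; apply: ler_sum => T _.
      by rewrite /Q tW /=; case: ltP => _ /=; rewrite ?mulr1 ?mulr0 ?add0r ?addr0.
    apply: le_trans (sum_entry_le Dpos n l) _.
    have h1 : 0 <= \sum_(T < n | Q l T) entry l T.
      by apply: sumr_ge0 => T _; exact: entry_ge0.
    have h2 : 0 <= \sum_(T < n) entry l T * (rr <= `|T%:R - s^-1 * k%:R|)%R%:R.
      by apply: sumr_ge0 => T _; rewrite mulr_ge0 ?entry_ge0.
    lra.
  apply: lerD.
    apply: (sum_entry_le_pr X_rw) => // l T om lk _ /andP[tW TS] E gd.
    have [e hc hT] := E.
    move: TS; rewrite ltr_norml => /andP[TS1 TS2].
    have Tt : (T <= t)%N.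
      have [uE|uE] := u_max.
        rewrite -(ler_nat R); lra.
      have l0 : l = [::] by apply: size0nil; rewrite lk k0u.
      by case: T hT {E e hc TS1 TS2} => // T' []; rewrite l0.
    have tT : (t <= T + m)%N.
      rewrite -(ler_nat R) natrD; lra.
    have /inconeP[s' es] := hc t Tt.
    rewrite /Bset /= es; apply/allpairsP; exists (l, s') => /=; split => //.
      by rewrite mem_filter tW words_size lk eqxx.
    apply: mem_short; have [+ _] := good_lip T (t - T) gd.
    rewrite subnKC // e es size_cat addnC leq_add2l => h.
    by apply: leq_trans h _; rewrite leq_subLR.
  have -> : delta = delta / 2 + delta / 2 by lra.
  have sg0 : 0 < sg by lra.
  apply: lerD.
    (* With [lam] of order [1 / sg] the quadratic term [lam ^+ 2 * k] stays bounded, whereas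
       [lam * rr] is proportional to [A0]. *)
    have lam_le : 0 <= lam0 / sg <= lam0.
      rewrite divr_ge0 ?(ltW lam00) ?(ltW sg0) //= ler_pdivrMr // ler_peMr //.
      exact: ltW.
    apply: le_trans (hTt _ rr k n lam_le) _.
    apply: le_trans (hA2 _ A0A2); rewrite ler_wpM2l // ler_expR.
    have -> : lam0 / sg * rr = lam0 * A0 by rewrite /rr; field; rewrite gt_eqF.
    rewrite lerD2r.
    have -> : D2 * (lam0 / sg) ^+ 2 * k%:R = D2 * lam0 ^+ 2 * (k%:R / sg ^+ 2).
      by field; rewrite gt_eqF.
    apply: ler_wpM2l; first by rewrite mulr_ge0 // sqr_ge0.
    by rewrite ler_pdivrMr // exprn_gt0.
  have lam_le : 0 <= sg^-1 <= 1 by rewrite invr_ge0 (ltW sg0) /= invf_le1.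
  apply: le_trans (hWt _ rr k lam_le) _.
  apply: le_trans (hA1 _ A0A1); rewrite ler_wpM2l // ler_expR mul1r.
  have -> : sg^-1 * rr = A0 by rewrite /rr; field; rewrite gt_eqF.
  rewrite lerD2r.
  have -> : C2 * sg^-1 ^+ 2 * k%:R = C2 * (k%:R / sg ^+ 2) by field; rewrite gt_eqF.
  by rewrite ler_wpM2l // ler_pdivrMr // exprn_gt0.
have cv : \sum_(l <- words k) \sum_(T < n) entry l T @[n --> \oo] --> (1 : R).
  rewrite -[X in _ --> X](sum_W Dpos k).
  by apply: cvg_rsum => l _; exact: cvg_sum_entry.
have : 1 <= pr Bset + delta by apply: (cvgr_to_le cv); exact: nearW.
by lra.
Qed.

End Spread.

(** * Projection onto the lifts *)

Section GraphWalk.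
Variables (R : realType) (H : wmgraph R).
Local Notation K := (kernel_pow (@rw R H)).

Lemma sum_rw y (F : vertex H -> R) : \sum_z rw y z * F z =
  2^-1 * F y + 2^-1 * \sum_(a : oedge H | src a == y) weight a * F (tgt a).
Proof.
rewrite (eq_bigr (fun z => 2^-1 * ((y == z)%:R * F z) + 2^-1 *
   \sum_(a : oedge H | src a == y) weight a * ((tgt a == z)%:R * F z))); last first.
  move=> z _; rewrite /rw /lazy_kernel mulrDl -!mulrA mulr_suml.
  congr (_ + _ * _); rewrite [RHS]big_mkcond [LHS]big_mkcond /=.
  apply: eq_bigr => a _.
  by case: (_ == _) => //=; case: (_ == z); rewrite ?mul1r // mul0r mulr0.
have pick z0 : \sum_z (z0 == z)%:R * F z = F z0.
  rewrite (bigD1 z0) //= eqxx mul1r big1 ?addr0 // => z.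
  by rewrite eq_sym => /negbTE ->; rewrite mul0r.
rewrite big_split /= -!mulr_sumr pick exchange_big /=; congr (_ + _ * _).
by apply: eq_bigr => a _; rewrite -mulr_sumr pick.
Qed.

Lemma sum_rw1 y : \sum_z @rw R H y z = 1.
Proof.
under eq_bigr do rewrite -[rw _ _]mulr1.
rewrite (sum_rw y (fun=> 1)); under eq_bigr do rewrite mulr1.
by rewrite sum_out; lra.
Qed.

Lemma sum_kernel_pow t y : \sum_z K t y z = 1.
Proof.
elim: t y => [|t IH] y /=.
  rewrite (bigD1 y) //= eqxx big1 ?addr0 // => z.
  by rewrite eq_sym => /negbTE ->.
rewrite exchange_big /= -[RHS](sum_rw1 y); apply: eq_bigr => z _.
by rewrite -mulr_sumr IH mulr1.
Qed.

Lemma kernel_pow_add s t x y :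
  K (s + t) x y = \sum_z K s x z * K t z y.
Proof.
elim: s x => [|s IH] x /=.
  rewrite (bigD1 x) //= eqxx mul1r big1 ?addr0 // => z.
  by rewrite eq_sym => /negbTE ->; rewrite mul0r.
under eq_bigr do rewrite IH mulr_sumr.
rewrite exchange_big /=; apply: eq_bigr => z _; rewrite mulr_suml.
by apply: eq_bigr => z' _; rewrite mulrA.
Qed.

Lemma kernel_pow_set_le1 t y (S : {set vertex H}) : \sum_(z in S) K t y z <= 1.
Proof.
rewrite -(sum_kernel_pow t y) [leRHS](bigID (mem S)) /= lerDl.
by apply: sumr_ge0 => z _; exact: kernel_pow_rw_ge0.
Qed.

End GraphWalk.

Lemma dTV_set (R : realType) (T : finType) (mu nu : T -> R) (S : {set T}) :
  \sum_(x in S) mu x - \sum_(x in S) nu x <= dTV mu nu.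
Proof.
apply: le_trans (ler_norm _) _; rewrite /dTV.
exact: (@le_bigmax _ _ _ 0 (fun A : {set T} =>
  `|\sum_(x in A) mu x - \sum_(x in A) nu x|) S).
Qed.

Section LiftWalk.
Variables (R : realType) (G : wmgraph R) (v : vertex G) (n : nat).
Variable sigma : edge G -> {perm 'I_n}.
Local Notation O := (oedge G).
Local Notation Gn := (lift_graph sigma).
Local Notation K := (kernel_pow (@rw R Gn)).

Definition sheet (a : O) (i : 'I_n) : 'I_n :=
  if a.2 then sigma a.1 i else ((sigma a.1)^-1)%g i.

Lemma sheet_oinv a i : sheet (oinv a) (sheet a i) = i.
Proof. by case: a => e []; rewrite /sheet /= ?permK ?permKV. Qed.

Lemma sum_out_lift u i (F : vertex Gn -> R) :
  \sum_(a : oedge Gn | src a == (u, i)) weight a * F (tgt a) =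
  \sum_(a : O | src a == u) weight a * F (tgt a, sheet a i).
Proof.
pose f (a : O) : oedge Gn :=
  ((a.1, if a.2 then i else (sigma a.1)^-1%g i), a.2).
pose g (a : oedge Gn) : O := (a.1.1, a.2).
rewrite (reindex_onto f g) /=; last first.
  move=> [[e j] []]; rewrite /src /osrc /f /g /=.
    by move=> /eqP[_ ->].
  by move=> /eqP[_ <-]; rewrite permK.
apply: eq_big => [[e []]|[e b] _].
- by rewrite /src /osrc /f /g /= xpair_eqE !eqxx !andbT.
- by rewrite /src /osrc /f /g /= xpair_eqE permKV !eqxx !andbT.
- congr (_ * F _); rewrite /tgt /otgt /f /sheet /=.
  by case: b.
Qed.

Lemma kernel_pow_lift m u i y : K m.+1 (u, i) y = 2^-1 * K m (u, i) y +
  2^-1 * \sum_(a : O | src a == u) weight a * K m (tgt a, sheet a i) y.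
Proof.
exact: etrans (sum_rw (H := Gn) ((u, i) : vertex Gn) (fun z => K m z y))
  (congr1 (fun z => _ + 2^-1 * z) (sum_out_lift u i (fun z => K m z y))).
Qed.

Section Projection.
Variable i0 : 'I_n.

Fixpoint label (l : seq O) : 'I_n :=
  if l is a :: l' then sheet a (label l') else i0.

(* The image of a vertex of the tree under the covering map onto the lift      *)
(* that sends the root to [(v, i0)]. *)
Definition proj (l : seq O) : vertex Gn := (endv v l, label l).

Lemma label_move l a : okst v l -> src a = endv v l ->
  proj (move_st l a) = (tgt a, sheet a (label l)).
Proof.
case: l => [|c l] okl sa //; rewrite /move_st; case: eqVneq => [->|_] //.
by rewrite /proj (endv_pop okl) tgt_oinv /= sheet_oinv.
Qed.

Variables (d : measure_display) (Omega : measurableType d).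
Variables (P : probability Omega R) (X : nat -> Omega -> ucover v).
Hypothesis X_rw : markov_chain (@cover_rw R G v) (cover_root v) P X.

(** By [label_move], a step of the tree along [a] projects to the step of the lift along the
    corresponding lift of [a]; so both sides satisfy the same backward equation. *)
Lemma pr_proj t y :
  prob P [set om | proj (stk (X t om)) = y] = K t (v, i0) y.
Proof.
have h := @markov_future _ _ _ _ _ _ _ X_rw
  (fun m t => [set om | proj (stk (X (t + m)%N om)) = y])
  (fun m x => K m (proj (stk x)) y) predT.
have := h _ _ _ _ _ t 0%N setT (cover_root v).
rewrite setTI (pr_root X_rw) mul1r => <- //.
- rewrite setIC pr_full //; [exact: mX X_rw _ _| |exact: pr_root X_rw].
  exact: (mXQ X_rw t (fun x => proj (stk x) = y)).
- by move=> m t'; exact: (mXQ X_rw _ (fun x => proj (stk x) = y)).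
- move=> t' x A mA; rewrite [kernel_pow _ _ _ _]/=; case: eqVneq => [xy|xy].
    rewrite mulr1; congr (prob P _); apply/seteqP; split => [w' []|w' [Aw /= xw]] //.
    by split => //=; rewrite addn0 xw.
  rewrite mulr0 -[RHS](pr0 P); congr (prob P _); apply/seteqP; split => // w' [[_ /= e]].
  by rewrite addn0 e => e'; rewrite e' eqxx in xy.
- by move=> m t' w' _ /=; rewrite addSnnS.
- move=> m x; rewrite kernel_pow_lift /stepU; congr (_ + _ * _).
  apply: eq_bigr => a /eqP sa.
  by rewrite stk_move // label_move // stk_ok.
Qed.

Lemma pr_proj_set t (S : {set vertex Gn}) (B : seq (seq O)) :
  (forall l, l \in B -> proj l \in S) ->
  prob P [set om | stk (X t om) \in B] <= \sum_(y in S) K t (v, i0) y.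
Proof.
move=> BS.
have mQ (Q : set (ucover v)) : measurable [set om | Q (X t om)] := mXQ X_rw t Q.
apply: (@le_trans _ _ (prob P [set om | proj (stk (X t om)) \in S])).
  apply: pr_le => [||om /=]; last exact: BS.
    exact: (mQ (fun x => stk x \in B)).
  exact: (mQ (fun x => proj (stk x) \in S)).
have mf z : measurable [set om | proj (stk (X t om)) = z].
  exact: (mQ (fun x => proj (stk x) = z)).
have mS := mQ (fun x => proj (stk x) \in S).
rewrite (pr_split_fibers P mf mS (enum_uniq (mem S))).
rewrite [X in _ + X](_ : _ = 0) ?addr0; last first.
  rewrite -[RHS](pr0 P); congr (prob P _); apply/seteqP; split => // om [/= h1].
  by rewrite mem_enum h1.
rewrite big_enum /=; apply: ler_sum => y _; rewrite -pr_proj.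
by apply: pr_le => //; exact: measurableI.
Qed.

End Projection.

End LiftWalk.

(** A path of positive probability from [x] to [u] lifts backwards from [(u, i)], which determines
    [j]; the weights along it depend neither on [n] nor on the permutations, whence the uniform
    [p0]. *)
Lemma lift_backward (R : realType) (G : wmgraph R) t (x u : vertex G) :
  0 < kernel_pow (@rw R G) t x u -> exists2 p0 : R, 0 < p0 &
  forall n (sigma : edge G -> {perm 'I_n}) i, exists j,
    p0 <= kernel_pow (@rw R (lift_graph sigma)) t (x, j) (u, i).
Proof.
elim: t x => [|t IH] x.
  rewrite /=; case: eqVneq => [->|_]; last by rewrite ltxx.
  by move=> _; exists 1 => // n sigma i; exists i; rewrite eqxx.
case/kernel_pow_gt0 => z [xz /IH[p0 p00 hp]].
have K0 n (sigma : edge G -> {perm 'I_n}) y z' :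
    0 <= kernel_pow (@rw R (lift_graph sigma)) t y z' by exact: kernel_pow_rw_ge0.
have [->|[a [ax az wa]]] := rw_step (lt0r_neq0 xz).
  exists (2^-1 * p0); first by rewrite mulr_gt0 // invr_gt0.
  move=> n sigma i; have [j hj] := hp n sigma i; exists j.
  rewrite kernel_pow_lift ler_wpDr //; last by rewrite ler_wpM2l ?invr_ge0.
  by rewrite mulr_ge0 ?invr_ge0 //; apply: sumr_ge0 => a _; rewrite mulr_ge0 ?wge0 ?K0.
exists (2^-1 * (weight a * p0)); first by rewrite !mulr_gt0 // invr_gt0.
move=> n sigma i; have [j hj] := hp n sigma i; exists (sheet sigma (oinv a) j).
rewrite kernel_pow_lift ler_wpDl //; first by rewrite mulr_ge0 ?invr_ge0 ?K0.
rewrite ler_wpM2l ?invr_ge0 // (bigD1 a) ?ax //= ler_wpDr //.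
  by apply: sumr_ge0 => b _; rewrite mulr_ge0 ?wge0 ?K0.
have := sheet_oinv sigma (oinv a) j; rewrite oinvK => ->.
by rewrite az ler_wpM2l ?wge0.
Qed.

(** For [n] above [e] one has [ln n >= 1], so every constant loss, including [T0] and [ln rho], is
    paid by a multiple of the square root of [ln n]. *)
Lemma expR_deadline (R : realType) (h A T0 rho : R) :
  0 < h -> 0 <= A -> 0 <= T0 -> 0 < rho ->
  exists (K : R) (n0 : nat), 0 <= K /\ forall n t m : nat, (n0 <= n)%N ->
    t%:R < h^-1 * ln (n%:R : R) - K * Num.sqrt (ln (n%:R : R)) ->
    m%:R <= T0 + t%:R ->
    (0 < n)%N /\ expR (h * m%:R + A * Num.sqrt m.+1%:R) <= rho * n%:R.
Proof.
move=> h0 A0 T00 rho0.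
have hV0 : 0 < h^-1 by rewrite invr_gt0.
(* Before the deadline [m + 1 <= T0 + 1 + h^-1 * ln n], which is at most [c ^+ 2 * ln n]. *)
pose c := Num.sqrt (T0 + 1 + h^-1).
have c0 : 0 <= c := sqrtr_ge0 _.
pose K := h^-1 * (A * c + h * T0 + `|ln rho|).
have Ac0 : 0 <= A * c := mulr_ge0 A0 c0.
have hT0 : 0 <= h * T0 := mulr_ge0 (ltW h0) T00.
have rn0 : 0 <= `|ln rho| := normr_ge0 _.
have K0 : 0 <= K by rewrite mulr_ge0 ?(ltW hV0) //; lra.
have [n0 hn0] := exists_nat_gt (expR 1 : R).
exists K, n0; split => // n t m nn0 + hm.
have en : expR 1 <= n%:R :> R.
  by apply: le_trans (ltW hn0) _; rewrite ler_nat.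
have n_gt0 : 0 < n%:R :> R := lt_le_trans (expR_gt0 1) en.
have L1 : 1 <= ln (n%:R : R) by rewrite -ler_expR lnK.
have eL : expR (ln (n%:R : R)) = n%:R by rewrite lnK.
move: (ln n%:R) L1 eL => L L1 eL ht.
have [sL1 sL2] : 1 <= Num.sqrt L /\ Num.sqrt L * Num.sqrt L = L.
  by split; [rewrite -[leLHS]sqrtr1 ler_wsqrtr|rewrite -expr2 sqr_sqrtr //; lra].
move: (Num.sqrt L) sL1 sL2 ht => q q1 q2 ht.
split; first by rewrite -(ltr_nat R).
have KE : h * K = A * c + h * T0 + `|ln rho| by rewrite /K mulrA divff ?mul1r ?gt_eqF.
have Kq : 0 <= K * q by rewrite mulr_ge0 //; lra.
have htL : h * t%:R <= L - h * K * q.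
  have := ltW ht; rewrite -(ler_pM2l h0) mulrBr mulrA divff ?gt_eqF // mul1r.
  by rewrite mulrA.
have hmL : h * m%:R <= h * T0 + h * t%:R by rewrite -mulrDr ler_pM2l.
have sm : Num.sqrt m.+1%:R <= c * q.
  have cq : 0 <= c * q by rewrite mulr_ge0 //; lra.
  rewrite -[leRHS]ger0_norm // -sqrtr_sqr ler_wsqrtr // exprMn sqr_sqrtr; last by lra.
  rewrite expr2 q2 -addn1 natrD.
  have tL : t%:R <= h^-1 * L by lra.
  have : 0 <= (T0 + 1) * (L - 1) by rewrite mulr_ge0 //; lra.
  rewrite mulrDl mulrBr mulr1; lra.
have Asm : A * Num.sqrt m.+1%:R <= A * c * q by rewrite -mulrA ler_wpM2l.
rewrite -eL -[rho](@lnK R) ?posrE // -expRD ler_expR.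
have lr : - ln rho <= `|ln rho| by rewrite -normrN ler_norm.
have e1 : 0 <= (h * T0 + `|ln rho|) * (q - 1) by rewrite mulr_ge0 //; lra.
rewrite KE in htL.
have e2 : (A * c + h * T0 + `|ln rho|) * q =
  A * c * q + (h * T0 + `|ln rho|) * (q - 1) + (h * T0 + `|ln rho|) by ring.
rewrite e2 in htL.
lra.
Qed.

(** * Lower bound for the mixing times of the lifts *)

Lemma le_tmix_min (R : realType) (T : finType) (p : T -> T -> R) (pi : T -> R)
    (eps l : R) :
  (forall t x, dTV (kernel_pow p t x) pi <= eps -> l <= t%:R) ->
  (l%:E <= tmix_min p pi eps)%E.
Proof.
move=> H; rewrite /tmix_min; elim/big_rec: _ => [|x y _ ly]; first exact: leey.
rewrite le_min ly andbT; apply: le_ereal_inf_tmp => _ [t /= ht <-].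
by rewrite lee_fin; exact: H ht.
Qed.

Section Mixing.
Variables (R : realType) (G : wmgraph R) (v : vertex G) (n : nat).
Variable sigma : edge G -> {perm 'I_n}.
Local Notation O := (oedge G).
Local Notation Gn := (lift_graph sigma).
Local Notation K := (kernel_pow (@rw R Gn)).
Variables (pi : vertex G -> R) (pi_inv : invariant_prob (@rw R G) pi).
Variables (d : measure_display) (Omega : measurableType d).
Variables (P : probability Omega R) (X : nat -> Omega -> ucover v).
Hypothesis X_rw : markov_chain (@cover_rw R G v) (cover_root v) P X.

Lemma lift_prob_le (S : {set vertex Gn}) :
  \sum_(y in S) @lift_prob R G n sigma pi y <= #|S|%:R / n%:R.
Proof.
have [pi0 pi1 _] := pi_inv.
rewrite -mulr_suml ler_wpM2r ?invr_ge0 //.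
rewrite -sum1_card natr_sum; apply: ler_sum => y _.
by rewrite -pi1 (bigD1 y.1) //= lerDl sumr_ge0.
Qed.

(* Started from [(v, j)] the walk passes through [(u, i)] at time [t0] with    *)
(* probability at least [p0], so that confining it at time [t0 + t] confines   *)
(* with large probability the walk started from [(u, i)] at time [t].          *)
Lemma mixed_not_confined (t0 t : nat) u i j (B : seq (seq O)) (p0 eps delta : R) :
  0 <= p0 -> p0 <= K t0 (v, j) (u, i) ->
  1 - delta <= prob P [set om | stk (X (t0 + t)%N om) \in B] ->
  dTV (K t (u, i)) (@lift_prob R G n sigma pi) <= eps ->
  p0 * (1 - eps - (size B)%:R / n%:R) <= delta.
Proof.
move=> p00 hp hB hmix.
pose S : {set vertex Gn} := [set y in map (proj v sigma j) B].
have SB : #|S|%:R / n%:R <= (size B)%:R / n%:R :> R.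
  rewrite ler_wpM2r ?invr_ge0 // ler_nat cardsE.
  by rewrite -(size_map (proj v sigma j)); exact: card_size.
have conf : 1 - delta <= \sum_(y in S) K (t0 + t) (v, j) y.
  apply: le_trans hB _; apply: (pr_proj_set (sigma := sigma) X_rw) => l lB.
  by rewrite inE map_f.
pose a := \sum_(y in S) K t (u, i) y.
have aS : a <= (size B)%:R / n%:R + eps.
  have := le_trans (dTV_set (K t (u, i)) (@lift_prob R G n sigma pi) S) hmix.
  have := le_trans (lift_prob_le S) SB; rewrite -/a; lra.
have a1 : a <= 1 by exact: kernel_pow_set_le1.
set q0 := K t0 (v, j) (u, i) in hp.
have split1 : \sum_(y in S) K (t0 + t) (v, j) y <= q0 * a + (1 - q0).
  under eq_bigr do rewrite kernel_pow_add.
  rewrite exchange_big /= (bigD1 ((u, i) : vertex Gn)) //= -mulr_sumr lerD //.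
  rewrite -(sum_kernel_pow t0 ((v, j) : vertex Gn)).
  rewrite [X in _ <= X - _](bigD1 ((u, i) : vertex Gn)) //= addrAC subrr add0r.
  apply: ler_sum => z _; rewrite -mulr_sumr.
  rewrite -[leRHS]mulr1; apply: ler_wpM2l; [exact: (@kernel_pow_rw_ge0 R Gn)|].
  exact: (@kernel_pow_set_le1 R Gn).
have h1 : p0 * (1 - a) <= q0 * (1 - a) by rewrite ler_wpM2r //; lra.
have h2 : p0 * (1 - eps - (size B)%:R / n%:R) <= p0 * (1 - a).
  by rewrite ler_wpM2l //; lra.
apply: le_trans h2 (le_trans h1 _).
have -> : q0 * (1 - a) = q0 - q0 * a by ring.
lra.
Qed.

End Mixing.

Theorem proposition2 (R : realType) (G : wmgraph R)
  (A1 : irreducible (@rw R G))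
  (A2 : two_cycles G)
  (pi : vertex G -> R) (pi_inv : invariant_prob (@rw R G) pi)
  (vstar : vertex G)
  (d : measure_display) (Omega : measurableType d) (P : probability Omega R)
  (X : nat -> Omega -> ucover vstar)
  (X_rw : markov_chain (@cover_rw R G vstar) (cover_root vstar) P X)
  (h : R) (h_entropy : is_entropy P X h)
  (sigma : forall n : nat, edge G -> {perm 'I_n})
  (eps : R) (eps_gt0 : 0 < eps) (eps_lt1 : eps < 1) :
  exists (K : R) (n0 : nat), 0 <= K /\
    forall n : nat, (n0 <= n)%N ->
      ((h^-1 * ln (n%:R : R) - K * Num.sqrt (ln (n%:R : R)))%:E <=
       tmix_min (@rw R (lift_graph (sigma n))) (@lift_prob R G n (sigma n) pi)
         eps)%E.
Proof.
have [s [hW [s0 hW0 speed decay hE]]] := h_entropy.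
have h0 : 0 < h by rewrite hE mulr_gt0.
(* One time and one probability for each vertex of [G]; finiteness of [G] then gives the common
   bounds [T0] and [p0] for all lifts. *)
have /boolp.choice[tm htm] : forall u, exists tp : nat * R, 0 < tp.2 /\
    forall n (sg : edge G -> {perm 'I_n}) i, exists j,
      tp.2 <= kernel_pow (@rw R (lift_graph sg)) tp.1 (vstar, j) (u, i).
  move=> u; have [t /lift_backward[p p_gt0 hp]] := A1 vstar u.
  by exists (t, p).
have [T0 T00 hT0] := finite_bound (fun u => ((tm u).1)%:R : R).
have [C C0 hC] := finite_bound (fun u => (tm u).2^-1).
pose p0 := (C + 1)^-1.
have p00 : 0 < p0 by rewrite invr_gt0; lra.
have p0tm u : p0 <= (tm u).2.
  have [tu _] := htm u.
  rewrite -[leRHS]invrK lef_pV2 ?posrE ?invr_gt0 //; last by lra.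
  by have := hC u; lra.
pose rho := (1 - eps) / 2.
have rho0 : 0 < rho by rewrite /rho; lra.
(* As [1 - eps - rho = rho], mixing before the deadline would give [p0 * rho <= delta] by
   [mixed_not_confined]; half of [p0 * rho] is therefore a contradictory [delta]. *)
have delta0 : 0 < p0 * rho / 2 by rewrite divr_gt0 // mulr_gt0.
have [A A0 hA] := spread A1 X_rw s0 hW0 speed decay delta0.
have [K [n0 [K0 hK]]] := expR_deadline h0 A0 T00 rho0.
exists K, n0; split => // n nn0; apply: le_tmix_min => t [u i] hmix.
rewrite leNgt; apply/negP => ht.
have [tu /(_ n (sigma n) i)[j hj]] := htm u.
have [B sB hB] := hA ((tm u).1 + t)%N.
have hm : ((tm u).1 + t)%:R <= T0 + t%:R :> R by rewrite natrD lerD2r.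
have [n_gt0 hE2] := hK n t _ nn0 ht hm.
have nR0 : 0 < n%:R :> R by rewrite ltr0n.
have sBn : (size B)%:R / n%:R <= rho.
  by rewrite ler_pdivrMr //; apply: le_trans hE2; rewrite hE.
have := mixed_not_confined pi_inv X_rw (ltW p00) (le_trans (p0tm u) hj) hB hmix.
have : p0 * rho <= p0 * (1 - eps - (size B)%:R / n%:R).
  by rewrite ler_wpM2l ?(ltW p00) //; rewrite /rho in sBn *; lra.
lra.
Qed.
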